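(* Let $X, X_1, X_2,\ldots$ be i.i.d. real random variables with distribution $F$ and mean $\mu$, let $\psi(\theta)=\log E[e^{\theta X}]$ and $\mathcal D=\{\theta:\psi(\theta)<\infty\}$. Let $b>\mu$ and $\gamma=bn$. Suppose either $F$ is lattice with span $h$ and $0<P(X=b)<1$, or $F$ is non-lattice. Suppose $0\in\mathcal D^\circ$ and there is a unique $\theta^*\in\mathcal D^\circ$ with $\psi'(\theta^* )=b$. Let $u=u(n)$ be such that there exists $\theta'>0$ with $\theta^*+\theta'\in\mathcal D^\circ$ and $\lim_{n\to\infty}ne^{-\theta' u}=0$. Then in the non-lattice case $$\lim_{n\to\infty}\theta^*\sqrt{2\pi n\psi''(\theta^* )}e^{\theta^* nb-n\psi(\theta^* )}\tilde p(F)=\lim_{n\to\infty}\theta^*\sqrt{2\pi n\psi''(\theta^* )}e^{\theta^* nb-n\psi(\theta^* )}\tilde p(\tilde F_u)=1,$$ and in the lattice case $$\lim_{n\to\infty}\theta^*\sqrt{2\pi n\psi''(\theta^* )}e^{\theta^* nb-n\psi(\theta^* )}\tilde p(F)=\lim_{n\to\infty}\theta^*\sqrt{2\pi n\psi''(\theta^* )}e^{\theta^* nb-n\psi(\theta^* )}\tilde p(\tilde F_u)=\frac{\theta^* h}{1-e^{-\theta^* h}}.$$ Moreover, in both cases $\tilde p(\tilde F_u)-\tilde p(F)=o(\tilde p(F))$ as $n\to\infty$.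
   Context: $S_n=X_1+\cdots+X_n$. For a distribution $G$, $\tilde p(G)=P_G(S_n\ge\gamma)$ is the probability that $S_n\ge\gamma$ when $X_1,\ldots,X_n$ are i.i.d. with law $G$. The truncated distribution $\tilde F_u$ is $\tilde F_u(x)=F(x)/F(u)$ for $x\le u$ and $1$ for $x>u$. $\mathcal D^\circ$ is the interior of $\mathcal D$. $F$ is lattice if $(X-x_0)/h$ is a.s. an integer for some $x_0$ and $h>0$; the span is the largest such $h$. *)

(* Defs.v *)
From HB Require Import structures.
From mathcomp Require Import all_boot all_order all_algebra.
From mathcomp Require Import all_classical all_reals all_analysis.
Set Implicit Arguments. Unset Strict Implicit. Unset Printing Implicit Defensive.
Import Order.TTheory GRing.Theory Num.Theory.
Import numFieldNormedType.Exports.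
Local Open Scope classical_set_scope.
Local Open Scope ring_scope.

Section Defs.
Context {R : realType}.

Definition lattice_set (x0 h : R) : set R := [set x | (x - x0) / h \is a Num.int].

Definition is_lattice (F : probability R R) : Prop :=
  exists x0 h : R, 0 < h /\ F (lattice_set x0 h) = 1%E.

Definition is_span (F : probability R R) (h : R) : Prop :=
  [/\ 0 < h, (exists x0 : R, F (lattice_set x0 h) = 1%E) &
      forall x0' h' : R, 0 < h' -> F (lattice_set x0' h') = 1%E -> h' <= h].

Definition mgf (F : probability R R) (theta : R) : \bar R :=
  (\int[F]_x (expR (theta * x))%:E)%E.

Definition dom_psi (F : probability R R) : set R :=
  [set theta | (mgf F theta < +oo)%E].

(* psi(theta) = log E[e^{theta X}] (meaningful on dom_psi) *)
Definition psi (F : probability R R) (theta : R) : R := ln (fine (mgf F theta)).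

Definition mean (F : probability R R) : R := fine (\int[F]_x x%:E)%E.

Fixpoint iter_int (G : {measure set R -> \bar R}) (n : nat) (f : R -> \bar R)
    (s : R) : \bar R :=
  match n with
  | 0%N => f s
  | n'.+1 => (\int[G]_x iter_int G n' f (s + x))%E
  end.

(* ptilde(G) = P_G(S_n >= gamma), X_1..X_n i.i.d. with law G, computed as the
   integral of the indicator of {x1+...+xn >= gamma} against G^{(x) n}. *)
Definition ptilde (G : {measure set R -> \bar R}) (n : nat) (gamma : R) : R :=
  fine (iter_int G n (fun s => (if gamma <= s then 1 else 0)%:E) 0).

Lemma trunc_scale_ge0 (F : probability R R) (u : R) :
  0 <= (fine (F [set` `]-oo, u]]))^-1.
Proof. by rewrite invr_ge0 fine_ge0 // measure_ge0. Qed.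

Definition trunc (F : probability R R) (u : R) : {measure set R -> \bar R} :=
  mscale (NngNum (trunc_scale_ge0 F u))
    (mrestr F (measurable_itv `]-oo, u])).

End Defs.

(* Main.v *)
Require Import Defs.
From HB Require Import structures.
From mathcomp Require Import all_boot all_order all_algebra.
From mathcomp Require Import all_classical all_reals all_analysis.
From mathcomp Require Import measurable_realfun ring lra.
Set Implicit Arguments. Unset Strict Implicit. Unset Printing Implicit Defensive.
Import Order.TTheory GRing.Theory Num.Theory.
Import numFieldNormedType.Exports.
Local Open Scope classical_set_scope.
Local Open Scope ring_scope.

(**
  Let [Q] be the law of [X - b] under the exponentially tilted measure
  [e^(theta* x - psi(theta* )) F(dx)]: it is centred, with variance
  [s2 = psi''(theta* )] and moments of all orders, and
  [ptilde F n (b n) = e^(n psi(theta* ) - theta* n b) E[e^(-theta* T); 0 <= T]]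
  where [T] is the sum of [n] independent variables of law [Q].

  If [k] is the Fourier transform of a function supported in [[-A, A]], then
  [E[k(T - z)]] is an integral over [[-A, A]] of the [n]-th power of the
  characteristic function of [Q], and a Taylor expansion at 0 together with
  [|E[e^(itX)]| < 1] away from 0 gives its equivalent, of order [1 / sqrt n], as
  well as a bound uniform in [z].  In the non-lattice case the Fejer kernel, of
  which [A] is at our disposal, is convolved with the function
  [e^(-theta* x) 1_(0 <= x)], which varies by a bounded factor over short
  windows; in the lattice case, where [A = pi / h], the transform of the
  indicator of [[-A, A]] vanishes at the nonzero multiples of [h] and so gives
  [P(T = k h)] exactly, whence a geometric series.

  For the truncation: imposing [X_i <= u] on each of the [n] steps changes the
  tilted expectation by at most
  [n * sup_z E[e^(-theta* (T' - z)); z <= T'] * Q(]u - b, oo[)], [T'] having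
  [n - 1] steps.  The supremum is [O(1 / sqrt n)] and the last factor is
  [O(e^(-theta' u))] by Markov's inequality, so this is [o(1 / sqrt n)], and
  [F(u)^n] tends to 1.
*)

(** [exp_tail], the function [e^(-th x) 1_(0 <= x)], jumps at 0 and its Fourier transform is not
    integrable, while the characteristic function of a non-lattice law may come back arbitrarily
    close to modulus 1 at infinity. Hence Fourier inversion is only applied to test functions with
    compactly supported transform, and no decay of the characteristic function is ever used. The
    price is a smoothing error, and since the target is of order [1 / sqrt n], this error must be
    small times [1 / sqrt n]. This forces two rounds: a crude smoothing of fixed bandwidth gives
    [exp_tail_sup_bound], uniform in the position; the sharp smoothing multiplies that bound by the
    small mass of the Fejer kernel away from 0. The same bound controls the truncation and the
    remainder of the geometric series in the lattice case. Positivity of the Fejer kernel makes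
    every comparison a one-sided inequality, and its exact mass [2 pi], which the limit constant
    requires, comes from Abel summation. *)

(** * Restriction, density and reflection of measures *)

Lemma ge0_integral_mrestr d (T : measurableType d) (R : realType)
    (m : {measure set T -> \bar R}) (D : set T) (mD : measurable D)
    (f : T -> \bar R) :
  measurable_fun setT f -> (forall x, 0 <= f x)%E ->
  (\int[(mrestr m mD : {measure set T -> \bar R})]_x f x = \int[m]_(x in D) f x)%E.
Proof.
move=> mf f0.
rewrite -(setUv D) ge0_integral_setU//=; last 3 first.
  exact: measurableC.
  by rewrite setUv.
  by rewrite disj_set2E setICr.
rewrite [X in (_ + X)%E](_ : _ = 0%E) ?adde0; last first.
  rewrite -[RHS](@integral_abs_eq0 _ _ _ (mrestr m mD) (~` D) f).
  - by apply: eq_integral => x _; rewrite gee0_abs.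
  - exact: measurableC.
  - exact: measurable_funS mf.
  - by rewrite /= /mrestr setICl measure0.
by apply: eq_measure_integral => A mA AD; rewrite /= /mrestr setIidl.
Qed.

(** [mnormalize] turns a bare measure into an element of the type [probability]. At mass one it
    rescales by 1; the Dirac mass is only its fallback for degenerate mass. *)
Lemma probability_of_measure (R : realType) (m : {measure set R -> \bar R}) :
  m setT = 1%E ->
  exists Q : probability R R,
    forall f : R -> \bar R, (\int[Q]_x f x = \int[m]_x f x)%E.
Proof.
move=> m1; exists (mnormalize m (dirac (0 : R))) => f.
apply: eq_measure_integral => A mA _ /=.
by rewrite /mnormalize m1 onee_eq0/= invr1 mule1.
Qed.

Section density.
Context (R : realType) (F : probability R R).
Local Notation mu := (@lebesgue_measure R).

Lemma density_probability (w phi : R -> R) :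
  measurable_fun setT w -> (forall x, 0 <= w x) ->
  measurable_fun setT phi -> (\int[F]_x (w x)%:E = 1)%E ->
  exists Q : probability R R, forall f : R -> \bar R,
    measurable_fun setT f -> (forall x, 0 <= f x)%E ->
    (\int[Q]_x f x = \int[F]_x (f (phi x) * (w x)%:E))%E.
Proof.
move=> mw w0 mphi intw.
(* [Q] is the image of [F x Lebesgue], restricted to the subgraph of [w]. *)
pose E : set (R * measurableTypeR R) := [set z | 0 <= z.2 <= w z.1].
have mE : measurable E.
  rewrite (_ : E = (fun z => z.2) @^-1` `[0, +oo[ `&`
     (fun z => w z.1 - z.2) @^-1` `[0, +oo[).
    apply: measurableI; rewrite -[X in measurable X]setTI.
      have m2 : measurable_fun setT (fun z : R * measurableTypeR R => z.2 : R) by exact: measurable_snd.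
      exact: (m2 measurableT _ (measurable_itv _)).
    have mm : measurable_fun setT (fun z : R * measurableTypeR R => w z.1 - z.2).
      by apply: measurable_funB => //; apply: measurableT_comp.
    exact: (mm measurableT _ (measurable_itv _)).
  apply/seteqP; split => z; rewrite /E /= !in_itv/= !andbT subr_ge0.
    by move=> /andP[].
  by move=> [-> ->].
pose m0 : {measure set (R * measurableTypeR R) -> \bar R} := mrestr (F \x mu)%E mE.
have mp : measurable_fun setT (fun z : R * measurableTypeR R => phi z.1).
  exact: measurableT_comp.
pose nu := pushforward m0 (fun z : R * measurableTypeR R => phi z.1).
have main (f : R -> \bar R) : measurable_fun setT f -> (forall x, 0 <= f x)%E ->
    (\int[nu]_x f x = \int[F]_x (f (phi x) * (w x)%:E))%E.
  move=> mf f0.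
  rewrite ge0_integral_pushforward//=.
  rewrite preimage_setT.
  rewrite ge0_integral_mrestr//=; last exact: measurableT_comp.
  rewrite integral_mkcond fubini_tonelli1//=; last 2 first.
    apply/(measurable_restrictT _ mE); apply: measurable_funS (_ : measurable_fun setT _) => //.
    by apply: measurableT_comp.
    by move=> z; rewrite patchE; case: ifP.
  apply: eq_integral => x _; rewrite /fubini_F.
  (* The slice of the subgraph above [x] is [[0, w x]], of length [w x]: this is how the density
     appears. *)
  transitivity (\int[mu]_(y in `[0%R, w x]) (cst (f (phi x)) y))%E.
    rewrite [RHS]integral_mkcond; apply: eq_integral => y _.
    rewrite !patchE/= (_ : ((x, y) \in E) = (y \in `[0, w x]%classic))//.
  by rewrite integral_cst//= lebesgue_measure_itv/= lte_fin sube0;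
     have := w0 x; rewrite le_eqVlt => /predU1P[<-|->]//; rewrite ltxx.
have nu1 : nu setT = 1%E.
  rewrite -[LHS]mul1e -integral_cst//= main//.
  by under eq_integral do rewrite mul1e.
have [Q QE] := probability_of_measure nu1.
by exists Q => f mf f0; rewrite QE main.
Qed.
End density.

(** By uniqueness of Lebesgue measure it is enough to test half-open intervals, which the reflection
    maps to intervals of the same length. It serves to swap the two factors of a convolution. *)
Lemma lebesgue_measure_subr_l (R : realType) (c : R) (A : set R) :
  measurable A -> pushforward (@lebesgue_measure R) (fun x : R => c - x : measurableTypeR R) A
   = lebesgue_measure A.
Proof.
move=> mA; apply/esym.
have mc : measurable_fun setT (fun x : measurableTypeR R => c - x : measurableTypeR R).
  exact: measurable_funB.
apply: (@lebesgue_measure_unique _ (pushforward (@lebesgue_measure R) (fun x : R => c - x : measurableTypeR R))) => //= _ [[a b]] _ <-.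
rewrite /pushforward (_ : _ @^-1` _ = `[c - b, c - a[%classic).
  rewrite !lebesgue_measure_itv/= !lte_fin ltrD2l ltrN2.
  by case: ifPn => // _; rewrite -!EFinB; congr _%:E; ring.
by apply/seteqP; split=> x; rewrite /= !in_itv/=; lra.
Qed.

Lemma ge0_integral_subr_l (R : realType) (c : R) (f : R -> \bar R) :
  measurable_fun setT f -> (forall x, 0 <= f x)%E ->
  (\int[@lebesgue_measure R]_x f (c - x)%R = \int[@lebesgue_measure R]_x f x)%E.
Proof.
move=> mf f0.
have mc : measurable_fun setT (fun x : measurableTypeR R => c - x : measurableTypeR R).
  exact: measurable_funB.
transitivity (\int[pushforward (@lebesgue_measure R) (fun x : R => (c - x)%R : measurableTypeR R)]_x f x)%E.
  by rewrite ge0_integral_pushforward//=.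
by apply: eq_measure_integral => A mA _; exact: lebesgue_measure_subr_l.
Qed.

(** * Iterated integrals *)

Section iter_on.
Context (R : realType).
Local Open Scope ereal_scope.

(** The iteration of [iter_int] with every step confined to [D]. Full and truncated laws become the
    cases [setT] and []-oo, u]] of one operator and can be compared step by step. *)
Fixpoint iter_on (D : set R) (G : {measure set R -> \bar R}) n
    (f : R -> \bar R) (s : R) : \bar R :=
  if n is n'.+1 then \int[G]_(x in D) iter_on D G n' f (s + x)%R else f s.

Lemma iter_int_iter_on (G : {measure set R -> \bar R}) n f s :
  iter_int G n f s = iter_on setT G n f s.
Proof. by elim: n s => //= n IH s; apply: eq_integral => x _; rewrite IH. Qed.

Lemma measurable_integral_shift (P : probability R R) (D : set R)
    (f : R -> \bar R) : measurable D -> measurable_fun setT f ->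
  (forall x, 0 <= f x) ->
  measurable_fun setT (fun s : R => \int[P]_(x in D) f (s + x)%R).
Proof.
move=> mD mf f0.
pose g := (fun z : R * R => f (z.1 + z.2)%R) \_ [set z : R * R | D z.2].
have mD2 : measurable [set z : R * R | D z.2].
  rewrite -[X in measurable X]setTI.
  by apply: (@measurable_snd _ _ R R measurableT D).
have mg : measurable_fun setT g.
  apply/(measurable_restrictT _ mD2).
  apply: (measurable_funS measurableT) => //.
  by apply: measurableT_comp => //; exact: measurable_funD.
rewrite (_ : (fun _ => _) = fubini_F P g).
  by apply: measurable_fun_fubini_tonelli_F => // z; rewrite /g patchE; case: ifP.
apply/funext => s; rewrite /fubini_F [LHS]integral_mkcond; apply: eq_integral => x _.
by rewrite /g !patchE; congr (if _ then _ else _).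
Qed.

Variable P : probability R R.

Lemma iter_on_ge0 D n f s : (forall x, 0 <= f x) -> 0 <= iter_on D P n f s.
Proof.
by move=> f0; elim: n s => //= n IH s; apply: integral_ge0 => x _; exact: IH.
Qed.

Lemma measurable_iter_on D n f : measurable D -> measurable_fun setT f ->
  (forall x, 0 <= f x) -> measurable_fun setT (iter_on D P n f).
Proof.
move=> mD mf f0; elim: n => //= n IH.
by apply: measurable_integral_shift => // x; exact: iter_on_ge0.
Qed.

Lemma measurable_shift (f : R -> \bar R) (s : R) : measurable_fun setT f ->
  measurable_fun setT (fun x : R => f (s + x)%R).
Proof. by move=> mf; apply: measurableT_comp => //; exact: measurable_funD. Qed.

Lemma ge0_integral_setC_split D (g : R -> \bar R) : measurable D ->
  measurable_fun setT g -> (forall x, 0 <= g x) ->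
  \int[P]_x g x = \int[P]_(x in D) g x + \int[P]_(x in ~` D) g x.
Proof.
move=> mD mg g0; rewrite -{1}(setUv D) ge0_integral_setU//=.
- exact: measurableC.
- exact: (measurable_funS measurableT).
- by rewrite disj_set2E setICr.
Qed.

(* The remainder of replacing [T^n] by its truncation to [D], written
   additively; [T] commutes with the integral over [~` D] by Tonelli. *)
Lemma iter_on_trunc_le D n f s : measurable D -> measurable_fun setT f ->
  (forall x, 0 <= f x) ->
  iter_on setT P n.+1 f s <= iter_on D P n.+1 f s +
     n.+1%:R%:E * \int[P]_(x in ~` D) iter_on setT P n f (s + x)%R.
Proof.
move=> mD mf f0.
have mDC : measurable (~` D) by exact: measurableC.
elim: n s => [|n IH] s.
  by rewrite mul1e /= (ge0_integral_setC_split mD)//; exact: measurable_shift.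
have -> : iter_on setT P n.+2 f s =
   \int[P]_x iter_on setT P n.+1 f (s + x)%R by [].
have -> : iter_on D P n.+2 f s =
   \int[P]_(x in D) iter_on D P n.+1 f (s + x)%R by [].
have TE x : iter_on setT P n.+1 f x =
   \int[P]_y iter_on setT P n f (x + y)%R by [].
have mT1 : measurable_fun setT (iter_on setT P n f) by exact: measurable_iter_on.
have T10 x : 0 <= iter_on setT P n f x by exact: iter_on_ge0.
have mT : measurable_fun setT (iter_on setT P n.+1 f) by exact: measurable_iter_on.
have T0 x : 0 <= iter_on setT P n.+1 f x by exact: iter_on_ge0.
have mV : measurable_fun setT (iter_on D P n.+1 f) by exact: measurable_iter_on.
have V0 x : 0 <= iter_on D P n.+1 f x by exact: iter_on_ge0.
move: IH TE mT T0 mV V0; move: (iter_on setT P n.+1 f) (iter_on D P n.+1 f).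
move: (iter_on setT P n f) mT1 T10 => T1 mT1 T10 T V IH TE mT T0 mV V0.
rewrite (ge0_integral_setC_split mD)//; last exact: measurable_shift.
have -> : n.+2%:R%:E * \int[P]_(x in ~` D) T (s + x)%R =
   n.+1%:R%:E * \int[P]_(x in ~` D) T (s + x)%R + \int[P]_(x in ~` D) T (s + x)%R.
  by rewrite -[in LHS]natr1 EFinD ge0_muleDl ?mul1e.
(* Of the [n + 2] copies of the remainder, one pays for a first step outside [D]; the others come
   from the induction hypothesis after a first step inside [D]. *)
rewrite [leRHS]addeA; apply: leeD2r.
pose Rm x := \int[P]_(y in ~` D) T1 (x + y)%R.
have mRm : measurable_fun setT Rm by exact: measurable_integral_shift.
have Rm0 x : 0 <= Rm x by exact: integral_ge0.
have mshD (g : R -> \bar R) : measurable_fun setT g -> measurable_fun D (fun x : R => g (s + x)%R).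
  by move=> mg; apply: (measurable_funS measurableT) => //; exact: measurable_shift.
apply: (@le_trans _ _ (\int[P]_(x in D) (V (s + x)%R + n.+1%:R%:E * Rm (s + x)%R))).
  apply: ge0_le_integral => //; first exact: mshD.
    apply: (mshD (fun x => V x + n.+1%:R%:E * Rm x)).
    by apply: emeasurable_funD => //; exact: measurable_funeM.
rewrite ge0_integralD//; last 3 first.
- exact: mshD.
- by move=> x _; rewrite mule_ge0.
- by apply: measurable_funeM; exact: mshD.
rewrite leeD2l// ge0_integralZl//; last exact: mshD.
apply: lee_wpmul2l; first by rewrite lee_fin.
(* With [D] enlarged to the whole line, a free step precedes the step outside [D]; Tonelli moves it
   after, where it joins the [n] other free steps. *)
apply: (@le_trans _ _ (\int[P]_x Rm (s + x)%R)).
  by apply: ge0_subset_integral => //; exact: measurable_shift.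
rewrite le_eqVlt; apply/orP; left; apply/eqP.
pose g := (fun z : R * R => T1 (s + z.1 + z.2)%R) \_ [set z : R * R | (~` D) z.2].
have mD2 : measurable [set z : R * R | (~` D) z.2].
  rewrite -[X in measurable X]setTI.
  by apply: (@measurable_snd _ _ R R measurableT (~` D)).
have mg : measurable_fun setT g.
  apply/(measurable_restrictT _ mD2).
  apply: (measurable_funS measurableT) => //.
  apply: measurableT_comp => //; apply: measurable_funD => //.
  exact: measurable_funD.
have g0 z : 0 <= g z by rewrite /g patchE; case: ifP.
transitivity (\int[P]_x \int[P]_y g (x, y)).
  apply: eq_integral => x _; rewrite /Rm integral_mkcond; apply: eq_integral => y _.
  by rewrite /g !patchE; congr (if _ then _ else _).
rewrite (fubini_tonelli g)// [RHS]integral_mkcond; apply: eq_integral => y _.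
rewrite patchE /g; case: ifPn => yD.
  rewrite TE; apply: eq_integral => x _; rewrite patchE ifT; last by rewrite inE in yD; rewrite inE.
  by rewrite addrAC.
apply: integral0_eq => x _; rewrite patchE ifF//.
by apply/negbTE; apply: contra yD; rewrite !inE.
Qed.

(** The law of the sum, built by repeated convolution. A single probability on the line gives access
    to integrability and to Fubini against Lebesgue measure. *)
Lemma iter_on_law n : exists L : probability R R, forall (f : R -> \bar R) (s : R),
  measurable_fun setT f -> (forall x, 0 <= f x) ->
  iter_on setT P n f s = \int[L]_y f (s + y)%R.
Proof.
elim: n => [|n [L IH]].
  exists (dirac (0%R : R)) => f s mf f0.
  by rewrite integral_dirac//= ?diracT ?mul1e ?addr0//; exact: measurable_shift.
have ms : measurable_fun setT (fun z : R * R => (z.1 + z.2)%R) by exact: measurable_funD.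
pose nu := pushforward (P \x L) (fun z : R * R => (z.1 + z.2)%R).
have main (f : R -> \bar R) : measurable_fun setT f -> (forall x, 0 <= f x) ->
    \int[nu]_x f x = \int[P]_x \int[L]_y f (x + y)%R.
  move=> mf f0.
  rewrite ge0_integral_pushforward//= preimage_setT fubini_tonelli1//=.
  exact: measurableT_comp.
have nu1 : nu setT = 1.
  rewrite -[LHS]mul1e -integral_cst//= main//.
  rewrite (eq_integral (cst 1)) ?integral_cst//= ?probability_setT ?mule1//.
have [Q QE] := probability_of_measure nu1.
exists Q => f s mf f0; rewrite QE main//=; last exact: measurable_shift.
apply: eq_integral => x _; rewrite IH//; apply: eq_integral => y _.
by rewrite addrA.
Qed.

End iter_on.

(** * Characteristic functions *)

Section trig_bounds.
Context (R : realType).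
Implicit Types (x y : R) (f : R -> R).

(** The mean value theorem. Iterating it climbs one Taylor order at a time for sine and cosine; the
    factorials are dropped, since only the orders matter later. *)
Lemma norm_le_of_derive y f (f' : R -> R) k :
  (forall x, is_derive x 1 f (f' x)) -> f 0 = 0 ->
  (forall x, `|f' x| <= `|x| ^+ k) -> `|f y| <= `|y| ^+ k.+1.
Proof.
move=> df f0 bf.
have cf x : {for x, continuous f}.
  by apply: differentiable_continuous; apply/derivable1_diffP; have [] := df x.
have [y0|y0|->] := ltgtP y 0; last by rewrite f0 normr0 expr0n.
- have [c] := MVT y0 (fun x _ => df x) (continuous_subspaceT cf).
  rewrite in_itv/= f0 sub0r sub0r => /andP[yc c0] /(congr1 Num.norm).
  rewrite !normrN normrM normrN => ->; rewrite exprSr ler_wpM2r//.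
  by rewrite (le_trans (bf c))// lerXn2r ?nnegrE// ltr0_norm// ltr0_norm// lerN2 ltW.
- have [c] := MVT y0 (fun x _ => df x) (continuous_subspaceT cf).
  rewrite in_itv/= f0 !subr0 => /andP[c0 cy] ->.
  rewrite normrM exprSr ler_wpM2r// (le_trans (bf c))// lerXn2r ?nnegrE//.
  by rewrite gtr0_norm// gtr0_norm// ltW.
Qed.

Lemma norm_sin_le y : `|sin y| <= `|y|.
Proof.
have d x : is_derive x 1 sin (cos x) by exact: is_derive_sin.
rewrite -[leRHS]expr1; apply: (norm_le_of_derive _ d) => [|x]; first exact: sin0.
by rewrite expr0; exact: cos_max.
Qed.

Let d1subcos x : is_derive x 1 (fun x => 1 - cos x) (sin x).
Proof. by apply: is_derive_eq; rewrite /GRing.scale/=; ring. Qed.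

Let dsubsin x : is_derive x 1 (fun x => x - sin x) (1 - cos x).
Proof. by apply: is_derive_eq; rewrite /GRing.scale/=; ring. Qed.

Lemma norm_1subcos_le y : `|1 - cos y| <= `|y|.
Proof.
rewrite -[leRHS]expr1; apply: (norm_le_of_derive _ d1subcos) => [|x].
- by rewrite cos0 subrr.
- by rewrite expr0; exact: sin_max.
Qed.

Lemma norm_1subcos_le2 y : `|1 - cos y| <= `|y| ^+ 2.
Proof.
apply: (norm_le_of_derive _ d1subcos) => [|x].
- by rewrite cos0 subrr.
- by rewrite expr1; exact: norm_sin_le.
Qed.

Lemma norm_subsin_le2 y : `|y - sin y| <= `|y| ^+ 2.
Proof.
apply: (norm_le_of_derive _ dsubsin) => [|x].
- by rewrite sin0 subrr.
- by rewrite expr1; exact: norm_1subcos_le.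
Qed.

Lemma norm_subsin_le3 y : `|y - sin y| <= `|y| ^+ 3.
Proof.
apply: (norm_le_of_derive _ dsubsin) => [|x].
- by rewrite sin0 subrr.
- exact: norm_1subcos_le2.
Qed.

Lemma norm_cos_taylor3 y : `|cos y - 1 + y ^+ 2 / 2| <= `|y| ^+ 3.
Proof.
have d x : is_derive x 1 (fun x => cos x - 1 + x ^+ 2 / 2) (x - sin x).
  by apply: is_derive_eq; rewrite /GRing.scale/=; field.
apply: (norm_le_of_derive _ d) => [|x].
- by rewrite cos0 subrr expr0n mul0r addr0.
- exact: norm_subsin_le2.
Qed.

Lemma norm_subcos_le x y : `|cos x - cos y| <= `|x - y|.
Proof.
have d (z : R) : is_derive z 1 (fun z : R => cos (y + z) - cos y) (- sin (y + z)).
  by apply: is_derive_eq; rewrite /GRing.scale/=; ring.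
have := norm_le_of_derive (x - y) (k := 0) d.
rewrite expr1 [y + (x - y)]addrC subrK; apply => [|z].
- by rewrite addr0 subrr.
- by rewrite normrN expr0; exact: sin_max.
Qed.

Lemma norm_subsin_le x y : `|sin x - sin y| <= `|x - y|.
Proof.
by rewrite -!cosBpihalf (le_trans (norm_subcos_le _ _))// opprB addrA subrK.
Qed.

End trig_bounds.

Section Rintegral_bounds.
Context d (T : measurableType d) (R : realType) (mu : {measure set T -> \bar R}).
Implicit Types f g : T -> R.

Lemma EFin_Rintegral f : mu.-integrable setT (EFin \o f) ->
  (\int[mu]_x (f x)%:E)%E = (\int[mu]_x f x)%:E.
Proof. by move=> intf; rewrite /Rintegral fineK//; exact: integrable_fin_num. Qed.

Lemma integrable_le f g : measurable_fun setT f ->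
  (forall x, `|f x| <= g x) -> mu.-integrable setT (EFin \o g) ->
  mu.-integrable setT (EFin \o f).
Proof.
move=> mf fg; apply: le_integrable => //; first exact/measurable_EFinP.
by move=> x _; rewrite /= lee_fin (le_trans (fg x))// ler_norm.
Qed.

Lemma norm_Rintegral_le f g : measurable_fun setT f ->
  (forall x, `|f x| <= g x) -> mu.-integrable setT (EFin \o g) ->
  `|\int[mu]_x f x| <= \int[mu]_x g x.
Proof.
move=> mf fg intg; have intf := integrable_le mf fg intg.
apply: (le_trans (le_normr_Rintegral _ _)) => //.
apply: le_Rintegral => //.
by apply: (integrable_le _ _ intg) => [|x]; [exact: measurableT_comp|rewrite normr_id].
Qed.

Lemma integrable_scale (r : R) f : mu.-integrable setT (EFin \o f) ->
  mu.-integrable setT (EFin \o (fun x => r * f x)).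
Proof. by move=> intf; apply: (integrableZl measurableT r intf). Qed.

Lemma integrable_add f g : mu.-integrable setT (EFin \o f) ->
  mu.-integrable setT (EFin \o g) ->
  mu.-integrable setT (EFin \o (fun x => f x + g x)).
Proof. by move=> intf intg; apply: (integrableD measurableT intf intg). Qed.

Lemma integrable_sub f g : mu.-integrable setT (EFin \o f) ->
  mu.-integrable setT (EFin \o g) ->
  mu.-integrable setT (EFin \o (fun x => f x - g x)).
Proof. by move=> intf intg; apply: (integrableB measurableT intf intg). Qed.

End Rintegral_bounds.

Section probability_integrals.
Context (R : realType) (P : probability R R).

Lemma bounded_integrable (M : R) (f : R -> R) : measurable_fun setT f ->
  (forall x, `|f x| <= M) -> P.-integrable setT (EFin \o f).
Proof.
move=> mf fM; apply: measurable_bounded_integrable => //.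
  by rewrite (_ : _ setT = 1%E) ?ltry//; exact: probability_setT.
exists M; split; first exact: num_real.
by move=> N MN x _ /=; rewrite (le_trans (fM x))// ltW.
Qed.

Lemma integrable_const (c : R) : P.-integrable setT (EFin \o (fun _ : R => c)).
Proof. by apply: (@bounded_integrable `|c|). Qed.

Lemma Rintegral_prob_cst (c : R) : \int[P]_(_ in setT) c = c.
Proof.
by rewrite Rintegral_cst// (_ : fine _ = 1) ?mulr1// (_ : _ setT = 1%E)//; exact: probability_setT.
Qed.

Lemma measurable_cos_affine (t a : R) : measurable_fun setT (fun x : R => cos (t * x + a)).
Proof.
apply: continuous_measurable_fun => x; apply: continuous_comp; last exact: continuous_cos.
by apply: cvgD; [apply: cvgMr; exact: cvg_id|exact: cvg_cst].
Qed.

Lemma measurable_sin_affine (t a : R) : measurable_fun setT (fun x : R => sin (t * x + a)).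
Proof.
apply: continuous_measurable_fun => x; apply: continuous_comp; last exact: continuous_sin.
by apply: cvgD; [apply: cvgMr; exact: cvg_id|exact: cvg_cst].
Qed.

Lemma integrable_cos (t a : R) : P.-integrable setT (EFin \o (fun x => cos (t * x + a))).
Proof.
apply: (@bounded_integrable 1) => [|x]; [exact: measurable_cos_affine|exact: cos_max].
Qed.

Lemma integrable_sin (t a : R) : P.-integrable setT (EFin \o (fun x => sin (t * x + a))).
Proof.
apply: (@bounded_integrable 1) => [|x]; [exact: measurable_sin_affine|exact: sin_max].
Qed.

Definition ecos (t : R) := \int[P]_x cos (t * x).
Definition esin (t : R) := \int[P]_x sin (t * x).

Lemma Rintegral_cos_affine (t a : R) :
  \int[P]_x cos (t * x + a) = ecos t * cos a - esin t * sin a.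
Proof.
have ic : P.-integrable setT (EFin \o (fun x => cos (t * x))).
  by have := integrable_cos t 0; under eq_fun do rewrite addr0.
have is_ : P.-integrable setT (EFin \o (fun x => sin (t * x))).
  by have := integrable_sin t 0; under eq_fun do rewrite addr0.
rewrite /ecos /esin (mulrC _ (cos a)) (mulrC _ (sin a)) -!RintegralZl//.
rewrite -RintegralB//; try exact: integrable_scale.
by apply: eq_Rintegral => x _; rewrite cosD mulrC [sin _ * sin _]mulrC.
Qed.

Lemma Rintegral_sin_affine (t a : R) :
  \int[P]_x sin (t * x + a) = esin t * cos a + ecos t * sin a.
Proof.
have := Rintegral_cos_affine t (a - pi / 2).
rewrite cosBpihalf sinBpihalf mulrN opprK => H; rewrite [RHS]addrC -H.
by apply: eq_Rintegral => x _; rewrite addrA cosBpihalf.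
Qed.

End probability_integrals.

Section law.
Context (R : realType) (Q : probability R R).

(** Tested on nonnegative functions only, the class where Tonelli asks for no integrability. Signed
    functions are reached by adding a constant. *)
Definition is_sum_law n (L : probability R R) := forall (f : R -> \bar R) (s : R),
  measurable_fun setT f -> (forall x, 0 <= f x)%E ->
  (iter_on setT Q n f s = \int[L]_y f (s + y)%R)%E.

(* [cpow c s n] is the pair (Re, Im) of [(c + i s)^n]. *)
Fixpoint cpow (c s : R) n : R * R :=
  if n is m.+1 then
    ((cpow c s m).1 * c - (cpow c s m).2 * s, (cpow c s m).1 * s + (cpow c s m).2 * c)
  else (1, 0).

Lemma cpow_norm c s n : (cpow c s n).1 ^+ 2 + (cpow c s n).2 ^+ 2 = (c ^+ 2 + s ^+ 2) ^+ n.
Proof.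
elim: n => [|n IH]; first by rewrite /= expr1n expr0n addr0 expr0.
rewrite [RHS]exprS -IH /=; ring.
Qed.

(** Real part of [e^(i a)] times the n-th power of the characteristic function. The phase [a] is
    arbitrary because integrating out the first summand [x] replaces it by [t * x + a]. *)
Lemma Rintegral_cos_sum_law n L (t a : R) : is_sum_law n L ->
  \int[L]_y cos (t * y + a) = (cpow (ecos Q t) (esin Q t) n).1 * cos a -
     (cpow (ecos Q t) (esin Q t) n).2 * sin a.
Proof.
(* [1 + cos] is nonnegative, so [is_sum_law] applies to it; the 1 is cancelled afterwards. *)
have E (P : probability R R) b :
    (\int[P]_y (1 + cos (t * y + b))%:E = (1 + \int[P]_y cos (t * y + b))%:E)%E.
  rewrite EFin_Rintegral; last first.
    by apply: integrable_add; [exact: integrable_const|exact: integrable_cos].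
  congr _%:E; rewrite RintegralD//.
  - by rewrite Rintegral_prob_cst.
  - exact: integrable_const.
  - exact: integrable_cos.
have m1 b : measurable_fun setT (fun y : R => (1 + cos (t * y + b))%:E).
  by apply/measurable_EFinP; apply: measurable_funD => //; exact: measurable_cos_affine.
have p1 b (y : R) : (0 <= (1 + cos (t * y + b))%:E)%E.
  by rewrite lee_fin -lerBlDl sub0r cos_geN1.
elim: n L a => [|n IH] L a HL.
  have := HL _ 0 (m1 a) (p1 a); rewrite /= mulr0 add0r.
  under eq_integral do rewrite add0r.
  by rewrite E => -[/addrI <-]; rewrite mul1r mul0r subr0.
have [L' HL'] := iter_on_law Q n.
have := HL _ 0 (m1 a) (p1 a); rewrite [LHS]/=.
under [RHS]eq_integral do rewrite add0r.
rewrite E => H.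
have : (\int[Q]_x (1 + \int[L']_y cos (t * y + (t * x + a)))%:E =
   (1 + \int[L]_y cos (t * y + a))%:E)%E.
  rewrite -H; apply: eq_integral => x _.
  rewrite HL'// -E; apply: eq_integral => y _.
  by rewrite add0r mulrDr addrA (addrC (t * x)).
under eq_integral do rewrite (IH _ _ HL').
set A := (cpow _ _ n).1; set B := (cpow _ _ n).2.
have ic := integrable_cos Q t a; have is_ := integrable_sin Q t a.
have isub : Q.-integrable setT (EFin \o (fun x => A * cos (t * x + a) - B * sin (t * x + a))).
  by apply: integrable_sub; exact: integrable_scale.
have i1 : Q.-integrable setT (EFin \o (fun _ => 1 : R)) by exact: integrable_const.
rewrite EFin_Rintegral; last by apply: integrable_add.
rewrite RintegralD// Rintegral_prob_cst => -[/addrI <-].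
rewrite RintegralB//; try exact: integrable_scale.
rewrite !RintegralZl// Rintegral_cos_affine Rintegral_sin_affine /=.
rewrite -/A -/B; ring.
Qed.

End law.

(** * Elementary inequalities and powers of complex numbers *)

Section real_bounds.
Context (R : realType).
Implicit Types (c s g m d a x y t : R).

Lemma expRN_taylor2 y : 0 <= y -> `|expR (- y) - (1 - y)| <= y ^+ 2.
Proof.
move=> y0; have h1 := expR_ge1Dx (- y).
rewrite ger0_norm ?subr_ge0// expRN.
have h2 : (expR y)^-1 <= (1 + y)^-1.
  by rewrite lef_pV2 ?posrE ?expR_gt0 ?expR_ge1Dx//; lra.
apply: (@le_trans _ _ ((1 + y)^-1 - (1 - y))); first by rewrite lerD2r.
have -> : (1 + y)^-1 - (1 - y) = y ^+ 2 / (1 + y) by field; apply/eqP; lra.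
by rewrite ler_pdivrMr; [rewrite ler_peMr ?sqr_ge0//; lra|lra].
Qed.

Lemma pow_le_gauss c : 0 < c -> exists2 C, 0 <= C &
  forall x, 0 <= x -> x <= C * expR (c * x ^+ 2) /\ x ^+ 3 <= C * expR (c * x ^+ 2).
Proof.
move=> c0; exists (1 + c^-1 + 4 / c ^+ 2).
  by rewrite !addr_ge0 ?invr_ge0 ?divr_ge0 ?sqr_ge0// ltW.
move=> x x0.
have e1 : 1 <= expR (c * x ^+ 2).
  by rewrite -expR0 ler_expR mulr_ge0 ?sqr_ge0// ltW.
have e2 : x ^+ 2 <= c^-1 * expR (c * x ^+ 2).
  rewrite ler_pdivlMl//; have := expR_ge1Dx (c * x ^+ 2); lra.
have e4 : x ^+ 4 <= 4 / c ^+ 2 * expR (c * x ^+ 2).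
  have h : c / 2 * x ^+ 2 <= expR (c / 2 * x ^+ 2).
    by have := expR_ge1Dx (c / 2 * x ^+ 2); lra.
  have -> : c * x ^+ 2 = c / 2 * x ^+ 2 + c / 2 * x ^+ 2 by field.
  rewrite expRD -expr2.
  have -> : x ^+ 4 = 4 / c ^+ 2 * (c / 2 * x ^+ 2) ^+ 2.
    by field; apply/eqP; lra.
  rewrite ler_wpM2l ?divr_ge0 ?sqr_ge0// lerXn2r ?nnegrE ?expR_ge0//.
  by rewrite mulr_ge0 ?sqr_ge0 ?divr_ge0// ltW.
have q2 := sqr_ge0 (x - 1). have q4 := sqr_ge0 (x ^+ 2 - x).
have q0 : 0 <= x ^+ 2 by exact: sqr_ge0.
have q40 : 0 <= x ^+ 4 by rewrite exprn_even_ge0.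
have E1 : (x - 1) ^+ 2 = x ^+ 2 - 2 * x + 1 by ring.
have E2 : (x ^+ 2 - x) ^+ 2 = x ^+ 4 - 2 * x ^+ 3 + x ^+ 2 by ring.
rewrite !mulrDl mul1r; split; lra.
Qed.

Lemma le_of_sqr (x y : R) : 0 <= y -> x ^+ 2 <= y ^+ 2 -> `|x| <= y.
Proof.
move=> y0 xy; rewrite -(@ler_pXn2r _ 2)// ?nnegrE//.
by rewrite real_normK// num_real.
Qed.

Lemma cpow_le c s m n : 0 <= m -> c ^+ 2 + s ^+ 2 <= m ^+ 2 ->
  `|(cpow c s n).1| <= m ^+ n /\ `|(cpow c s n).2| <= m ^+ n.
Proof.
move=> m0 csm.
have H : (cpow c s n).1 ^+ 2 + (cpow c s n).2 ^+ 2 <= (m ^+ n) ^+ 2.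
  rewrite cpow_norm -exprM mulnC exprM lerXn2r// ?nnegrE ?sqr_ge0//.
  by rewrite addr_ge0 ?sqr_ge0.
have h1 := sqr_ge0 (cpow c s n).1; have h2 := sqr_ge0 (cpow c s n).2.
by split; apply: le_of_sqr; rewrite ?exprn_ge0//; lra.
Qed.

Lemma cpow_rot_le c s m n a : 0 <= m -> c ^+ 2 + s ^+ 2 <= m ^+ 2 ->
  `|(cpow c s n).1 * cos a - (cpow c s n).2 * sin a| <= m ^+ n.
Proof.
move=> m0 csm; apply: le_of_sqr; rewrite ?exprn_ge0//.
have H : (cpow c s n).1 ^+ 2 + (cpow c s n).2 ^+ 2 <= (m ^+ n) ^+ 2.
  rewrite cpow_norm -exprM mulnC exprM lerXn2r// ?nnegrE ?sqr_ge0//.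
  by rewrite addr_ge0 ?sqr_ge0.
apply: le_trans H; have e := cos2Dsin2 a.
set A := (cpow c s n).1; set B := (cpow c s n).2.
have q := sqr_ge0 (A * sin a + B * cos a).
have E : (A * cos a - B * sin a) ^+ 2 + (A * sin a + B * cos a) ^+ 2 =
  (A ^+ 2 + B ^+ 2) * (cos a ^+ 2 + sin a ^+ 2) by ring.
rewrite e mulr1 in E; lra.
Qed.

(** Telescoping: the difference of the powers is a sum of [n + 1] terms, each with one factor
    [c + i s - g] and [n] factors of modulus at most [m]. The 2 comes from bounding the real and
    imaginary parts of that factor separately by [d]. *)
Lemma cpow_sub_le c s g m d n : 0 <= d -> 0 <= g -> g <= m ->
  c ^+ 2 + s ^+ 2 <= m ^+ 2 -> `|c - g| <= d -> `|s| <= d ->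
  `|(cpow c s n.+1).1 - g ^+ n.+1| <= 2 * n.+1%:R * d * m ^+ n /\
  `|(cpow c s n.+1).2| <= 2 * n.+1%:R * d * m ^+ n.
Proof.
move=> d0 g0 gm csm cg sd.
have m0 : 0 <= m by exact: le_trans gm.
elim: n => [|n [IH1 IH2]].
  rewrite /= !mul1r !mul0r subr0 addr0 expr0 expr1 !mulr1.
  by split; lra.
have [hA hB] := cpow_le n.+1 m0 csm.
move: hA hB IH1 IH2; rewrite [cpow c s n.+2]/= -/(cpow c s n.+1).
set A := (cpow c s n.+1).1; set B := (cpow c s n.+1).2 => hA hB IH1 IH2.
have mn0 : 0 <= m ^+ n.+1 by exact: exprn_ge0.
have bnd (u v w : R) : `|u| <= m ^+ n.+1 -> `|v| <= d -> `|u * v| <= m ^+ n.+1 * d.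
  by move=> hu hv; rewrite normrM ler_pM.
have gb (u : R) : `|u| <= 2 * n.+1%:R * d * m ^+ n -> `|g * u| <= 2 * n.+1%:R * d * m ^+ n.+1.
  move=> hu; rewrite normrM (ger0_norm g0) exprS mulrCA ler_pM//.
have Em : 2 * n.+2%:R * d * m ^+ n.+1 =
   2 * n.+1%:R * d * m ^+ n.+1 + m ^+ n.+1 * d + m ^+ n.+1 * d.
  by rewrite -[n.+2%:R]natr1; ring.
rewrite Em; split.
- have -> : A * c - B * s - g ^+ n.+2 = g * (A - g ^+ n.+1) + A * (c - g) - B * s.
    by rewrite [g ^+ n.+2]exprS; ring.
  apply: (le_trans (ler_normB _ _)); apply: lerD; last exact: bnd.
  by apply: (le_trans (ler_normD _ _)); apply: lerD; [exact: gb|exact: bnd].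
- have -> : A * s + B * c = g * B + A * s + B * (c - g) by ring.
  apply: (le_trans (ler_normD _ _)); apply: lerD; last exact: bnd.
  by apply: (le_trans (ler_normD _ _)); apply: lerD; [exact: gb|exact: bnd].
Qed.

End real_bounds.

(** * Expansion and decay of the characteristic function *)

Section ecf_bounds.
Context (R : realType) (Q : probability R R).
Hypothesis i1 : Q.-integrable setT (EFin \o (fun x : R => x)).
Hypothesis i2 : Q.-integrable setT (EFin \o (fun x : R => x ^+ 2)).
Hypothesis i3 : Q.-integrable setT (EFin \o (fun x : R => `|x| ^+ 3)).
Hypothesis Q_mean0 : \int[Q]_x x = 0.
Let s2 := \int[Q]_x x ^+ 2.
Hypothesis s2_gt0 : 0 < s2.
Let M := \int[Q]_x `|x| ^+ 3.

Lemma M_ge0 : 0 <= M.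
Proof. by apply: Rintegral_ge0 => x _; rewrite exprn_ge0. Qed.

Let mcos t : measurable_fun setT (fun x : R => cos (t * x)).
Proof. by have := measurable_cos_affine t 0; under eq_fun do rewrite addr0. Qed.

Let msin t : measurable_fun setT (fun x : R => sin (t * x)).
Proof. by have := measurable_sin_affine t 0; under eq_fun do rewrite addr0. Qed.

Let icos t : Q.-integrable setT (EFin \o (fun x : R => cos (t * x))).
Proof. by have := integrable_cos Q t 0; under eq_fun do rewrite addr0. Qed.

Let isin t : Q.-integrable setT (EFin \o (fun x : R => sin (t * x))).
Proof. by have := integrable_sin Q t 0; under eq_fun do rewrite addr0. Qed.

Lemma ecos_taylor t : `|ecos Q t - 1 + s2 * t ^+ 2 / 2| <= M * `|t| ^+ 3.
Proof.
have -> : ecos Q t - 1 + s2 * t ^+ 2 / 2 =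
    \int[Q]_x (cos (t * x) - 1 + t ^+ 2 / 2 * x ^+ 2).
  rewrite RintegralD//; last 2 first.
  - by apply: integrable_sub; [exact: icos|exact: integrable_const].
  - exact: integrable_scale.
  rewrite RintegralB//; last exact: integrable_const.
  by rewrite Rintegral_prob_cst RintegralZl// -/s2 /ecos; field.
rewrite [leRHS]mulrC -RintegralZl//; apply: norm_Rintegral_le.
- apply: measurable_funD; first exact: measurable_funB.
  by apply: measurable_funM => //; exact: exprn_measurable.
- move=> x; have := norm_cos_taylor3 (t * x).
  by rewrite normrM !exprMn mulrAC.
- exact: integrable_scale.
Qed.

(** Centring removes the linear term of the sine, so the imaginary part is already of the order of
    the error in [ecos_taylor]. *)
Lemma norm_esin_le t : `|esin Q t| <= M * `|t| ^+ 3.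
Proof.
have -> : esin Q t = \int[Q]_x (sin (t * x) - t * x).
  rewrite RintegralB//; last exact: integrable_scale.
  by rewrite RintegralZl// Q_mean0 mulr0 subr0.
rewrite [leRHS]mulrC -RintegralZl//; apply: norm_Rintegral_le.
- by apply: measurable_funB => //; exact: measurable_funM.
- move=> x; have := norm_subsin_le3 (t * x).
  by rewrite distrC normrM !exprMn.
- exact: integrable_scale.
Qed.

Lemma norm_ecos_le1 t : `|ecos Q t| <= 1.
Proof.
rewrite -[leRHS](Rintegral_prob_cst Q); apply: norm_Rintegral_le => //.
- by move=> x; exact: cos_max.
- exact: integrable_const.
Qed.

Lemma norm_esin_le1 t : `|esin Q t| <= 1.
Proof.
rewrite -[leRHS](Rintegral_prob_cst Q); apply: norm_Rintegral_le => //.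
- by move=> x; exact: sin_max.
- exact: integrable_const.
Qed.

Let iabs : Q.-integrable setT (EFin \o (fun x : R => `|x|)).
Proof. exact: (integrable_abse i1). Qed.

Lemma ecos_lip t u : `|ecos Q t - ecos Q u| <= (\int[Q]_x `|x|) * `|t - u|.
Proof.
rewrite -RintegralB// [leRHS]mulrC -RintegralZl//; apply: norm_Rintegral_le.
- exact: measurable_funB.
- by move=> x; rewrite (le_trans (norm_subcos_le _ _))// -mulrBl normrM.
- exact: integrable_scale.
Qed.

Lemma esin_lip t u : `|esin Q t - esin Q u| <= (\int[Q]_x `|x|) * `|t - u|.
Proof.
rewrite -RintegralB// [leRHS]mulrC -RintegralZl//; apply: norm_Rintegral_le.
- exact: measurable_funB.
- by move=> x; rewrite (le_trans (norm_subsin_le _ _))// -mulrBl normrM.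
- exact: integrable_scale.
Qed.

End ecf_bounds.

Section ecf_norm.
Context (R : realType) (Q : probability R R).
Hypothesis i1 : Q.-integrable setT (EFin \o (fun x : R => x)).
Hypothesis i2 : Q.-integrable setT (EFin \o (fun x : R => x ^+ 2)).
Hypothesis i3 : Q.-integrable setT (EFin \o (fun x : R => `|x| ^+ 3)).
Hypothesis Q_mean0 : \int[Q]_x x = 0.
Variables (s2 M : R).
Hypothesis s2E : \int[Q]_x x ^+ 2 = s2.
Hypothesis s2_gt0 : 0 < s2.
Hypothesis ME : \int[Q]_x `|x| ^+ 3 = M.
Let M0 : 0 <= M. Proof. rewrite -ME; exact: M_ge0. Qed.

(** Squared modulus of the characteristic function; the square avoids roots. *)
Definition ecf2 t := ecos Q t ^+ 2 + esin Q t ^+ 2.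

Let sqr_le_norm (x : R) : `|x| <= 1 -> x ^+ 2 <= `|x|.
Proof. by move=> x1; rewrite -real_normK ?num_real// expr2 ler_piMr. Qed.

Lemma ecf2_near0 : exists2 T, 0 < T & forall t, `|t| <= T ->
  ecf2 t <= 1 - s2 / 4 * t ^+ 2.
Proof.
have hM := M0; have s20 := s2_gt0.
have s21 : 0 < s2 + 1 by rewrite ltr_wpDr.
have M81 : 0 < 8 * (M + 1) by rewrite mulr_gt0// ltr_wpDl.
(* The first two bounds give [s2 t^2 <= 1], hence the sign of [1 - s2 t^2 / 2]; the third makes the
   two cubic errors at most [s2 t^2 / 4]. Squares are bounded by absolute values, which leaves
   [s2 / 2] as quadratic coefficient, and the cubic errors take half of it. *)
exists (Num.min (Num.min 1 (s2 + 1)^-1) (s2 / (8 * (M + 1)))).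
  rewrite !lt_min ltr01 invr_gt0 divr_gt0//=.
  by rewrite s21.
move=> t; rewrite !le_min => /andP[/andP[t1 t2] t3].
have v0 : 0 <= `|t| by [].
have c := ecos_taylor i2 i3 t; have s := norm_esin_le i1 i3 Q_mean0 t.
have c1 := norm_ecos_le1 Q t; have s1 := norm_esin_le1 Q t.
rewrite s2E ME in c; rewrite ME in s; rewrite -(real_normK (num_real t)) in c *.
have [v vE] : exists v : R, v = `|t| by exists `|t|.
rewrite -vE in c s t1 t2 t3 v0 *.
have t2' : s2 * v <= 1.
  apply: (@le_trans _ _ ((s2 + 1) * v)); first by rewrite ler_wpM2r// lerDl.
  by rewrite mulrC -ler_pdivlMr// mul1r.
have t3' : 2 * M * v <= s2 / 4.
  move: t3; rewrite ler_pdivlMr//.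
  move=> h; rewrite ler_pdivlMr//; apply: le_trans h.
  have -> : v * (8 * (M + 1)) = 2 * M * v * 4 + 8 * v by ring.
  by rewrite lerDl mulr_ge0.
have vv : 0 <= v ^+ 2 by exact: sqr_ge0.
have h2 : s2 * v ^+ 2 <= 1.
  rewrite expr2 mulrA; apply: (@le_trans _ _ (1 * v)); last by rewrite mul1r.
  by rewrite ler_wpM2r.
have h3 : 2 * (M * v ^+ 3) <= s2 / 4 * v ^+ 2.
  have -> : 2 * (M * v ^+ 3) = 2 * M * v * v ^+ 2 by ring.
  by rewrite ler_wpM2r.
have hc : `|ecos Q t| <= 1 - s2 * v ^+ 2 / 2 + M * v ^+ 3.
  have -> : ecos Q t = (ecos Q t - 1 + s2 * v ^+ 2 / 2) + (1 - s2 * v ^+ 2 / 2) by ring.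
  apply: (le_trans (ler_normD _ _)).
  by rewrite (@ger0_norm _ (1 - _)); lra.
rewrite /ecf2; have := sqr_le_norm c1; have := sqr_le_norm s1; lra.
Qed.

Lemma ecf2N t : ecf2 (- t) = ecf2 t.
Proof.
rewrite /ecf2 /ecos /esin.
under eq_Rintegral do rewrite mulNr cosN.
congr (_ + _).
have -> : \int[Q]_x sin (- t * x) = - \int[Q]_x sin (t * x).
  rewrite -[RHS]mulN1r -RintegralZl//.
    by apply: eq_Rintegral => x _; rewrite mulNr sinN mulN1r.
  by have := integrable_sin Q t 0; under eq_fun do rewrite addr0.
by rewrite sqrrN.
Qed.

Lemma continuous_of_lip (f : R -> R) (K : R) :
  (forall t u, `|f t - f u| <= K * `|t - u|) -> continuous f.
Proof.
move=> fK x; apply/cvgrPdist_lt => e e0.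
have K1 : 0 < `|K| + 1 by rewrite ltr_pwDr.
near=> y; rewrite (le_lt_trans (fK _ _))//.
apply: (@le_lt_trans _ _ ((`|K| + 1) * `|x - y|)).
  by rewrite ler_wpM2r// (le_trans (ler_norm K))// lerDl.
rewrite -ltr_pdivlMl// mulrC.
near: y; apply: cvgr_dist_lt; first exact: cvg_id.
by rewrite divr_gt0.
Unshelve. all: by end_near. Qed.

Lemma continuous_ecf2 : continuous ecf2.
Proof.
have cc := continuous_of_lip (ecos_lip i1).
have cs := continuous_of_lip (esin_lip i1).
move=> x; rewrite /ecf2.
have cvg2 (f : R -> R) : {for x, continuous f} -> {for x, continuous (fun y => f y ^+ 2)}.
  by move=> cf; rewrite (_ : (fun _ => _) = (fun y => f y * f y)); [exact: cvgM|apply/funext => y; rewrite expr2].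
by apply: cvgD; [exact: (cvg2 _ (cc x))|exact: (cvg2 _ (cs x))].
Qed.

(** Beyond the neighbourhood of 0, compactness keeps the modulus away from 1, and a small enough [c]
    extends the quadratic bound to the whole interval. The clause [c <= s2] lets the same Gaussian
    dominate the limiting one. *)
Lemma ecf2_on T : 0 < T -> (forall t, 0 < t <= T -> ecf2 t < 1) ->
  exists2 c, 0 < c <= s2 & forall t, `|t| <= T -> ecf2 t <= 1 - c * t ^+ 2.
Proof.
have s20 := s2_gt0; move=> T0 HT; have [T1 T10 H1] := ecf2_near0.
have [TT1|T1T] := leP T T1.
  exists (s2 / 4) => [|t tT]; first by apply/andP; split; lra.
  by apply: H1; exact: le_trans TT1.
have [u] := @EVT_max _ ecf2 T1 T (ltW T1T) (continuous_subspaceT continuous_ecf2).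
rewrite in_itv/= => /andP[T1u uT] Hu.
have u1 : ecf2 u < 1 by apply: HT; rewrite uT (lt_le_trans T10).
pose c := Num.min (s2 / 4) ((1 - ecf2 u) / T ^+ 2).
have T20 : 0 < T ^+ 2 by exact: exprn_gt0.
have c0 : 0 < c by rewrite lt_min !divr_gt0//= subr_gt0.
have cs : c <= s2 / 4 by rewrite ge_min lexx.
exists c => [|t tT]; first by rewrite c0/=; lra.
have [tT1|T1t] := leP `|t| T1.
  apply: (le_trans (H1 _ tT1)); rewrite lerD2l lerN2 ler_wpM2r ?sqr_ge0//.
have -> : ecf2 t = ecf2 `|t|.
  by have [_|_] := ger0P t; rewrite ?ecf2N.
apply: (@le_trans _ _ (ecf2 u)); first by apply: Hu; rewrite in_itv/= tT ltW.
have cT : c * T ^+ 2 <= 1 - ecf2 u by rewrite -ler_pdivlMr// ge_min lexx orbT.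
have : c * t ^+ 2 <= c * T ^+ 2.
  by rewrite ler_pM2l// -real_normK ?num_real// lerXn2r ?nnegrE// ltW.
lra.
Qed.

Let A t n := (cpow (ecos Q t) (esin Q t) n).1.
Let B t n := (cpow (ecos Q t) (esin Q t) n).2.

(** The characteristic function and [g = e^(- s2 t^2 / 2)] both have modulus at most
    [m = e^(- c t^2 / 2)] and differ by [O(|t|^3)], so [cpow_sub_le] compares their n-th powers. *)
Lemma ecf_pow_gauss T c : 0 < T -> 0 < c <= s2 ->
  (forall t, `|t| <= T -> ecf2 t <= 1 - c * t ^+ 2) ->
  exists2 D, 0 <= D & forall n t a, (0 < n)%N -> `|t| <= T ->
    `|A t n * cos a - B t n * sin a| <= expR (- (c / 2 * (n%:R * t ^+ 2))) /\
    `|A t n * cos a - B t n * sin a - expR (- (s2 / 2 * (n%:R * t ^+ 2))) * cos a|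
      <= D * (n%:R * `|t| ^+ 3) * expR (- (c / 2 * (n%:R * t ^+ 2))).
Proof.
have hM := M0; have s20 := s2_gt0; move=> T0 /andP[c0 cs2] Hc.
(* [M] is the cubic error of the characteristic function; [s2^2 T / 4] is the error [(s2 t^2 / 2)^2]
   of the linearized exponential, with one factor [|t|] bounded by [T]. *)
pose d0 := M + s2 ^+ 2 * T / 4.
have d00 : 0 <= d0 by rewrite addr_ge0// !mulr_ge0 ?sqr_ge0// ltW.
(* 4 is the 2 of [cpow_sub_le], once for the real and once for the imaginary part; the exponential
   restores the power of [m] lost in telescoping. *)
exists (4 * d0 * expR (c / 2 * T ^+ 2)).
  by rewrite !mulr_ge0 ?expR_ge0.
move=> n t a n0 tT.
pose m := expR (- (c / 2 * t ^+ 2)).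
pose g := expR (- (s2 / 2 * t ^+ 2)).
have t20 : 0 <= t ^+ 2 by exact: sqr_ge0.
have gm : g <= m by rewrite ler_expR lerN2 ler_wpM2r//; lra.
have m0 : 0 <= m by exact: expR_ge0.
have g0 : 0 <= g by exact: expR_ge0.
have csm : ecos Q t ^+ 2 + esin Q t ^+ 2 <= m ^+ 2.
  apply: (le_trans (Hc _ tT)).
  rewrite /m -expRM_natl; have -> : 2 * - (c / 2 * t ^+ 2) = - (c * t ^+ 2) by field.
  by have := expR_ge1Dx (- (c * t ^+ 2)).
have mn k : m ^+ k = expR (- (c / 2 * (k%:R * t ^+ 2))).
  by rewrite -expRM_natl; congr expR; ring.
have gn k : g ^+ k = expR (- (s2 / 2 * (k%:R * t ^+ 2))).
  by rewrite -expRM_natl; congr expR; ring.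
split; first by rewrite -mn; exact: cpow_rot_le.
pose d := d0 * `|t| ^+ 3.
have t3 : 0 <= `|t| ^+ 3 by exact: exprn_ge0.
have dd : 0 <= d by rewrite mulr_ge0.
have sd : `|esin Q t| <= d.
  apply: (le_trans (norm_esin_le i1 i3 Q_mean0 t)); rewrite ME /d /d0 ler_wpM2r//.
  by rewrite lerDl !mulr_ge0 ?sqr_ge0// ltW.
have cd : `|ecos Q t - g| <= d.
  have h1 := ecos_taylor i2 i3 t; rewrite s2E ME in h1.
  have h2 : `|g - (1 - s2 / 2 * t ^+ 2)| <= (s2 / 2 * t ^+ 2) ^+ 2.
    by apply: expRN_taylor2; rewrite mulr_ge0// divr_ge0// ltW.
  have -> : ecos Q t - g = (ecos Q t - 1 + s2 * t ^+ 2 / 2) - (g - (1 - s2 / 2 * t ^+ 2)) by ring.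
  apply: (le_trans (ler_normB _ _)); apply: (le_trans (lerD h1 h2)).
  rewrite /d /d0 mulrDl lerD2l.
  have -> : (s2 / 2 * t ^+ 2) ^+ 2 = s2 ^+ 2 / 4 * `|t| * `|t| ^+ 3.
    by rewrite -(real_normK (num_real t)); field.
  rewrite ler_wpM2r// mulrAC ler_wpM2r//.
  by have := sqr_ge0 s2; rewrite ler_wpM2l ?divr_ge0 ?sqr_ge0.
case: n n0 => // n _.
have [hA hB] := cpow_sub_le n dd g0 gm csm cd sd.
rewrite -/(A t n.+1) -/(B t n.+1) in hA hB.
have -> : A t n.+1 * cos a - B t n.+1 * sin a - expR (- (s2 / 2 * (n.+1%:R * t ^+ 2))) * cos a
   = (A t n.+1 - g ^+ n.+1) * cos a - B t n.+1 * sin a by rewrite gn; ring.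
apply: (le_trans (ler_normB _ _)); rewrite !normrM.
apply: (@le_trans _ _ (2 * n.+1%:R * d * m ^+ n + 2 * n.+1%:R * d * m ^+ n)).
  apply: lerD; rewrite -[leRHS]mulr1; apply: ler_pM => //; [exact: cos_max|exact: sin_max].
have -> : 2 * n.+1%:R * d * m ^+ n + 2 * n.+1%:R * d * m ^+ n =
  4 * d0 * (n.+1%:R * `|t| ^+ 3) * m ^+ n by rewrite /d; ring.
have n1 : 0 <= n.+1%:R * `|t| ^+ 3 by rewrite mulr_ge0.
have -> (u v : R) : 4 * d0 * u * (n.+1%:R * `|t| ^+ 3) * v =
  4 * d0 * (n.+1%:R * `|t| ^+ 3) * (u * v) by ring.
rewrite ler_wpM2l ?mulr_ge0//.
rewrite -expRD mn ler_expR.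
have -> : n.+1%:R = n%:R + 1 :> R by rewrite natr1.
have -> : - (c / 2 * ((n%:R + 1) * t ^+ 2)) = - (c / 2 * (n%:R * t ^+ 2)) - c / 2 * t ^+ 2 by ring.
have : c / 2 * t ^+ 2 <= c / 2 * T ^+ 2.
  by rewrite ler_pM2l ?divr_gt0// -real_normK ?num_real// lerXn2r ?nnegrE// ltW.
lra.
Qed.

End ecf_norm.

(** * Smoothed local limit *)

Section gauss.
Context (R : realType).
Local Notation mu := (@lebesgue_measure R).

Lemma integral_gauss (a : R) : 0 < a ->
  (\int[mu]_t (expR (- (a * t ^+ 2)))%:E = (Num.sqrt (pi / a))%:E)%E.
Proof.
move=> a0; pose s := Num.sqrt (2 * a)^-1.
have a20 : 0 < (2 * a)^-1 by rewrite invr_gt0 mulr_gt0.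
have s0 : s != 0 by rewrite gt_eqF// sqrtr_gt0.
have sE : s ^+ 2 = (2 * a)^-1 by rewrite sqr_sqrtr// ltW.
have a1 : a != 0 by rewrite gt_eqF.
have pE : normal_peak s = (Num.sqrt (pi / a))^-1.
  rewrite /normal_peak sE; congr (Num.sqrt _)^-1.
  by rewrite -mulr_natr; field.
have pa : 0 < pi / a by rewrite divr_gt0 ?pi_gt0.
have q0 : Num.sqrt (pi / a) != 0 by rewrite gt_eqF// sqrtr_gt0.
have pdfE t : Num.sqrt (pi / a) * normal_pdf 0 s t = expR (- (a * t ^+ 2)).
  rewrite /normal_pdf (negbTE s0) pE /normal_fun mulrA divff// mul1r.
  congr (expR _); rewrite subr0 sE -[(_ *+ 2)]mulr_natr; field.
  exact: a1.
transitivity (\int[mu]_t ((Num.sqrt (pi / a))%:E * (normal_pdf 0 s t)%:E))%E.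
  apply: eq_integral => t _; by rewrite -EFinM pdfE.
rewrite ge0_integralZl//=.
- by rewrite integral_normal_pdf mule1.
- by apply/measurable_EFinP; exact: measurable_normal_pdf.
- by move=> t _; rewrite lee_fin; exact: normal_pdf_ge0.
Qed.

Lemma measurable_gauss (a : R) : measurable_fun setT (fun t : R => expR (- (a * t ^+ 2))).
Proof.
by apply: measurableT_comp => //; apply: measurable_funN; apply: measurable_funM.
Qed.

Lemma integrable_gauss (a : R) : 0 < a ->
  mu.-integrable setT (EFin \o (fun t => expR (- (a * t ^+ 2)))).
Proof.
move=> a0; apply/integrableP; split; first by apply/measurable_EFinP; exact: measurable_gauss.
under eq_integral do rewrite /= ger0_norm ?expR_ge0//.
by rewrite integral_gauss// ltry.
Qed.

Lemma Rintegral_gauss (a : R) : 0 < a ->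
  \int[mu]_t expR (- (a * t ^+ 2)) = Num.sqrt (pi / a).
Proof. by move=> a0; rewrite /Rintegral integral_gauss. Qed.

End gauss.

Section kernel.
Context (R : realType).
Local Notation mu := (@lebesgue_measure R).
Variables (T : R) (k : R -> R).
Hypothesis T_gt0 : 0 < T.
Hypothesis mk : measurable_fun setT k.
Hypothesis k01 : forall t, 0 <= k t <= 1.
Hypothesis k1 : forall t, `|1 - k t| <= `|t| / T.
Hypothesis ksupp : forall t, T < `|t| -> k t = 0.

Lemma kernel_integrable : mu.-integrable setT (EFin \o k).
Proof.
apply: (@integrable_le _ (measurableTypeR R) _ mu _ (fun t : R => expR 1 * expR (- (T ^- 2 * t ^+ 2)))) => //.
  move=> t; have /andP[kt0 kt1] := k01 t; rewrite ger0_norm//.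
  have [tT|tT] := leP `|t| T; last by rewrite ksupp// mulr_ge0 ?expR_ge0.
  apply: (le_trans kt1); rewrite -expRD -[leLHS]expR0 ler_expR subr_ge0.
  rewrite mulrC ler_pdivrMr ?exprn_gt0// mul1r -real_normK ?num_real//.
  by rewrite lerXn2r ?nnegrE// ltW.
apply: integrable_scale; apply: integrable_gauss.
by rewrite invr_gt0 exprn_gt0.
Qed.

(** A cosine transform, which is the Fourier transform for an even [k]. The hypotheses on [k] fit
    both the Fejer tent and the indicator of an interval, so that one local limit serves both
    cases. *)
Definition kerft (x : R) := \int[mu]_t (k t * cos (t * x)).

Let mkcos x a : measurable_fun setT (fun t : R => k t * cos (t * x + a)).
Proof.
apply: measurable_funM => //.
rewrite (_ : (fun _ => _) = (fun t => cos (x * t + a))); first exact: measurable_cos_affine.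
by apply/funext => t; rewrite mulrC.
Qed.

Lemma kerft_integrable x : mu.-integrable setT (EFin \o (fun t => k t * cos (t * x))).
Proof.
apply: integrable_le kernel_integrable.
  by have := mkcos x 0; under eq_fun do rewrite addr0.
move=> t; have /andP[kt0 _] := k01 t.
by rewrite normrM ger0_norm// ler_piMr// cos_max.
Qed.

Lemma continuous_kerft : continuous kerft.
Proof.
apply: (@continuous_of_lip _ _ (T * \int[mu]_t k t)) => x y.
rewrite /kerft -RintegralB//; try exact: kerft_integrable.
rewrite (_ : _ * _ * _ = (T * `|x - y|) * \int[mu]_t k t); last by ring.
have m0 z : measurable_fun setT (fun t : R => k t * cos (t * z)).
  by have := mkcos z 0; under eq_fun do rewrite addr0.
rewrite -RintegralZl//; last exact: kernel_integrable.
have mB : measurable_fun setT (fun t : R => k t * cos (t * x) - k t * cos (t * y)).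
  exact: measurable_funB.
apply: norm_Rintegral_le.
- exact: mB.
- move=> t; have /andP[kt0 _] := k01 t.
  have [tT|tT] := leP `|t| T; last by rewrite ksupp// !mul0r subrr normr0 mulr0.
  rewrite -mulrBr normrM (ger0_norm kt0) mulrC ler_wpM2r//.
  rewrite (le_trans (norm_subcos_le _ _))// -mulrBr normrM ler_wpM2r//.
- apply: integrable_scale; exact: kernel_integrable.
Qed.

Lemma Rintegral_kerft (L : probability R R) (z : R) :
  \int[L]_y kerft (y - z) = \int[mu]_t (k t * \int[L]_y cos (t * y + - (t * z))).
Proof.
pose f (w : R * measurableTypeR R) : \bar R := (k w.2 * cos (w.2 * (w.1 - z)))%:E.
have mf : measurable_fun setT f.
  apply/measurable_EFinP; apply: measurable_funM.
    apply: measurableT_comp => //; exact: measurable_snd.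
  apply: measurableT_comp; first exact: continuous_measurable_fun (@continuous_cos R).
  apply: measurable_funM; first exact: measurable_snd.
  by apply: measurable_funB => //; exact: measurable_fst.
have intf : (L \x mu)%E.-integrable setT f.
  apply/integrable12ltyP => //.
  apply: (@le_lt_trans _ _ (\int[L]_x (cst (\int[mu]_t k t)%:E) x)%E).
    apply: ge0_le_integral => //.
    - by move=> x _; apply: integral_ge0.
    - apply: (measurable_fun_fubini_tonelli_F (abse \o f)) => //=.
      exact: measurableT_comp.
    - move=> x _; rewrite -EFin_Rintegral; last exact: kernel_integrable.
      apply: ge0_le_integral => //.
      + apply: measurableT_comp => //; apply/measurable_EFinP => /=.
        have := mkcos (x - z) 0; under eq_fun do rewrite addr0; exact.
      + exact/measurable_EFinP.
      + move=> t _; have /andP[kt0 _] := k01 t.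
        by rewrite /f/= lee_fin normrM ger0_norm// ler_piMr// cos_max.
  by rewrite integral_cst// (_ : _ setT = 1%E) ?mule1 ?ltry//; exact: probability_setT.
rewrite /Rintegral; congr fine.
transitivity (\int[L]_y \int[mu]_t f (y, t))%E.
  apply: eq_integral => y _; rewrite /kerft -EFin_Rintegral//.
  exact: kerft_integrable.
rewrite Fubini//; apply: eq_integral => t _.
rewrite -/(Rintegral _ _ _) -RintegralZl//; last exact: integrable_cos.
rewrite -EFin_Rintegral; last by apply: integrable_scale; exact: integrable_cos.
by apply: eq_integral => y _; rewrite /f/= mulrBr.
Qed.

End kernel.

Section kernel_local_limit.
Context (R : realType) (Q : probability R R).
Local Notation mu := (@lebesgue_measure R).
Hypothesis i1 : Q.-integrable setT (EFin \o (fun x : R => x)).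
Hypothesis i2 : Q.-integrable setT (EFin \o (fun x : R => x ^+ 2)).
Hypothesis i3 : Q.-integrable setT (EFin \o (fun x : R => `|x| ^+ 3)).
Hypothesis Q_mean0 : \int[Q]_x x = 0.
Variables (s2 : R).
Hypothesis s2E : \int[Q]_x x ^+ 2 = s2.
Hypothesis s2_gt0 : 0 < s2.

Lemma continuous_cpow n :
  continuous (fun t => (cpow (ecos Q t) (esin Q t) n).1) /\
  continuous (fun t => (cpow (ecos Q t) (esin Q t) n).2).
Proof.
have cc := continuous_of_lip (ecos_lip i1).
have cs := continuous_of_lip (esin_lip i1).
elim: n => [|n [IH1 IH2]] /=; first by split=> x; exact: cvg_cst.
split=> x.
- apply: cvgB; apply: cvgM;
    [exact: IH1|exact: cc|exact: IH2|exact: cs].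
- apply: cvgD; apply: cvgM;
    [exact: IH1|exact: cs|exact: IH2|exact: cc].
Qed.

Variables (T : R) (k : R -> R).
Hypothesis T_gt0 : 0 < T.
Hypothesis mk : measurable_fun setT k.
Hypothesis k01 : forall t, 0 <= k t <= 1.
Hypothesis k1 : forall t, `|1 - k t| <= `|t| / T.
Hypothesis ksupp : forall t, T < `|t| -> k t = 0.
Hypothesis Q_ecf : forall t, 0 < t <= T -> ecf2 Q t < 1.

Let E t n a := (cpow (ecos Q t) (esin Q t) n).1 * cos a -
   (cpow (ecos Q t) (esin Q t) n).2 * sin a.

(** Three errors: the power of the characteristic function against the Gaussian, [k t] against 1,
    and [cos (t * z)] against 1. They are of order [n |t|^3], [|t|] and [|t z|]; in the scale
    [x = sqrt n |t|] each gains a factor [1 / sqrt n], and the powers of [x] are absorbed by a part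
    of the Gaussian. *)
Lemma kernel_pointwise : exists c D, [/\ 0 < c, 0 <= D &
  forall n t z, (0 < n)%N ->
  `|k t * E t n (- (t * z)) - expR (- (n%:R * s2 / 2 * t ^+ 2))| <=
    D * (1 + `|z|) / Num.sqrt n%:R * expR (- (c * n%:R * t ^+ 2)) /\
  `|k t * E t n (- (t * z))| <= expR (- (c * n%:R * t ^+ 2))].
Proof.
have s20 := s2_gt0; have T0 := T_gt0.
have [c /andP[c0 cs2] Hc] := ecf2_on i1 i2 i3 Q_mean0 s2E s2_gt0 erefl T_gt0 Q_ecf.
have [D0 D00 HD] := ecf_pow_gauss i1 i2 i3 Q_mean0 s2E s2_gt0 erefl T_gt0
  (introT andP (conj c0 cs2)) Hc.
have c40 : 0 < c / 4 by rewrite divr_gt0.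
have [C C0 HC] := pow_le_gauss c40.
(* [ecf_pow_gauss] provides the exponent [c / 2]: one half absorbs the powers of [x], the other
   stays. The sum lists the constants of the three errors. *)
exists (c / 4), (C * (D0 + T^-1 + 1)); split => //.
  by rewrite mulr_ge0// !addr_ge0// invr_ge0 ltW.
move=> n t z n0.
have nn0 : 0 < n%:R :> R by rewrite ltr0n.
have sn0 : 0 < Num.sqrt n%:R :> R by rewrite sqrtr_gt0.
have snE : Num.sqrt n%:R ^+ 2 = n%:R :> R by rewrite sqr_sqrtr// ltW.
pose x := Num.sqrt n%:R * `|t|.
have x0 : 0 <= x by rewrite mulr_ge0// ltW.
have x2 : x ^+ 2 = n%:R * t ^+ 2 by rewrite exprMn snE real_normK ?num_real.
have [hx1 hx3] := HC x x0.
pose G := expR (- (c / 4 * n%:R * t ^+ 2)).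
have G0 : 0 <= G by exact: expR_ge0.
have GE : G = expR (- (c / 4 * (n%:R * t ^+ 2))) by rewrite /G; congr expR; ring.
have GG : expR (- (c / 2 * (n%:R * t ^+ 2))) = G * G.
  by rewrite GE -expRD; congr expR; field.
have GK : G * expR (c / 4 * x ^+ 2) = 1.
  by rewrite GE x2 -expRD addNr expR0.
have CE : C = C * expR (c / 4 * x ^+ 2) * G by rewrite -mulrA [_ * G]mulrC GK mulr1.
have g1 : x * (G * G) <= C * G.
  have : x * G <= C by rewrite CE ler_wpM2r.
  by move=> h; rewrite mulrA ler_wpM2r.
have g3 : x ^+ 3 * (G * G) <= C * G.
  have : x ^+ 3 * G <= C by rewrite CE ler_wpM2r.
  by move=> h; rewrite mulrA ler_wpM2r.
have tE : `|t| = x / Num.sqrt n%:R by rewrite /x mulrAC divff ?mul1r// gt_eqF.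
have t3E : n%:R * `|t| ^+ 3 = x ^+ 3 / Num.sqrt n%:R.
  rewrite /x exprMn -{1}snE; field.
  by rewrite gt_eqF.
have t20 : 0 <= n%:R * t ^+ 2 by rewrite mulr_ge0 ?sqr_ge0// ltW.
have gg : expR (- (n%:R * s2 / 2 * t ^+ 2)) <= G * G.
  rewrite -GG ler_expR lerN2.
  have -> : n%:R * s2 / 2 * t ^+ 2 = s2 / 2 * (n%:R * t ^+ 2) by ring.
  by rewrite ler_wpM2r//; lra.
have G1 : G <= 1 by rewrite GE -[leRHS]expR0 ler_expR oppr_le0 mulr_ge0// ltW.
have /andP[kt0 kt1] := k01 t.
set g := expR (- (n%:R * s2 / 2 * t ^+ 2)) in gg *.
have g0 : 0 <= g by exact: expR_ge0.
set r := Num.sqrt n%:R in sn0 snE tE t3E *.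
have b1 : `|t| * (G * G) <= C / r * G.
  rewrite tE mulrAC [leRHS]mulrAC ler_wpM2r// invr_ge0 ltW//.
have b3 : n%:R * `|t| ^+ 3 * (G * G) <= C / r * G.
  rewrite t3E mulrAC [leRHS]mulrAC ler_wpM2r// invr_ge0 ltW//.
have -> : C * (D0 + T^-1 + 1) * (1 + `|z|) / r * G =
   (D0 + T^-1 + 1) * (1 + `|z|) * (C / r * G) by ring.
have CG0 : 0 <= C / r * G by rewrite mulr_ge0// divr_ge0// ltW.
have Ti0 : 0 <= T^-1 by rewrite invr_ge0 ltW.
have z0 : 0 <= `|z| by [].
(* Outside the support only the Gaussian is left, and [1 <= |t| / T] makes it an error of order
   [|t|]. *)
have [tT|tT] := leP `|t| T; last first.
  rewrite ksupp// mul0r sub0r normrN normr0; split => //.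
  rewrite ger0_norm//.
  have tT1 : 1 <= `|t| * T^-1 by rewrite ler_pdivlMr// mul1r ltW.
  apply: (@le_trans _ _ (`|t| * T^-1 * (G * G))).
    by apply: (le_trans gg); rewrite ler_peMl ?mulr_ge0.
  rewrite mulrAC mulrC; apply: (@le_trans _ _ (T^-1 * (C / r * G))).
    by rewrite ler_wpM2l.
  rewrite ler_wpM2r//.
  have -> : (D0 + T^-1 + 1) * (1 + `|z|) = D0 + T^-1 + 1 + (D0 + T^-1 + 1) * `|z| by ring.
  have : 0 <= (D0 + T^-1 + 1) * `|z| by rewrite mulr_ge0// !addr_ge0.
  lra.
have [hE1 hE2] := HD n t (- (t * z)) n0 tT.
rewrite -/(E _ _ _) GG in hE1; rewrite -/(E _ _ _) GG in hE2.
have gE : expR (- (s2 / 2 * (n%:R * t ^+ 2))) = g by rewrite /g; congr expR; ring.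
rewrite gE in hE2.
split; last first.
  rewrite normrM (ger0_norm kt0).
  apply: (@le_trans _ _ (1 * (G * G))); first by rewrite ler_pM.
  by rewrite mul1r ler_piMr.
set e := E t n (- (t * z)) in hE1 hE2 *.
have -> : k t * e - g = k t * (e - g * cos (- (t * z))) -
   (1 - k t) * (g * cos (- (t * z))) - g * (1 - cos (- (t * z))) by ring.
apply: (@le_trans _ _ (D0 * (C / r * G) + T^-1 * (C / r * G) + `|z| * (C / r * G))); last first.
  rewrite -!mulrDl ler_wpM2r//.
  have -> : (D0 + T^-1 + 1) * (1 + `|z|) = D0 + T^-1 + 1 + (D0 + T^-1) * `|z| + `|z| by ring.
  have : 0 <= (D0 + T^-1) * `|z| by rewrite mulr_ge0// !addr_ge0.
  lra.
apply: (le_trans (ler_normB _ _)); apply: lerD.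
  apply: (le_trans (ler_normB _ _)); apply: lerD.
  - rewrite normrM (ger0_norm kt0); apply: (@le_trans _ _ (1 * (D0 * (n%:R * `|t| ^+ 3) * (G * G)))).
      by rewrite ler_pM.
    by rewrite mul1r -mulrA ler_wpM2l.
  - rewrite normrM; apply: (@le_trans _ _ (`|t| / T * (G * G))).
      apply: ler_pM => //; rewrite normrM (ger0_norm g0).
      by apply: (le_trans _ gg); rewrite ler_piMr// cos_max.
    by rewrite mulrAC mulrC ler_wpM2l.
- rewrite normrM (ger0_norm g0).
  apply: (@le_trans _ _ (G * G * (`|t| * `|z|))).
    rewrite ler_pM// (le_trans (norm_1subcos_le _))// normrN normrM//.
  have -> : G * G * (`|t| * `|z|) = `|z| * (`|t| * (G * G)) by ring.
  by rewrite ler_wpM2l.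
Qed.

(** The main term is the integral of [e^(- n s2 t^2 / 2)]. In the error [1 / n], one [1 / sqrt n] is
    pointwise and the other is the width of the dominating Gaussian. The second bound compares
    nothing, hence its uniformity in [z]. *)
Lemma kernel_local_limit : exists2 D, 0 <= D & forall n z L, (0 < n)%N ->
  is_sum_law Q n L ->
  `|\int[L]_y kerft k (y - z) - Num.sqrt (2 * pi / (n%:R * s2))| <= D * (1 + `|z|) / n%:R /\
  `|\int[L]_y kerft k (y - z)| <= D / Num.sqrt n%:R.
Proof.
have [c [D [c0 D0 H]]] := kernel_pointwise.
exists ((D + 1) * Num.sqrt (pi / c)); first by rewrite mulr_ge0 ?addr_ge0// sqrtr_ge0.
move=> n z L n0 HL.
have nn0 : 0 < n%:R :> R by rewrite ltr0n.
have sn0 : 0 < Num.sqrt n%:R :> R by rewrite sqrtr_gt0.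
have snE : Num.sqrt n%:R ^+ 2 = n%:R :> R by rewrite sqr_sqrtr// ltW.
rewrite (Rintegral_kerft T_gt0 mk k01 ksupp).
under eq_Rintegral do rewrite (Rintegral_cos_sum_law _ _ HL).
have a0 : 0 < n%:R * s2 / 2 by rewrite divr_gt0// mulr_gt0.
have cn0 : 0 < c * n%:R by rewrite mulr_gt0.
have -> : Num.sqrt (2 * pi / (n%:R * s2)) = \int[mu]_t expR (- (n%:R * s2 / 2 * t ^+ 2)).
  rewrite Rintegral_gauss//; congr Num.sqrt; field.
  by rewrite !gt_eqF.
have mE : measurable_fun setT (fun t => k t * E t n (- (t * z))).
  have [cA cB] := continuous_cpow n.
  have mt : measurable_fun setT (fun t : R => - (t * z)).
    by apply: measurable_funN; exact: measurable_funM.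
  apply: measurable_funM => //; apply: measurable_funB; apply: measurable_funM.
  - exact: continuous_measurable_fun.
  - by apply: measurableT_comp mt; exact: continuous_measurable_fun (@continuous_cos R).
  - exact: continuous_measurable_fun.
  - by apply: measurableT_comp mt; exact: continuous_measurable_fun (@continuous_sin R).
have iG : mu.-integrable setT (EFin \o (fun t => expR (- (c * n%:R * t ^+ 2)))).
  exact: integrable_gauss.
have ig := integrable_gauss a0.
have mg := measurable_gauss (n%:R * s2 / 2).
have iE : mu.-integrable setT (EFin \o (fun t => k t * E t n (- (t * z)))).
  by apply: integrable_le iG => // t; have [] := H n t z n0.
have sqE : Num.sqrt (pi / (c * n%:R)) = Num.sqrt (pi / c) / Num.sqrt n%:R.
  rewrite -sqrtrV ?ltW// -sqrtrM; last by rewrite divr_ge0 ?pi_ge0// ltW.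
  by rewrite invfM mulrA.
split.
- rewrite -RintegralB//.
  apply: (@le_trans _ _ (\int[mu]_t (D * (1 + `|z|) / Num.sqrt n%:R * expR (- (c * n%:R * t ^+ 2))))).
    apply: norm_Rintegral_le.
    + exact: measurable_funB.
    + by move=> t; have [] := H n t z n0.
    + exact: integrable_scale.
  rewrite RintegralZl// Rintegral_gauss// sqE -[in leRHS]snE.
  have -> : D * (1 + `|z|) / Num.sqrt n%:R * (Num.sqrt (pi / c) / Num.sqrt n%:R) =
     D * (Num.sqrt (pi / c) * (1 + `|z|) / Num.sqrt n%:R ^+ 2).
    by field; rewrite gt_eqF.
  rewrite -!mulrA ler_wpM2r ?lerDl// !mulr_ge0 ?sqrtr_ge0// ?invr_ge0 ?sqr_ge0//.
- apply: (@le_trans _ _ (\int[mu]_t (expR (- (c * n%:R * t ^+ 2))))).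
    apply: norm_Rintegral_le => //.
    by move=> t; have [] := H n t z n0.
  rewrite Rintegral_gauss// sqE -mulrA ler_peMl ?lerDr//.
Qed.

End kernel_local_limit.

(** * Integrals computed from a primitive *)

Section FTC_everywhere.
Context (R : realType).
Local Notation mu := (@lebesgue_measure R).
Implicit Types (F f : R -> R) (a b l : R).

Lemma is_derive_continuous F f : (forall x : R, is_derive x 1 F (f x)) -> continuous F.
Proof.
move=> dF x; apply: differentiable_continuous; apply/derivable1_diffP.
by have [] := dF x.
Qed.

Lemma Rintegral_is_derive F f a b : a < b -> continuous f ->
  (forall x : R, is_derive x 1 F (f x)) -> \int[mu]_(x in `[a, b]) f x = F b - F a.
Proof.
move=> ab cf dF; have cF := is_derive_continuous dF.
rewrite /Rintegral (continuous_FTC2 (F := F) ab) ?EFinB//.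
- exact: continuous_subspaceT.
- split=> [x _||]; first by have [] := dF x.
    by apply: cvg_at_right_filter; exact: cF.
  by apply: cvg_at_left_filter; exact: cF.
- by move=> x _; rewrite derive1E; apply: derive_val.
Qed.

Lemma ge0_integral_is_derive_y F f a l : continuous f ->
  (forall x, a <= x -> 0 <= f x) ->
  (forall x : R, is_derive x 1 F (f x)) -> F x @[x --> +oo] --> l ->
  (\int[mu]_(x in `[a, +oo[) (f x)%:E = (l - F a)%:E)%E.
Proof.
move=> cf f0 dF Fl; have cF := is_derive_continuous dF.
rewrite (ge0_continuous_FTC2y (F := F) f0 _ Fl) ?EFinB//.
- exact: continuous_subspaceT.
- by apply: cvg_at_right_filter; exact: cF.
- by move=> x _; rewrite derive1E; apply: derive_val.
Qed.

(** The cut at 0 is for the tent, whose formula changes there: on each half a smooth primitive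
    exists. *)
Lemma Rintegral_supp_itv f T : 0 < T -> (forall t, T < `|t| -> f t = 0) ->
  mu.-integrable setT (EFin \o f) ->
  \int[mu]_t f t = \int[mu]_(t in `[- T, 0]) f t + \int[mu]_(t in `[0, T]) f t.
Proof.
move=> T0 f0 intf.
have -> : \int[mu]_t f t = \int[mu]_(t in `[- T, T]) f t.
  rewrite [RHS]Rintegral_mkcond; apply: eq_Rintegral => t _.
  rewrite patchE; case: ifPn => // tT; apply: f0; rewrite ltNge.
  by apply: contra tT; rewrite ler_norml inE/= in_itv.
rewrite (@itv_bndbnd_setU _ _ _ (BRight 0)); last 2 first.
  by rewrite bnd_simp lerNl oppr0 ltW.
  by rewrite bnd_simp ltW.
rewrite Rintegral_setU//=.
- rewrite Rintegral_itv_obnd_cbnd//.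
  by apply: integrableS intf.
- by apply: integrableS intf => //; exact: measurableU.
- apply/disj_setPS => y [/=]; rewrite !in_itv/= => /andP[_ yx] /andP[].
  by rewrite ltNge yx.
Qed.

End FTC_everywhere.

(** * The Fejer kernel *)

Section fejer.
Context (R : realType).
Local Notation mu := (@lebesgue_measure R).
Variable T : R.
Hypothesis T_gt0 : 0 < T.

Definition fejer_weight (t : R) : R := Num.max 0 (1 - `|t| / T).

Lemma measurable_fejer_weight : measurable_fun setT fejer_weight.
Proof.
apply: measurable_maxr => //; apply: measurable_funB => //.
by apply: measurable_funM => //; exact: measurableT_comp.
Qed.

Lemma fejer_weight01 t : 0 <= fejer_weight t <= 1.
Proof.
by rewrite le_max lexx ge_max ler01 gerBl divr_ge0// ltW.
Qed.

Lemma fejer_weight1 t : `|1 - fejer_weight t| <= `|t| / T.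
Proof.
have t0 : 0 <= `|t| / T by rewrite divr_ge0// ltW.
rewrite /fejer_weight; have [h|h] := leP 0 (1 - `|t| / T).
  by rewrite opprB addrCA subrr addr0 ger0_norm.
by rewrite subr0 ger0_norm//; lra.
Qed.

Lemma fejer_weight_supp t : T < `|t| -> fejer_weight t = 0.
Proof.
move=> tT; apply/max_idPl; rewrite subr_le0 ler_pdivlMr// mul1r; exact: ltW.
Qed.

Definition fejer (x : R) := kerft fejer_weight x.

Lemma fejer_integrable x :
  mu.-integrable setT (EFin \o (fun t => fejer_weight t * cos (t * x))).
Proof.
exact: (kerft_integrable T_gt0 measurable_fejer_weight fejer_weight01 fejer_weight_supp).
Qed.

Lemma continuous_fejer : continuous fejer.
Proof.
exact: (continuous_kerft T_gt0 measurable_fejer_weight fejer_weight01 fejer_weight_supp).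
Qed.

(** The closed form shows what the integral hides: nonnegativity and decay in [1 / x^2]. *)
Lemma fejerE x : x != 0 -> fejer x = 2 * (1 - cos (T * x)) / (T * x ^+ 2).
Proof.
move=> x0; have T0 : T != 0 by rewrite gt_eqF.
rewrite /fejer /kerft (Rintegral_supp_itv T_gt0); last 2 first.
  by move=> t tT; rewrite fejer_weight_supp// mul0r.
  exact: fejer_integrable.
have -> : \int[mu]_(t in `[- T, 0]) (fejer_weight t * cos (t * x)) =
   \int[mu]_(t in `[- T, 0]) ((1 + 1 * (t / T)) * cos (t * x)).
  apply: eq_Rintegral => t; rewrite inE/= in_itv/= => /andP[Tt t0].
  rewrite /fejer_weight ler0_norm// mulNr opprK mul1r; congr (_ * _); apply/max_idPr.
  by rewrite -lerBlDl sub0r ler_pdivlMr// mulN1r.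
have -> : \int[mu]_(t in `[0, T]) (fejer_weight t * cos (t * x)) =
   \int[mu]_(t in `[0, T]) ((1 + -1 * (t / T)) * cos (t * x)).
  apply: eq_Rintegral => t; rewrite inE/= in_itv/= => /andP[t0 tT].
  rewrite /fejer_weight ger0_norm// mulN1r; congr (_ * _); apply/max_idPr.
  by rewrite subr_ge0 ler_pdivrMr// mul1r.
have cc (s : R) : continuous (fun t : R => (1 + s * (t / T)) * cos (t * x)).
  move=> t; apply: cvgM; last first.
    by apply: continuous_comp; [exact: mulrr_continuous|exact: continuous_cos].
  by apply: cvgD; [exact: cvg_cst|apply: cvgM; [exact: cvg_cst|exact: mulrr_continuous]].
(* Primitive found by integration by parts; [s = 1] on the left half of the tent, [s = -1] on the
   right half. *)
have dF (s : R) (t : R) : is_derive t 1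
   (fun t : R => (1 + s * (t / T)) * (sin (t * x) / x) + s * cos (t * x) / (T * x ^+ 2))
   ((1 + s * (t / T)) * cos (t * x)).
  apply: is_derive_eq; rewrite /GRing.scale/=; field.
  by rewrite x0 T0.
rewrite (Rintegral_is_derive _ (cc 1) (dF 1)) ?oppr_lt0//.
rewrite (Rintegral_is_derive _ (cc (-1)) (dF (-1)))//.
rewrite !mul0r mulNr sin0 cos0 mulNr cosN sinN; field.
by rewrite x0 T0.
Qed.

Lemma fejerN x : fejer (- x) = fejer x.
Proof.
by rewrite /fejer /kerft; apply: eq_Rintegral => t _; rewrite mulrN cosN.
Qed.

Lemma fejer_ge0 x : 0 <= fejer x.
Proof.
have [->|x0] := eqVneq x 0; last first.
  by rewrite fejerE// divr_ge0// mulr_ge0// ?sqr_ge0 ?(ltW T_gt0)// subr_ge0 cos_le1.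
apply: Rintegral_ge0 => t _; rewrite mulr0 cos0 mulr1.
by have /andP[] := fejer_weight01 t.
Qed.

Lemma fejer_le x : x != 0 -> fejer x <= 4 / (T * x ^+ 2).
Proof.
move=> x0; rewrite fejerE// ler_wpM2r//.
  by rewrite invr_ge0 mulr_ge0 ?sqr_ge0 ?(ltW T_gt0).
have := cos_geN1 (T * x); lra.
Qed.

End fejer.

(** * Laplace transform of the cosine and Cauchy kernel *)

Section laplace_cauchy.
Context (R : realType).
Local Notation mu := (@lebesgue_measure R).
Implicit Types (e t x : R).

Lemma cvg_expRN_mul e : 0 < e -> expR (- (e * x)) @[x --> +oo] --> (0 : R).
Proof.
move=> e0; apply: (@cvg_comp _ _ _ (fun x => e * x) (fun z => expR (- z)) _ (pinfty_nbhs R)); last exact: cvgr_expR.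
exact: gt0_cvgMry.
Qed.

Lemma continuous_laplace_cos e t : continuous (fun x => expR (- (e * x)) * (1 + cos (t * x))).
Proof.
move=> x; apply: cvgM.
  apply: continuous_comp; last exact: continuous_expR.
  by apply: cvgN; exact: mulrl_continuous.
apply: cvgD; first exact: cvg_cst.
by apply: continuous_comp; [exact: mulrl_continuous|exact: continuous_cos].
Qed.

(** The added 1 makes the integrand nonnegative, as needed to integrate over the half-line from a
    primitive and then to use Tonelli. It contributes [e^-1]. *)
Lemma integral_laplace_cos e t : 0 < e ->
  (\int[mu]_(x in `[0%R, +oo[) (expR (- (e * x)) * (1 + cos (t * x)))%:E =
    (e^-1 + e / (e ^+ 2 + t ^+ 2))%:E)%E.
Proof.
move=> e0; have en0 : e != 0 by rewrite gt_eqF.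
have et0 : 0 < e ^+ 2 + t ^+ 2 by rewrite ltr_pwDl ?exprn_gt0 ?sqr_ge0.
have etn0 : e ^+ 2 + t ^+ 2 != 0 by rewrite gt_eqF.
pose B x := - e^-1 + (t * sin (t * x) - e * cos (t * x)) / (e ^+ 2 + t ^+ 2).
have dF x : is_derive x 1 (fun x => expR (- (e * x)) * B x)
   (expR (- (e * x)) * (1 + cos (t * x))).
  apply: is_derive_eq; rewrite /B /GRing.scale/=; field.
  by rewrite en0 etn0.
pose C := e^-1 + (`|t| + e) / (e ^+ 2 + t ^+ 2).
have BC x : `|B x| <= C.
  apply: (le_trans (ler_normD _ _)); apply: lerD.
    by rewrite normrN ger0_norm// invr_ge0 ltW.
  rewrite normrM [X in _ * X]ger0_norm ?invr_ge0 ?(ltW et0)// ler_wpM2r ?invr_ge0 ?(ltW et0)//.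
  apply: (le_trans (ler_normB _ _)); rewrite !normrM (gtr0_norm e0).
  by apply: lerD; rewrite ler_piMr ?sin_max ?cos_max// ltW.
have F0 : expR (- (e * x)) * B x @[x --> +oo] --> (0 : R).
  have CF : C * expR (- (e * x)) @[x --> +oo] --> (0 : R).
    by rewrite -[X in _ --> X](mulr0 C); apply: cvgM; [exact: cvg_cst|exact: cvg_expRN_mul].
  apply: norm_cvg0; apply: (@squeeze_cvgr _ _ _ _ (cst 0) (fun x => C * expR (- (e * x)))) => //.
    apply/nearW => x; rewrite /= normr_ge0/= normrM ger0_norm ?expR_ge0// mulrC.
    by rewrite ler_wpM2r ?expR_ge0.
  exact: cvg_cst.
rewrite (ge0_integral_is_derive_y _ _ dF F0).
- congr _%:E; rewrite mulr0 oppr0 expR0 /B mulr0 sin0 cos0; field.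
  by rewrite en0 etn0.
- exact: continuous_laplace_cos.
- by move=> x _; rewrite mulr_ge0 ?expR_ge0// -lerBlDl sub0r cos_geN1.
Qed.

(** [pi] times the Cauchy density of scale [e]: of mass [pi] for every [e > 0], and concentrating at
    0 as [e] tends to 0. *)
Definition cauchy e t := e / (e ^+ 2 + t ^+ 2).

Lemma cauchy_ge0 e t : 0 < e -> 0 <= cauchy e t.
Proof. by move=> e0; rewrite divr_ge0 ?addr_ge0 ?sqr_ge0// ltW. Qed.

Lemma continuous_cauchy e : 0 < e -> continuous (cauchy e).
Proof.
move=> e0 t; apply: cvgM; first exact: cvg_cst.
apply: cvgV; first by rewrite gt_eqF// ltr_pwDl ?exprn_gt0 ?sqr_ge0.
by apply: cvgD; [exact: cvg_cst|exact: exprn_continuous].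
Qed.

Lemma is_derive_cauchy e t : 0 < e -> is_derive t 1 (fun t => atan (t / e)) (cauchy e t).
Proof.
move=> e0; have en0 : e != 0 by rewrite gt_eqF.
have et0 : e ^+ 2 + t ^+ 2 != 0 by rewrite gt_eqF// ltr_pwDl ?exprn_gt0 ?sqr_ge0.
apply: is_derive_eq; rewrite /cauchy /GRing.scale/=; field.
by rewrite en0 et0.
Qed.

Lemma integral_cauchy e : 0 < e -> (\int[mu]_t (cauchy e t)%:E = pi%:E)%E.
Proof.
move=> e0.
rewrite ge0_symfun_integralT; last 3 first.
- by move=> t; exact: cauchy_ge0.
- exact: continuous_cauchy.
- by move=> t; rewrite /cauchy /= sqrrN.
have cv : atan (t / e) @[t --> +oo] --> pi / 2.
  apply: (@cvg_comp _ _ _ (fun t => t / e) atan _ (pinfty_nbhs R)); last exact: cvgy_atan.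
  by apply: gt0_cvgMly; [rewrite invr_gt0|exact: cvg_id].
rewrite -set_itvcy (ge0_integral_is_derive_y (continuous_cauchy e0)
  (fun t _ => cauchy_ge0 t e0) (fun t => is_derive_cauchy t e0) cv).
by rewrite mul0r atan0 subr0 -EFinM; congr _%:E; field.
Qed.

Lemma Rintegral_cauchy_itv e d : 0 < e -> 0 < d ->
  \int[mu]_(t in `[- d, d]) cauchy e t = 2 * atan (d / e).
Proof.
move=> e0 d0; have dd : - d < d by rewrite gtrN.
rewrite (Rintegral_is_derive dd (continuous_cauchy e0) (fun t => is_derive_cauchy t e0)).
by rewrite mulNr atanN; ring.
Qed.

End laplace_cauchy.

(** * Fejer smoothing *)

Lemma integral_expRN (R : realType) (e : R) : 0 < e ->
  (\int[@lebesgue_measure R]_(x in `[0%R, +oo[) (expR (- (e * x)))%:E = (e^-1)%:E)%E.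
Proof.
move=> e0; have en0 : e != 0 by rewrite gt_eqF.
have dF (x : R) : is_derive x 1 (fun x : R => - e^-1 * expR (- (e * x))) (expR (- (e * x))).
  by apply: is_derive_eq; rewrite /GRing.scale/=; field.
have F0 : - e^-1 * expR (- (e * x)) @[x --> +oo] --> (0 : R).
  by rewrite -[X in _ --> X](mulr0 (- e^-1)); apply: cvgM; [exact: cvg_cst|exact: cvg_expRN_mul].
have c : continuous (fun x : R => expR (- (e * x))).
  move=> x; apply: continuous_comp; last exact: continuous_expR.
  by apply: cvgN; exact: mulrl_continuous.
rewrite (ge0_integral_is_derive_y c (fun x _ => expR_ge0 _) dF F0).
by rewrite mulr0 oppr0 expR0 mulr1 sub0r opprK.
Qed.

Section fejer_mass.
Context (R : realType).
Local Notation mu := (@lebesgue_measure R).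
Variable T : R.
Hypothesis T_gt0 : 0 < T.
Local Notation k := (fejer_weight T).
Local Notation K := (fejer T).

Let mk : measurable_fun setT k. Proof. exact: measurable_fejer_weight. Qed.
Let k0 t : 0 <= k t. Proof. by have /andP[] := fejer_weight01 T_gt0 t. Qed.
Let k1 t : k t <= 1. Proof. by have /andP[] := fejer_weight01 T_gt0 t. Qed.
Let ik : mu.-integrable setT (EFin \o k).
Proof.
exact: (kernel_integrable T_gt0 mk (fejer_weight01 T_gt0) (fejer_weight_supp T_gt0)).
Qed.
Let mK : measurable_fun setT K.
Proof. by apply: continuous_measurable_fun; exact: continuous_fejer. Qed.

(* Abel regularization: as [e] tends to 0 the left-hand side increases to the
   mass of [K] on the half-line, and the right-hand side tends to [pi * k 0]. *)
Lemma integral_laplace_fejer e : 0 < e ->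
  (\int[mu]_(x in `[0%R, +oo[) (expR (- (e * x)) * K x)%:E =
   \int[mu]_t (k t * cauchy e t)%:E)%E.
Proof.
move=> e0; have en0 : e != 0 by rewrite gt_eqF.
pose kap := \int[mu]_t k t.
pose D : set R := `[0, +oo[%classic.
have mD : measurable D by exact: measurable_itv.
pose w x : R := expR (- (e * x)) * \1_D x.
have w0 x : 0 <= w x by rewrite mulr_ge0 ?expR_ge0.
have mw : measurable_fun setT w.
  apply: measurable_funM; last exact: measurable_indic.
  by apply: measurableT_comp => //; apply: measurable_funN; exact: measurable_funM.
have wE (f : R -> R) : measurable_fun setT f -> (forall x, 0 <= f x) ->
    (\int[mu]_(x in `[0%R, +oo[) (expR (- (e * x)) * f x)%:E = \int[mu]_x (w x * f x)%:E)%E.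
  move=> mf f0; rewrite integral_mkcond; apply: eq_integral => x _.
  rewrite patchE /w indicE -/D; case: ifPn => xD; first by rewrite mulr1.
  by rewrite mulr0 mul0r.
(* The cosine is replaced by [1 + cos] for Tonelli. This adds the finite quantity [kap / e] to both
   sides, which is subtracted at the end. *)
pose f (z : measurableTypeR R * measurableTypeR R) : \bar R :=
  (w z.1 * (k z.2 * (1 + cos (z.2 * z.1))))%:E.
have c0 (y : R) : 0 <= 1 + cos y by rewrite -lerBlDl sub0r cos_geN1.
have mf : measurable_fun setT f.
  apply/measurable_EFinP; apply: measurable_funM.
    apply: measurableT_comp => //; exact: measurable_fst.
  apply: measurable_funM.
    apply: measurableT_comp => //; exact: measurable_snd.
  apply: measurable_funD => //.
  apply: measurableT_comp; first exact: continuous_measurable_fun (@continuous_cos R).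
  by apply: measurable_funM; [exact: measurable_snd|exact: measurable_fst].
have f0 z : (0 <= f z)%E by rewrite lee_fin !mulr_ge0.
have := @fubini_tonelli _ _ _ _ R mu mu f mf f0.
have -> : (\int[mu]_x \int[mu]_y f (x, y) = \int[mu]_x (w x * (kap + K x))%:E)%E.
  apply: eq_integral => x _; rewrite /f/=.
  have iK := fejer_integrable T_gt0 x.
  have : mu.-integrable setT (EFin \o (fun t => k t * (1 + cos (t * x)))).
    by under eq_fun do rewrite mulrDr mulr1; exact: integrable_add.
  move=> ikc; rewrite EFin_Rintegral; last exact: integrable_scale.
  rewrite RintegralZl//; congr (_ * _)%:E.
  under eq_Rintegral do rewrite mulrDr mulr1.
  by rewrite RintegralD.
have -> : (\int[mu]_y \int[mu]_x f (x, y) = \int[mu]_t (e^-1 * k t + k t * cauchy e t)%:E)%E.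
  apply: eq_integral => t _; rewrite /f/=.
  have cE x : w x * (k t * (1 + cos (t * x))) = k t * (w x * (1 + cos (t * x))) by ring.
  under eq_integral do rewrite cE EFinM.
  have mc : measurable_fun setT (fun x : R => 1 + cos (t * x)).
    apply: measurable_funD => //.
    by have := measurable_cos_affine t 0; under eq_fun do rewrite addr0.
  rewrite ge0_integralZl//=.
  - rewrite -wE// integral_laplace_cos// -EFinM; congr _%:E.
    by rewrite /cauchy mulrDr (mulrC (k t)).
  - apply/measurable_EFinP; exact: measurable_funM.
  - by move=> x _; rewrite lee_fin mulr_ge0.
  - by rewrite lee_fin.
have kap0 : 0 <= kap by apply: Rintegral_ge0 => t _.
have -> : (\int[mu]_x (w x * (kap + K x))%:E = (kap * e^-1)%:E + \int[mu]_x (w x * K x)%:E)%E.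
  under eq_integral do rewrite mulrDr EFinD.
  rewrite ge0_integralD//=; last 4 first.
  - by move=> x _; rewrite lee_fin mulr_ge0.
  - by apply/measurable_EFinP; exact: measurable_funM.
  - by move=> x _; rewrite lee_fin mulr_ge0// fejer_ge0.
  - by apply/measurable_EFinP; exact: measurable_funM.
  congr (_ + _)%E.
  rewrite -wE//.
  under eq_integral do rewrite mulrC EFinM.
  have me : measurable_fun setT (fun x : R => (expR (- (e * x)))%:E).
    apply/measurable_EFinP; apply: measurableT_comp => //.
    by apply: measurable_funN; exact: measurable_funM.
  by rewrite ge0_integralZl//= ?integral_expRN ?EFinM//; exact: measurable_funTS.
have -> : (\int[mu]_t (e^-1 * k t + k t * cauchy e t)%:E = (kap * e^-1)%:E + \int[mu]_t (k t * cauchy e t)%:E)%E.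
  under eq_integral do rewrite EFinD.
  rewrite ge0_integralD//=; last 4 first.
  - by move=> x _; rewrite lee_fin mulr_ge0// invr_ge0 ltW.
  - by apply/measurable_EFinP; exact: measurable_funM.
  - by move=> x _; rewrite lee_fin mulr_ge0// cauchy_ge0.
  - apply/measurable_EFinP; apply: measurable_funM => //.
    by apply: continuous_measurable_fun; exact: continuous_cauchy.
  congr (_ + _)%E.
  by rewrite EFin_Rintegral; [rewrite RintegralZl// mulrC|exact: integrable_scale].
have mK' := fun x => fejer_ge0 T_gt0 x.
rewrite wE// => /(congr1 (fun y => y - (kap * e^-1)%:E)%E).
by rewrite ![((kap * e^-1)%:E + _)%E]addeC !addeK.
Qed.

Lemma integral_laplace_fejer_le e : 0 < e ->
  (\int[mu]_(x in `[0%R, +oo[) (expR (- (e * x)) * K x)%:E <= pi%:E)%E.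
Proof.
move=> e0; rewrite integral_laplace_fejer// -(integral_cauchy e0).
apply: ge0_le_integral => //.
- by move=> t _; rewrite lee_fin mulr_ge0// cauchy_ge0.
- apply/measurable_EFinP; apply: measurable_funM => //.
  by apply: continuous_measurable_fun; exact: continuous_cauchy.
- by apply/measurable_EFinP; apply: continuous_measurable_fun; exact: continuous_cauchy.
- by move=> t _; rewrite lee_fin ler_piMl// cauchy_ge0.
Qed.

(** On [[-d, d]] the tent is at least [1 - d / T], and the Cauchy kernel has mass [2 atan (d / e)]
    there. *)
Lemma integral_laplace_fejer_ge e d : 0 < e -> 0 < d -> d <= T ->
  (((1 - d / T) * (2 * atan (d / e)))%:E <=
   \int[mu]_(x in `[0%R, +oo[) (expR (- (e * x)) * K x)%:E)%E.
Proof.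
move=> e0 d0 dT; rewrite integral_laplace_fejer//.
have dd : - d < d by rewrite gtrN.
have cc := continuous_cauchy e0.
have mc := continuous_measurable_fun cc.
have mkc : measurable_fun setT (fun t : R => (k t * cauchy e t)%:E).
  by apply/measurable_EFinP; apply: measurable_funM.
apply: (@le_trans _ _ (\int[mu]_(t in `[(- d)%R, d]) (k t * cauchy e t)%:E)%E); last first.
  apply: ge0_subset_integral => //.
  by move=> t _; rewrite lee_fin mulr_ge0// cauchy_ge0.
apply: (@le_trans _ _ (\int[mu]_(t in `[(- d)%R, d]) ((1 - d / T) * cauchy e t)%:E)%E); last first.
  have dT1 : 0 <= 1 - d / T by rewrite subr_ge0 ler_pdivrMr// mul1r.
  apply: ge0_le_integral => //.
  - by move=> t _; rewrite lee_fin mulr_ge0// cauchy_ge0.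
  - by apply/measurable_EFinP; apply: measurable_funTS; apply: measurable_funM.
  - exact: measurable_funTS.
  - move=> t; rewrite /= in_itv/= -ler_norml => td; rewrite lee_fin ler_wpM2r ?cauchy_ge0//.
    rewrite /fejer_weight le_max; apply/orP; right.
    by rewrite lerD2l lerN2 ler_wpM2r// invr_ge0 ltW.
rewrite -(Rintegral_cauchy_itv e0 d0) -RintegralZl//; last first.
  apply: continuous_compact_integrable; first exact: segment_compact.
  exact: continuous_subspaceT.
rewrite /Rintegral fineK//.
apply: integrable_fin_num => //.
apply: continuous_compact_integrable; first exact: segment_compact.
apply: continuous_subspaceT => x; apply: cvgM; [exact: cvg_cst|exact: cc].
Qed.

(** Upper bound: monotone convergence along [e = 1 / (n + 1)], each integral being at most [pi].
    Lower bound: drop the factor [e^(- e x) <= 1] and optimize [d] and [e]. *)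
Lemma integral_fejer_half : (\int[mu]_(x in `[0%R, +oo[) (K x)%:E = pi%:E)%E.
Proof.
have K0 := fejer_ge0 T_gt0.
apply/eqP; rewrite eq_le; apply/andP; split.
- pose g n x : \bar R := (expR (- (n.+1%:R^-1 * x)) * K x)%:E.
  have gK x : (x \in `[0%R, +oo[%classic) -> limn (g ^~ x) = (K x)%:E.
    move=> _; apply/cvg_lim => //; apply: cvg_EFin; first exact: nearW.
    rewrite -[X in _ --> X]mul1r; apply: cvgM; last exact: cvg_cst.
    have h0 : - (n.+1%:R^-1 * x) @[n --> \oo] --> - (0 * x).
      by apply: cvgN; apply: cvgM; [exact: cvg_harmonic|exact: cvg_cst].
    have : expR (- (n.+1%:R^-1 * x)) @[n --> \oo] --> expR (- (0 * x)).
      by apply: continuous_cvg h0; exact: continuous_expR.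
    by rewrite mul0r oppr0 expR0.
  have -> : (\int[mu]_(x in `[0%R, +oo[) (K x)%:E = \int[mu]_(x in `[0%R, +oo[) limn (g ^~ x))%E.
    by apply: eq_integral => x /gK ->.
  have mg n : measurable_fun (`[0%R, +oo[ : set R) (g n).
    apply: measurable_funTS; apply/measurable_EFinP; apply: measurable_funM => //.
    by apply: measurableT_comp => //; apply: measurable_funN; exact: measurable_funM.
  have g0 n x : (`[0%R, +oo[%classic : set R) x -> (0 <= g n x)%E.
    by move=> _; rewrite lee_fin mulr_ge0 ?expR_ge0.
  have ndg x : (`[0%R, +oo[%classic : set R) x -> {homo g ^~ x : n m / (n <= m)%N >-> (n <= m)%E}.
    rewrite /= in_itv/= andbT => x0 n m nm; rewrite lee_fin ler_wpM2r// ler_expR lerN2.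
    by rewrite ler_wpM2r// lef_pV2 ?posrE ?ltr0n// ler_nat ltnS.
  rewrite (@monotone_convergence _ (measurableTypeR R) R mu _ (measurable_itv `[0%R, +oo[) _ mg g0 ndg).
  apply: lime_le; last by apply: nearW => n; exact: integral_laplace_fejer_le.
  apply: ereal_nondecreasing_is_cvgn => m n mn; apply: ge0_le_integral => //.
  - by move=> x; exact: g0.
  - exact: mg.
  - exact: mg.
  - by move=> x xD; exact: ndg.
- have T0 : T != 0 by rewrite gt_eqF.
  have E1 (N : R) : N != 0 -> T / N / (T / N / N) = N by move=> N0; field; rewrite N0 T0.
  have E2 (N : R) : N != 0 -> T / N / T = N^-1 by move=> N0; field; rewrite N0 T0.
  have le n : (((1 - n.+1%:R^-1) * (2 * atan n.+1%:R))%:E <= \int[mu]_(x in `[0%R, +oo[) (K x)%:E)%E.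
    (* [d = T / (n + 1)] and [e = d / (n + 1)] make [d / T] tend to 0 while [d / e] tends to
       infinity. *)
    have d0 : 0 < T / n.+1%:R by rewrite divr_gt0.
    have e0 : 0 < T / n.+1%:R / n.+1%:R by rewrite divr_gt0.
    have dT : T / n.+1%:R <= T by rewrite ler_pdivrMr// ler_peMr ?(ltW T_gt0)// ler1n.
    have := integral_laplace_fejer_ge e0 d0 dT.
    rewrite E1 ?pnatr_eq0// E2 ?pnatr_eq0//.
    move=> /le_trans; apply; apply: ge0_le_integral => //.
    + by move=> x _; rewrite lee_fin mulr_ge0 ?expR_ge0.
    + apply: measurable_funTS; apply/measurable_EFinP; apply: measurable_funM => //.
      by apply: measurableT_comp => //; apply: measurable_funN; exact: measurable_funM.
    + by apply: measurable_funTS; exact/measurable_EFinP.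
    + move=> x; rewrite /= in_itv/= andbT => x0; rewrite lee_fin ler_piMl//.
      by rewrite -[leRHS]expR0 ler_expR oppr_le0 mulr_ge0// ltW.
  have cv : (1 - n.+1%:R^-1) * (2 * atan n.+1%:R) @[n --> \oo] --> (pi : R).
    have -> : pi = (1 - 0) * (2 * (pi / 2)) :> R by field.
    apply: cvgM; first by apply: cvgB; [exact: cvg_cst|exact: cvg_harmonic].
    apply: cvgM; first exact: cvg_cst.
    apply: (@cvg_comp _ _ _ (fun n : nat => n.+1%:R) (@atan R) _ (pinfty_nbhs R)); last exact: cvgy_atan.
    by rewrite (cvg_shiftS (fun n : nat => n%:R : R)); exact: cvgr_idn.
  have cvE : (((1 - n.+1%:R^-1) * (2 * atan n.+1%:R))%:E @[n --> \oo] --> (pi%:E : \bar R))%E.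
    by apply: cvg_EFin cv; exact: nearW.
  rewrite -(cvg_lim _ cvE)//; apply: lime_le; last exact: nearW.
  by apply/cvg_ex; eexists; exact: cvE.
Qed.

Lemma integral_fejer : (\int[mu]_x (K x)%:E = (2 * pi)%:E)%E.
Proof.
rewrite ge0_symfun_integralT.
- by rewrite -set_itvcy integral_fejer_half.
- exact: fejer_ge0.
- exact: continuous_fejer.
- by move=> x; rewrite /= fejerN.
Qed.

(** For [|x| > h], [1 / x^2 <= 2 / (h^2 + x^2)]: the tail is dominated by a multiple of the Cauchy
    kernel of scale [h], whose mass is known. *)
Lemma integral_fejer_tail h : 0 < h ->
  (\int[mu]_(x in ~` `[(- h)%R, h]) (K x)%:E <= (8 * pi / (T * h))%:E)%E.
Proof.
move=> h0; have hn0 : h != 0 by rewrite gt_eqF.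
have T0 : T != 0 by rewrite gt_eqF.
have mc1 : measurable_fun setT (fun x : R => cauchy h x).
  by apply: continuous_measurable_fun; exact: continuous_cauchy.
have c0 : 0 <= 8 / (T * h) by rewrite divr_ge0// mulr_ge0// ltW.
apply: (@le_trans _ _ (\int[mu]_x (8 / (T * h) * cauchy h x)%:E)%E); last first.
  under eq_integral do rewrite EFinM.
  rewrite ge0_integralZl//=.
  - rewrite integral_cauchy// -EFinM lee_fin le_eqVlt; apply/orP; left; apply/eqP; ring.
  - exact/measurable_EFinP.
  - by move=> x _; rewrite lee_fin cauchy_ge0.
rewrite integral_mkcond; apply: ge0_le_integral => //.
- by move=> x _; rewrite patchE; case: ifP => // _; rewrite lee_fin fejer_ge0.
- apply/(measurable_restrictT _ (measurableC (measurable_itv _))).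
  by apply: measurable_funTS; exact/measurable_EFinP.
- by apply/measurable_EFinP; exact: measurable_funM.
move=> x _; rewrite patchE; case: ifPn => [|_]; last by rewrite lee_fin mulr_ge0// cauchy_ge0.
rewrite inE/= in_itv/= -ler_norml => /negP; rewrite -ltNge => hx.
have xn0 : x != 0 by apply/eqP => x0; move: hx; rewrite x0 normr0 ltNge (ltW h0).
have hx2 : h ^+ 2 <= x ^+ 2.
  by rewrite -(real_normK (num_real x)) lerXn2r ?nnegrE// ltW.
have h20 : 0 < h ^+ 2 by rewrite exprn_gt0.
have x20 : 0 < x ^+ 2 by exact: lt_le_trans hx2.
have hx0 : 0 < h ^+ 2 + x ^+ 2 by rewrite addr_gt0.
rewrite lee_fin (le_trans (fejer_le T_gt0 xn0))// /cauchy.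
have -> : 4 / (T * x ^+ 2) = 4 / T * (x ^+ 2)^-1.
  by field; rewrite xn0 T0.
have -> : 8 / (T * h) * (h / (h ^+ 2 + x ^+ 2)) = 4 / T * (2 / (h ^+ 2 + x ^+ 2)).
  by field; rewrite hn0 T0 gt_eqF.
rewrite ler_wpM2l ?divr_ge0 ?(ltW T_gt0)//.
rewrite ler_pdivlMr// mulrC ler_pdivrMr//; lra.
Qed.

End fejer_mass.

Section exp_tail.
Context (R : realType).
Local Notation mu := (@lebesgue_measure R).
Variable th : R.
Hypothesis th_gt0 : 0 < th.

Definition exp_tail (x : R) : R := if 0 <= x then expR (- (th * x)) else 0.
Local Notation f := exp_tail.

Lemma exp_tail_ge0 x : 0 <= f x.
Proof. by rewrite /f; case: ifP => // _; exact: expR_ge0. Qed.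

Lemma exp_tail_le1 x : f x <= 1.
Proof.
rewrite /f; case: ifPn => // x0.
by rewrite -[leRHS]expR0 ler_expR oppr_le0 mulr_ge0// ltW.
Qed.

Lemma measurable_exp_tail : measurable_fun setT f.
Proof.
rewrite (_ : f = fun x => expR (- (th * x)) * \1_(`[0, +oo[%classic : set R) x).
  apply: measurable_funM; last exact: measurable_indic.
  by apply: measurableT_comp => //; apply: measurable_funN; exact: measurable_funM.
apply/funext => x; rewrite /f indicE.
have -> : (x \in (`[0, +oo[%classic : set R)) = (0 <= x).
  by apply/idP/idP; rewrite inE/= in_itv/= andbT.
by case: ifP => _; rewrite ?mulr1 ?mulr0.
Qed.

(* [exp_tail] varies by at most the factor [e^(2 th h)] over windows of length
   [2 h], except for its upward jump at 0. *)
Lemma exp_tail_shift h x y : x <= y -> y <= x + 2 * h ->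
  f x <= expR (2 * th * h) * f y.
Proof.
move=> xy yx; rewrite {1}/f; case: ifPn => x0; last first.
  by rewrite mulr_ge0 ?expR_ge0 ?exp_tail_ge0.
rewrite /f (le_trans x0 xy) -expRD ler_expR.
have : th * y <= th * (x + 2 * h) by rewrite ler_pM2l.
by rewrite mulrDr; lra.
Qed.

Lemma integral_exp_tail : (\int[mu]_y (f y)%:E = (th^-1)%:E)%E.
Proof.
rewrite -integral_expRN// [RHS]integral_mkcond; apply: eq_integral => y _.
rewrite patchE.
have -> : (y \in (`[0, +oo[%classic : set R)) = (0 <= y).
  by apply/idP/idP; rewrite inE/= in_itv/= andbT.
by rewrite /f; case: ifP.
Qed.

Lemma integrable_exp_tail : mu.-integrable setT (EFin \o f).
Proof.
apply/integrableP; split; first by apply/measurable_EFinP; exact: measurable_exp_tail.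
under eq_integral do rewrite /= ger0_norm ?exp_tail_ge0//.
by rewrite integral_exp_tail ltry.
Qed.

Lemma Rintegral_exp_tail : \int[mu]_y f y = th^-1.
Proof. by rewrite /Rintegral integral_exp_tail. Qed.

End exp_tail.

Section exp_tail_moment.
Context (R : realType).
Local Notation mu := (@lebesgue_measure R).
Variable th : R.
Hypothesis th_gt0 : 0 < th.

(** The weight [1 + |z + y|] is the one in the error of [kernel_local_limit]. The linear growth
    costs half of the exponential rate: [y e^(- th y / 2) <= 2 / th]. *)
Lemma integrable_exp_tail_moment z :
  mu.-integrable setT (EFin \o (fun y => exp_tail th y * (1 + `|z + y|))).
Proof.
have th2 : 0 < th / 2 by rewrite divr_gt0.
apply: (@integrable_le _ (measurableTypeR R) _ mu _
  (fun y : R => (1 + `|z|) * exp_tail th y + 2 / th * exp_tail (th / 2) y)).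
- have H : measurable_fun setT (fun y : R => exp_tail th y * (1 + `|z + y|)).
    apply: measurable_funM; first exact: measurable_exp_tail.
    apply: measurable_funD => //; apply: measurableT_comp => //.
    exact: measurable_funD.
  exact: H.
- move=> y; rewrite /exp_tail; case: ifPn => y0; last by rewrite !mul0r !mulr0 addr0 normr0.
  rewrite ger0_norm ?mulr_ge0 ?expR_ge0 ?addr_ge0//.
  set e := expR (- (th * y)); set e' := expR (- (th / 2 * y)).
  have ee : e = e' * e' by rewrite /e /e' -expRD; congr expR; field.
  have e'0 : 0 <= e' by exact: expR_ge0.
  have h : y * e' <= 2 / th.
    have := expR_ge1Dx (th / 2 * y) => hy.
    have hy2 : th / 2 * y <= expR (th / 2 * y) by lra.
    have := ler_wpM2r e'0 hy2; rewrite /e' -expRD subrr expR0 -/e' => h1.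
    by rewrite ler_pdivlMr// mulrC; lra.
  have zy : `|z + y| <= `|z| + y by rewrite (le_trans (ler_normD _ _))// (ger0_norm y0).
  apply: (@le_trans _ _ (e * (1 + `|z| + y))).
    by rewrite ler_wpM2l ?expR_ge0//; lra.
  rewrite mulrDr mulrC lerD2l ee.
  have -> : e' * e' * y = y * e' * e' by ring.
  by rewrite ler_wpM2r.
- by apply: integrable_add; apply: integrable_scale; exact: integrable_exp_tail.
Qed.

End exp_tail_moment.

Section smoothing.
Context (R : realType).
Local Notation mu := (@lebesgue_measure R).
Variables (th T h : R).
Hypothesis th_gt0 : 0 < th.
Hypothesis T_gt0 : 0 < T.
Hypothesis h_gt0 : 0 < h.
Local Notation f := (exp_tail th).
Local Notation K := (fejer T).

Definition conv_fejer x : \bar R := (\int[mu]_y (f y * K (x - y))%:E)%E.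

Let mf : measurable_fun setT f. Proof. exact: measurable_exp_tail. Qed.
Let mK : measurable_fun setT K.
Proof. by apply: continuous_measurable_fun; exact: continuous_fejer. Qed.
Let f0 := exp_tail_ge0 th.
Let K0 := fejer_ge0 T_gt0.

Lemma measurable_conv_fejer_swap x : measurable_fun setT (fun v : R => (f (x - v) * K v)%:E).
Proof.
apply/measurable_EFinP; apply: measurable_funM => //.
by apply: measurableT_comp => //; exact: measurable_funB.
Qed.

Lemma conv_fejerE x : conv_fejer x = (\int[mu]_v (f (x - v) * K v)%:E)%E.
Proof.
rewrite -(ge0_integral_subr_l x (measurable_conv_fejer_swap x)); last first.
  by move=> v; rewrite lee_fin mulr_ge0.
by apply: eq_integral => v _; rewrite subKr.
Qed.

Lemma integral_fejer_itv_ge :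
  ((2 * pi - 8 * pi / (T * h))%:E <= \int[mu]_(v in `[(- h)%R, h]) (K v)%:E)%E.
Proof.
have E : (\int[mu]_(v in `[(- h)%R, h]) (K v)%:E + \int[mu]_(v in ~` `[(- h)%R, h]) (K v)%:E = (2 * pi)%:E)%E.
  rewrite -(integral_fejer T_gt0) -(setUv `[(- h)%R, h]%classic) ge0_integral_setU//=.
  - by apply: measurableC.
  - by apply: measurable_funTS; exact/measurable_EFinP.
  - by move=> x _; rewrite lee_fin.
  - by rewrite disj_set2E setICr.
have tl := integral_fejer_tail T_gt0 h_gt0.
rewrite EFinB -E leeBlDr//.
by apply: leeD2l.
Qed.

(** Convolving at [x + h] makes the window [[x, x + 2 h]] lie to the right of [x], on the harmless
    side of the jump of [exp_tail]. The coefficient on the left is the mass that the kernel is known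
    to have on [[-h, h]]. *)
Lemma exp_tail_le_conv x :
  (((2 * pi - 8 * pi / (T * h)) * f x)%:E <=
   (expR (2 * th * h))%:E * conv_fejer (x + h)%R)%E.
Proof.
rewrite conv_fejerE -ge0_integralZl//=; last 2 first.
- exact: measurable_conv_fejer_swap.
- by move=> v _; rewrite lee_fin mulr_ge0.
apply: (@le_trans _ _ (\int[mu]_(v in `[(- h)%R, h]) ((f x)%:E * (K v)%:E))%E).
  rewrite ge0_integralZl//=.
  - by rewrite mulrC EFinM lee_wpmul2l ?lee_fin// integral_fejer_itv_ge.
  - by apply: measurable_funTS; exact/measurable_EFinP.
  - by move=> v _; rewrite lee_fin.
  - by rewrite lee_fin.
have mm : measurable_fun setT (fun v : R => ((expR (2 * th * h))%:E * (f (x + h - v) * K v)%:E)%E).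
  by apply: measurable_funeM; exact: measurable_conv_fejer_swap.
apply: (@le_trans _ _ (\int[mu]_(v in `[(- h)%R, h]) ((expR (2 * th * h))%:E * (f (x + h - v) * K v)%:E))%E); last first.
  apply: ge0_subset_integral => //.
  by move=> v _; rewrite lee_fin !mulr_ge0// expR_ge0.
apply: ge0_le_integral => //.
- by move=> v _; rewrite lee_fin mulr_ge0.
- by apply: measurable_funeM; apply: measurable_funTS; exact/measurable_EFinP.
- exact: measurable_funTS.
- move=> v; rewrite /= in_itv/= => /andP[hv vh].
  by rewrite -!EFinM lee_fin mulrA ler_wpM2r// exp_tail_shift//; lra.
Qed.

(** Here the window is [[x - 2 h, x]]. The part outside it is kept as an integral: [exp_tail <= 1]
    would give a bound that does not decrease with [n]. *)
Lemma conv_le_exp_tail x :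
  (conv_fejer (x - h)%R <= (expR (2 * th * h) * (2 * pi) * f x)%:E +
   \int[mu]_(v in ~` `[(- h)%R, h]) (f (x - h - v) * K v)%:E)%E.
Proof.
have ms := measurable_conv_fejer_swap (x - h).
rewrite conv_fejerE -{1}(setUv `[(- h)%R, h]%classic) ge0_integral_setU//=.
- apply: leeD2r.
  apply: (@le_trans _ _ (\int[mu]_(v in `[(- h)%R, h]) ((expR (2 * th * h) * f x)%:E * (K v)%:E))%E).
    apply: ge0_le_integral => //.
    + by move=> v _; rewrite lee_fin mulr_ge0.
    + exact: measurable_funTS.
    + by apply: measurable_funeM; apply: measurable_funTS; exact/measurable_EFinP.
    + move=> v; rewrite /= in_itv/= => /andP[hv vh].
      by rewrite -!EFinM lee_fin ler_wpM2r// exp_tail_shift//; lra.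
  rewrite ge0_integralZl//=; last 3 first.
  - by apply: measurable_funTS; exact/measurable_EFinP.
  - by move=> v _; rewrite lee_fin.
  - by rewrite lee_fin mulr_ge0// expR_ge0.
  have -> : expR (2 * th * h) * (2 * pi) * f x = expR (2 * th * h) * f x * (2 * pi) by ring.
  rewrite [leRHS]EFinM; apply: lee_wpmul2l; first by rewrite lee_fin mulr_ge0// expR_ge0.
  rewrite -(integral_fejer T_gt0); apply: ge0_subset_integral => //.
  - exact/measurable_EFinP.
  - by move=> v _; rewrite lee_fin.
- exact: measurableC.
- exact: measurable_funTS.
- by move=> v _; rewrite lee_fin mulr_ge0.
- by rewrite disj_set2E setICr.
Qed.

End smoothing.

Section expect_conv.
Context (R : realType) (L : probability R R).
Local Notation mu := (@lebesgue_measure R).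
Variables (th T : R).
Hypothesis th_gt0 : 0 < th.
Hypothesis T_gt0 : 0 < T.
Local Notation f := (exp_tail th).
Local Notation K := (fejer T).

Let mf : measurable_fun setT f. Proof. exact: measurable_exp_tail. Qed.
Let mK : measurable_fun setT K.
Proof. by apply: continuous_measurable_fun; exact: continuous_fejer. Qed.
Let f0 := exp_tail_ge0 th.
Let K0 := fejer_ge0 T_gt0.

Lemma integrable_exp_tail_law z : L.-integrable setT (EFin \o (fun s => f (s - z))).
Proof.
apply: (@bounded_integrable _ _ 1) => [|s].
  by apply: measurableT_comp => //; exact: measurable_funB.
by rewrite ger0_norm// exp_tail_le1.
Qed.

Lemma fejer_le_const x : K x <= \int[mu]_t fejer_weight T t.
Proof.
have ik := kernel_integrable T_gt0 (measurable_fejer_weight T) (fejer_weight01 T_gt0) (fejer_weight_supp T_gt0).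
apply: le_Rintegral => //; first exact: fejer_integrable.
by move=> t _; rewrite ler_piMr ?cos_le1//; have /andP[] := fejer_weight01 T_gt0 t.
Qed.

Lemma integrable_fejer_law z : L.-integrable setT (EFin \o (fun s => K (s - z))).
Proof.
apply: (@bounded_integrable _ _ (\int[mu]_t fejer_weight T t)) => [|s].
  by apply: measurableT_comp => //; exact: measurable_funB.
by rewrite ger0_norm// fejer_le_const.
Qed.

Let g z (w : R * measurableTypeR R) : \bar R := (f w.2 * K (w.1 - z - w.2))%:E.

Let mg z : measurable_fun setT (g z).
Proof.
apply/measurable_EFinP; apply: measurable_funM.
  by apply: measurableT_comp => //; exact: measurable_snd.
apply: measurableT_comp => //; apply: measurable_funB; last exact: measurable_snd.
by apply: measurable_funB => //; exact: measurable_fst.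
Qed.

Let g0 z w : (0 <= g z w)%E. Proof. by rewrite lee_fin mulr_ge0. Qed.

Let EK z := \int[L]_s K (s - z).

Let innerE z y : (\int[L]_s g z (s, y) = (f y * EK (z + y))%:E)%E.
Proof.
rewrite /EK -RintegralZl//; last exact: integrable_fejer_law.
rewrite -EFin_Rintegral; last by apply: integrable_scale; exact: integrable_fejer_law.
by apply: eq_integral => s _; rewrite /g/= opprD addrA.
Qed.

Lemma measurable_conv_law z : measurable_fun setT (fun s : R => conv_fejer th T (s - z)).
Proof. exact: (measurable_fun_fubini_tonelli_F (g z)). Qed.

Lemma measurable_expect_fejer z : measurable_fun setT (fun y : R => (f y * EK (z + y))%:E).
Proof.
have := measurable_fun_fubini_tonelli_G (m1 := L) (g z) (mg z) (g0 z).
by rewrite /fubini_G; under eq_fun do rewrite innerE.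
Qed.

Lemma expect_conv z :
  (\int[L]_s conv_fejer th T (s - z)%R = \int[mu]_y (f y * EK (z + y))%:E)%E.
Proof.
transitivity (\int[L]_s \int[mu]_y g z (s, y))%E; first by [].
rewrite (fubini_tonelli (g z))//.
by apply: eq_integral => y _; exact: innerE.
Qed.

Lemma expect_conv_le z B : (forall z, EK z <= B) ->
  (\int[L]_s conv_fejer th T (s - z)%R <= (B / th)%:E)%E.
Proof.
move=> EB; have EK0 z' : 0 <= EK z' by apply: Rintegral_ge0 => s _.
have B0 : 0 <= B by exact: le_trans (EB 0).
rewrite expect_conv.
apply: (@le_trans _ _ (\int[mu]_y (B * f y)%:E)%E).
  apply: ge0_le_integral => //.
  - by move=> y _; rewrite lee_fin mulr_ge0.
  - exact: measurable_expect_fejer.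
  - by apply/measurable_EFinP; exact: measurable_funM.
  - by move=> y _; rewrite lee_fin mulrC ler_wpM2r.
rewrite EFin_Rintegral; last by apply: integrable_scale; exact: integrable_exp_tail.
by rewrite RintegralZl ?Rintegral_exp_tail//; exact: integrable_exp_tail.
Qed.

(** The error may grow linearly with the position, since the exponential weight integrates it to the
    constant [J], which depends on [z] but not on the law [L]. *)
Lemma expect_conv_approx z c B : (forall z, `|EK z - c| <= B * (1 + `|z|)) ->
  let J := \int[mu]_y (f y * (1 + `|z + y|)) in
  (\int[L]_s conv_fejer th T (s - z)%R <= (c / th + B * J)%:E)%E /\
  ((c / th)%:E <= \int[L]_s conv_fejer th T (s - z)%R + (B * J)%:E)%E.
Proof.
move=> EB J; have EK0 z' : 0 <= EK z' by apply: Rintegral_ge0 => s _.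
have iJ := integrable_exp_tail_moment th_gt0 z.
have if_ := integrable_exp_tail th_gt0.
have ifE : mu.-integrable setT (EFin \o (fun y => f y * EK (z + y))).
  have iU : mu.-integrable setT (EFin \o (fun y => c * f y + B * (f y * (1 + `|z + y|)))).
    by apply: integrable_add; apply: integrable_scale.
  apply: integrable_le iU; first by apply/measurable_EFinP; exact: measurable_expect_fejer.
  move=> y; rewrite ger0_norm ?mulr_ge0//.
  have := EB (z + y); rewrite ler_norml => /andP[_ h].
  have -> : c * f y + B * (f y * (1 + `|z + y|)) = f y * (c + B * (1 + `|z + y|)) by ring.
  by rewrite ler_wpM2l//; lra.
rewrite expect_conv EFin_Rintegral//.
rewrite -EFinD !lee_fin -(Rintegral_exp_tail th_gt0) -!RintegralZl// -!RintegralD//; try exact: integrable_scale.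
split; apply: le_Rintegral => //.
- by apply: integrable_add; exact: integrable_scale.
- move=> y _; have := EB (z + y); rewrite ler_norml => /andP[_ h].
  have -> : c * f y + B * (f y * (1 + `|z + y|)) = f y * (c + B * (1 + `|z + y|)) by ring.
  by rewrite ler_wpM2l//; lra.
- exact: integrable_scale.
- by apply: integrable_add => //; exact: integrable_scale.
- move=> y _; have := EB (z + y); rewrite ler_norml => /andP[h _].
  have -> : f y * EK (z + y) + B * (f y * (1 + `|z + y|)) = f y * (EK (z + y) + B * (1 + `|z + y|)) by ring.
  by rewrite mulrC ler_wpM2l//; lra.
Qed.

Let conv0 x : (0 <= conv_fejer th T x)%E.
Proof. by apply: integral_ge0 => y _; rewrite lee_fin mulr_ge0. Qed.

Lemma expect_exp_tail_le h z : 0 < h -> 0 <= 2 * pi - 8 * pi / (T * h) ->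
  (((2 * pi - 8 * pi / (T * h)) * \int[L]_s f (s - z))%:E <=
   (expR (2 * th * h))%:E * \int[L]_s conv_fejer th T (s - (z - h))%R)%E.
Proof.
move=> h0 c0.
rewrite -RintegralZl//; last exact: integrable_exp_tail_law.
rewrite -EFin_Rintegral; last by apply: integrable_scale; exact: integrable_exp_tail_law.
have mc := measurable_conv_law (z - h).
rewrite -ge0_integralZl//=.
apply: ge0_le_integral => //.
- by move=> s _; rewrite lee_fin mulr_ge0.
- apply/measurable_EFinP; apply: measurable_funM => //.
  by apply: measurableT_comp => //; exact: measurable_funB.
- exact: measurable_funeM.
- move=> s _; have -> : s - (z - h) = s - z + h by ring.
  exact: exp_tail_le_conv.
Qed.

(** The outer part is first averaged over [L] at fixed [v], where the uniform bound [C] applies, and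
    only then over the kernel. With [C = O(1 / sqrt n)] the loss is a small multiple of the main
    term. *)
Lemma expect_conv_le_exp_tail h z C : 0 < h -> 0 <= C ->
  (forall z, \int[L]_s f (s - z) <= C) ->
  (\int[L]_s conv_fejer th T (s - (z + h))%R <=
    (expR (2 * th * h) * (2 * pi) * \int[L]_s f (s - z) + 8 * pi / (T * h) * C)%:E)%E.
Proof.
move=> h0 C0 fC; have pi0 := pi_ge0 R.
pose D : set R := `[(- h), h]%classic.
have mDC : measurable (~` D) by apply: measurableC; exact: measurable_itv.
pose g2 (w : R * measurableTypeR R) : \bar R := (f (w.1 - z - h - w.2) * K w.2 * \1_(~` D) w.2)%:E.
have mg2 : measurable_fun setT g2.
  apply/measurable_EFinP; apply: measurable_funM; first apply: measurable_funM.
  - apply: measurableT_comp => //; apply: measurable_funB; last exact: measurable_snd.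
    apply: measurable_funB => //; apply: measurable_funB => //; exact: measurable_fst.
  - by apply: measurableT_comp => //; exact: measurable_snd.
  - have mi : measurable_fun setT (\1_(~` D) : R -> R) by exact: measurable_indic.
    by apply: measurableT_comp mi _; exact: measurable_snd.
have g20 w : (0 <= g2 w)%E by rewrite lee_fin !mulr_ge0.
have tailE s : (\int[mu]_(v in ~` `[(- h)%R, h]) (f (s - z - h - v) * K v)%:E = \int[mu]_v g2 (s, v))%E.
  rewrite integral_mkcond; apply: eq_integral => v _; rewrite patchE /g2/= indicE /D.
  by case: ifP => _; rewrite ?mulr1 ?mulr0.
pose c := expR (2 * th * h) * (2 * pi).
have c0 : 0 <= c by rewrite !mulr_ge0// expR_ge0.
have mf1 : measurable_fun setT (fun s : R => f (s - z)).
  by apply: measurableT_comp => //; exact: measurable_funB.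
apply: (@le_trans _ _ (\int[L]_s ((c * f (s - z))%:E + \int[mu]_v g2 (s, v)))%E).
  apply: ge0_le_integral => //.
  - exact: measurable_conv_law.
  - apply: emeasurable_funD; last exact: measurable_fun_fubini_tonelli_F.
    by apply/measurable_EFinP; exact: measurable_funM.
  - move=> s _; rewrite -tailE; have -> : s - (z + h) = s - z - h by ring.
    exact: conv_le_exp_tail.
rewrite ge0_integralD//=; last 4 first.
- by move=> s _; rewrite lee_fin mulr_ge0.
- by apply/measurable_EFinP; exact: measurable_funM.
- by move=> s _; apply: integral_ge0.
- exact: measurable_fun_fubini_tonelli_F.
rewrite EFinD; apply: leeD.
  rewrite EFin_Rintegral; last by apply: integrable_scale; exact: integrable_exp_tail_law.
  by rewrite RintegralZl//; exact: integrable_exp_tail_law.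
rewrite (fubini_tonelli g2)//.
apply: (@le_trans _ _ (\int[mu]_v (C%:E * ((K v)%:E * (\1_(~` D) v)%:E)))%E).
  apply: ge0_le_integral => //.
  - by move=> v _; apply: integral_ge0.
  - exact: measurable_fun_fubini_tonelli_G.
  - by apply: measurable_funeM; apply/measurable_EFinP; apply: measurable_funM.
  - move=> v _.
    have -> : (C%:E * ((K v)%:E * (\1_(~` D) v)%:E) = (C * (K v * \1_(~` D) v))%:E)%E by [].
    have E s : f (s - z - h - v) * K v * \1_(~` D) v = (K v * \1_(~` D) v) * f (s - (z + h + v)).
      by rewrite mulrC mulrCA mulrC; congr (_ * f _); ring.
    rewrite /g2/=; under eq_integral do rewrite E.
    rewrite EFin_Rintegral; last by apply: integrable_scale; exact: integrable_exp_tail_law.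
    rewrite RintegralZl//; last exact: integrable_exp_tail_law.
    by rewrite lee_fin mulrC ler_wpM2r// mulr_ge0.
rewrite ge0_integralZl//=.
- rewrite mulrC EFinM; apply: lee_wpmul2l; first by rewrite lee_fin.
  apply: le_trans (integral_fejer_tail T_gt0 h0).
  rewrite [leRHS]integral_mkcond le_eqVlt; apply/orP; left; apply/eqP.
  apply: eq_integral => v _; rewrite patchE indicE /D.
  by case: ifP => _; rewrite ?mule1 ?mule0.
- by apply/measurable_EFinP; apply: measurable_funM.
- by move=> v _; rewrite lee_fin mulr_ge0.
Qed.

End expect_conv.

(** * Limit for non-lattice laws *)

(** Order of the limits: [C] depends on [e], [C0] does not, so [n] goes to infinity at fixed [e]
    before [e] is made small. *)
Lemma near1_of_bounds (R : realType) (r : nat -> R) (th C0 : R) :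
  0 < th -> 0 <= C0 -> (forall n, 0 <= r n) ->
  (forall e, 0 < e -> e < 8^-1 -> exists C, forall n, (0 < n)%N ->
     (1 - 4 * e) * r n <= expR (2 * th * e) * (1 + C / Num.sqrt n%:R) /\
     1 <= expR (2 * th * e) * r n + C0 * e + C / Num.sqrt n%:R) ->
  r n @[n --> \oo] --> (1 : R).
Proof.
move=> th0 C00 r0 H; apply/cvgrPdist_le => eps eps0.
(* Each of the errors will be at most [d]; together they cost less than [8 d] once [d <= 1 / 8]. *)
pose d := Num.min (eps / 8) 8^-1.
have d0 : 0 < d by rewrite lt_min divr_gt0//= invr_gt0.
have d8 : 8 * d <= eps by rewrite mulrC -ler_pdivlMr// ge_min lexx.
have d18 : d <= 8^-1 by rewrite ge_min lexx orbT.
have ln0 : 0 < ln (1 + d) by rewrite ln_gt0// ltrDl.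
(* The terms ensure in turn [e^(2 th e) <= 1 + d], both [4 e <= d] and [C0 e <= d], and
   [e < 1 / 8]. *)
pose e := Num.min (ln (1 + d) / (2 * th)) (Num.min (d / (4 * (1 + C0))) 9^-1).
have e0 : 0 < e.
  rewrite !lt_min; apply/andP; split; first by rewrite divr_gt0 ?mulr_gt0.
  by rewrite invr_gt0 ltr0n andbT divr_gt0// mulr_gt0// ltr_pwDl.
have e1 : expR (2 * th * e) <= 1 + d.
  rewrite -[leRHS]lnK ?posrE ?addr_gt0// ler_expR mulrC -ler_pdivlMr ?mulr_gt0//.
  by rewrite ge_min lexx.
have [e2 e3] : 4 * e <= d /\ C0 * e <= d.
  have : e <= d / (4 * (1 + C0)) by rewrite !ge_min lexx orbT.
  rewrite ler_pdivlMr; last by rewrite mulr_gt0// ltr_pwDl.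
  have : 0 <= C0 * e by rewrite mulr_ge0// ltW.
  have -> : e * (4 * (1 + C0)) = 4 * e + 4 * (C0 * e) by ring.
  by move: (C0 * e) => u u0 h; split; lra.
have e4 : e < 8^-1.
  have : e <= 9^-1 by rewrite !ge_min lexx !orbT.
  by lra.
have [C HC] := H e e0 e4.
have cC : C / Num.sqrt n%:R @[n --> \oo] --> (0 : R).
  rewrite -[X in _ --> X](mulr0 C); apply: cvgM; first exact: cvg_cst.
  apply/gtr0_cvgV0; first by near=> n; rewrite sqrtr_gt0 ltr0n; near: n; exact: nbhs_infty_gt.
  apply/cvgryPge => A; near=> n.
  rewrite (le_trans (ler_norm A))// -sqrtr_sqr ler_wsqrtr//.
  near: n; exact: nbhs_infty_ger.
move/cvgrPdist_le : cC => /(_ d d0) cC.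
near=> n.
have n0 : (0 < n)%N by near: n; exact: nbhs_infty_gt.
have [h1 h2] := HC n n0.
have hC : C / Num.sqrt n%:R <= d.
  have : `|0 - C / Num.sqrt n%:R| <= d by near: n.
  by rewrite sub0r normrN => /(le_trans (ler_norm _)).
have rn := r0 n.
have E0 : 0 <= expR (2 * th * e) by exact: expR_ge0.
have h1' : (1 - d) * r n <= (1 + d) * (1 + d).
  apply: (@le_trans _ _ ((1 - 4 * e) * r n)); first by rewrite ler_wpM2r//; lra.
  apply: (le_trans h1); apply: (@le_trans _ _ (expR (2 * th * e) * (1 + d))).
    by rewrite ler_wpM2l// lerD2l.
  by rewrite ler_wpM2r//; lra.
have h2' : 1 - 2 * d <= (1 + d) * r n.
  have : expR (2 * th * e) * r n <= (1 + d) * r n by rewrite ler_wpM2r.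
  by move: (expR _ * r n) h2 => u h2 hu; lra.
have dd : d * d <= d * 8^-1 by rewrite ler_wpM2l// ltW.
rewrite ler_norml; apply/andP; split.
- apply: (@le_trans _ _ (- (8 * d))); first by lra.
  have : (1 - d) * r n <= (1 - d) * (1 + 8 * d).
    apply: (le_trans h1').
    have -> : (1 + d) * (1 + d) = 1 + 2 * d + d * d by ring.
    have -> : (1 - d) * (1 + 8 * d) = 1 + 7 * d - 8 * (d * d) by ring.
    by lra.
  by rewrite ler_pM2l; lra.
- apply: (@le_trans _ _ (8 * d)); last by lra.
  have : (1 + d) * (1 - 8 * d) <= (1 + d) * r n.
    apply: le_trans h2'.
    have -> : (1 + d) * (1 - 8 * d) = 1 - 7 * d - 8 * (d * d) by ring.
    have := mulr_ge0 (ltW d0) (ltW d0); lra.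
  by rewrite ler_pM2l; lra.
Unshelve. all: by end_near. Qed.

Section local_limit.
Context (R : realType) (Q : probability R R).
Local Notation mu := (@lebesgue_measure R).
Hypothesis i1 : Q.-integrable setT (EFin \o (fun x : R => x)).
Hypothesis i2 : Q.-integrable setT (EFin \o (fun x : R => x ^+ 2)).
Hypothesis i3 : Q.-integrable setT (EFin \o (fun x : R => `|x| ^+ 3)).
Hypothesis Q_mean0 : \int[Q]_x x = 0.
Variables (s2 th : R).
Hypothesis s2E : \int[Q]_x x ^+ 2 = s2.
Hypothesis s2_gt0 : 0 < s2.
Hypothesis th_gt0 : 0 < th.

(** Only the behaviour of the characteristic function near 0 enters, through a fixed small [T], so
    the bound holds for lattice and non-lattice laws alike. *)
Lemma exp_tail_sup_bound : exists2 C, 0 <= C & forall n L z, (0 < n)%N ->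
  is_sum_law Q n L -> \int[L]_s exp_tail th (s - z) <= C / Num.sqrt n%:R.
Proof.
have pi0 := pi_gt0 R; have th0 := th_gt0; have s20 := s2_gt0.
have [T T0 HT] := ecf2_near0 i1 i2 i3 Q_mean0 s2E s2_gt0 erefl.
have Q_ecf t : 0 < t <= T -> ecf2 Q t < 1.
  move=> /andP[t0 tT]; apply: (le_lt_trans (HT t _)); first by rewrite gtr0_norm.
  by rewrite gtrBl mulr_gt0 ?exprn_gt0// divr_gt0.
have [D D0 HD] := kernel_local_limit i1 i2 i3 Q_mean0 s2E s2_gt0 T0
  (measurable_fejer_weight T) (fejer_weight01 T0) (fejer_weight1 T0) (fejer_weight_supp T0) Q_ecf.
(* The window [h = 8 / T] leaves the mass [2 pi - pi = pi] in [exp_tail_le_conv]: positive is all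
   that is required here. *)
have h0 : 0 < 8 / T by rewrite divr_gt0.
have Th : 2 * pi - 8 * pi / (T * (8 / T)) = pi :> R by field; rewrite gt_eqF.
exists (expR (2 * th * (8 / T)) * D / th / pi).
  by rewrite !divr_ge0 ?mulr_ge0 ?expR_ge0// ltW.
move=> n L z n0 HL.
have := @expect_exp_tail_le R L th T th_gt0 T0 (8 / T) z h0.
rewrite Th => /(_ (ltW pi0)).
have EB z' : \int[L]_s fejer T (s - z') <= D / Num.sqrt n%:R.
  by have [_] := HD n z' L n0 HL; apply: le_trans; exact: ler_norm.
have := @expect_conv_le R L th T th_gt0 T0 (z - 8 / T) _ EB.
move=> hB hA.
have : (((pi * \int[L]_s exp_tail th (s - z))%:E <=
  (expR (2 * th * (8 / T)))%:E * (D / Num.sqrt n%:R / th)%:E)%E).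
  by apply: (le_trans hA); apply: lee_wpmul2l => //; rewrite lee_fin expR_ge0.
rewrite -EFinM lee_fin -ler_pdivlMl// => /le_trans; apply.
rewrite le_eqVlt; apply/orP; left; apply/eqP; ring.
Qed.

Lemma nonlattice_limit (L : nat -> probability R R) :
  (forall t, 0 < t -> ecf2 Q t < 1) -> (forall n, is_sum_law Q n (L n)) ->
  th * Num.sqrt (2 * pi * n%:R * s2) * \int[L n]_s exp_tail th s @[n --> \oo] --> (1 : R).
Proof.
move=> Q_ecf HL.
have pi0 := pi_gt0 R; have th0 := th_gt0; have s20 := s2_gt0.
have [C0 C00 HC0] := exp_tail_sup_bound.
pose a := th * Num.sqrt (2 * pi * s2).
have a0 : 0 < a by rewrite mulr_gt0// sqrtr_gt0 !mulr_gt0.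
have aE n : th * Num.sqrt (2 * pi * n%:R * s2) = a * Num.sqrt n%:R.
  rewrite /a -[RHS]mulrA -sqrtrM; last by rewrite !mulr_ge0 ?(ltW pi0)// ltW.
  by congr (_ * Num.sqrt _); ring.
have r0 n : 0 <= th * Num.sqrt (2 * pi * n%:R * s2) * \int[L n]_s exp_tail th s.
  rewrite !mulr_ge0 ?sqrtr_ge0 ?(ltW th0)//; apply: Rintegral_ge0 => s _.
  exact: exp_tail_ge0.
have aC0 : 0 <= 4 * C0 * a by rewrite !mulr_ge0// ltW.
apply: (near1_of_bounds th0 aC0 r0) => e e0 e8.
(* Window [e] with bandwidth [e^-2]: the window shrinks, and the mass [8 pi e] lost outside it
   vanishes as well. *)
have T0 : 0 < e ^- 2 by rewrite invr_gt0 exprn_gt0.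
have e0' : e != 0 by rewrite gt_eqF.
have pi0' : pi != 0 :> R by rewrite gt_eqF.
have th0' : th != 0 by rewrite gt_eqF.
have Te : 8 * pi / (e ^- 2 * e) = 8 * pi * e by field.
have [D D0 HD] := kernel_local_limit i1 i2 i3 Q_mean0 s2E s2_gt0 T0
  (measurable_fejer_weight _) (fejer_weight01 T0) (fejer_weight1 T0) (fejer_weight_supp T0)
  (fun t (h : 0 < t <= e ^- 2) => Q_ecf t (proj1 (andP h))).
pose J z := \int[mu]_y (exp_tail th y * (1 + `|z + y|)).
have J0 z : 0 <= J z.
  by apply: Rintegral_ge0 => y _; rewrite mulr_ge0 ?exp_tail_ge0 ?addr_ge0.
exists (a * D / (2 * pi) * (J (- e) + J e)) => n n0.
have HLn := HL n.
set p := \int[L n]_s exp_tail th s.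
have pE : p = \int[L n]_s exp_tail th (s - 0) by apply: eq_Rintegral => s _; rewrite subr0.
have nn0 : 0 < n%:R :> R by rewrite ltr0n.
have sn0 : 0 < Num.sqrt n%:R :> R by rewrite sqrtr_gt0.
have snE : Num.sqrt n%:R ^+ 2 = n%:R :> R by rewrite sqr_sqrtr// ltW.
pose c := Num.sqrt (2 * pi / (n%:R * s2)).
have acE : a * Num.sqrt n%:R * c = 2 * pi * th.
  rewrite /a /c -[LHS]mulrA -sqrtrM ?(ltW nn0)// -[LHS]mulrA -sqrtrM; last first.
    by rewrite !mulr_ge0 ?(ltW pi0)// ltW.
  have -> : 2 * pi * s2 * (n%:R * (2 * pi / (n%:R * s2))) = (2 * pi) ^+ 2.
    by field; rewrite !gt_eqF.
  by rewrite sqrtr_sqr ger0_norm ?mulr_ge0 ?(ltW pi0)// mulrC.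
have EB z : `|\int[L n]_s fejer (e ^- 2) (s - z) - c| <= D / n%:R * (1 + `|z|).
  by have [h _] := HD n z (L n) n0 HLn; rewrite (le_trans h)// mulrAC.
have [U1 _] := @expect_conv_approx R (L n) th _ th_gt0 T0 (0 - e) c _ EB.
have [_ U2] := @expect_conv_approx R (L n) th _ th_gt0 T0 (0 + e) c _ EB.
have c8 : 0 <= 2 * pi - 8 * pi * e.
  have -> : 2 * pi - 8 * pi * e = 2 * pi * (1 - 4 * e) by ring.
  by rewrite !mulr_ge0 ?(ltW pi0)//; lra.
have := @expect_exp_tail_le R (L n) th _ th_gt0 T0 e 0 e0.
rewrite Te -pE => /(_ c8) V1.
have C0n : 0 <= C0 / Num.sqrt n%:R by rewrite divr_ge0// ltW.
have := @expect_conv_le_exp_tail R (L n) th _ th_gt0 T0 e 0 _ e0 C0n (fun z => HC0 n (L n) z n0 HLn).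
rewrite Te -pE => V2.
have {V1 U1} W1 : (2 * pi - 8 * pi * e) * p <= expR (2 * th * e) * (c / th + D / n%:R * J (- e)).
  rewrite -lee_fin (le_trans V1)// EFinM; apply: lee_wpmul2l; first by rewrite lee_fin expR_ge0.
  by move: U1; rewrite sub0r.
have {V2 U2} W2 : c / th <= expR (2 * th * e) * (2 * pi) * p + 8 * pi * e * (C0 / Num.sqrt n%:R) + D / n%:R * J e.
  rewrite -lee_fin (le_trans U2)// EFinD add0r; apply: leeD2r.
  by move: V2; rewrite add0r.
rewrite aE; set sn := Num.sqrt n%:R in sn0 snE acE W2 C0n *.
have sn0' : sn != 0 by rewrite gt_eqF.
(* Multiplication by [m] turns the main term [c / th] into 1 and the error [D / n] into
   [O(1 / sqrt n)]. *)
pose m := a * sn / (2 * pi).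
have m0 : 0 <= m by rewrite divr_ge0 ?mulr_ge0 ?(ltW pi0)// ltW.
have mc : m * (c / th) = 1.
  have -> : m * (c / th) = a * sn * c / (2 * pi * th) by rewrite /m; move: (@pi R) pi0' => q q0; field; rewrite th0' q0.
  by rewrite acE divff// !mulf_neq0.
have mD j : m * (D / n%:R * j) = a * D / (2 * pi) * j / sn.
  by rewrite -snE /m; move: (@pi R) pi0' => q q0; field; rewrite ?q0 ?sn0'.
have aD0 : 0 <= a * D / (2 * pi) by rewrite divr_ge0 ?mulr_ge0 ?(ltW pi0)// ltW.
split.
- have -> : (1 - 4 * e) * (a * sn * p) = m * ((2 * pi - 8 * pi * e) * p).
    by rewrite /m; move: (@pi R) pi0' => q q0; field.
  apply: (le_trans (ler_wpM2l m0 W1)).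
  have -> : m * (expR (2 * th * e) * (c / th + D / n%:R * J (- e))) =
     expR (2 * th * e) * (m * (c / th) + m * (D / n%:R * J (- e))) by ring.
  rewrite mc mD ler_wpM2l ?expR_ge0// lerD2l ler_wpM2r ?invr_ge0 ?(ltW sn0)//.
  by rewrite ler_wpM2l// lerDl.
- rewrite -{1}mc; apply: (le_trans (ler_wpM2l m0 W2)).
  have -> : m * (expR (2 * th * e) * (2 * pi) * p + 8 * pi * e * (C0 / sn) + D / n%:R * J e) =
    expR (2 * th * e) * (a * sn * p) + 4 * C0 * a * e + m * (D / n%:R * J e).
    rewrite 2!mulrDr; congr (_ + _ + _); first by rewrite /m; move: (@pi R) pi0' => q q0; field.
    by rewrite /m; move: (@pi R) pi0' => q q0; field; rewrite ?q0 ?sn0'.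
  by rewrite mD lerD2l ler_wpM2r ?invr_ge0 ?(ltW sn0)// ler_wpM2l// lerDr.
Qed.

End local_limit.

(** * Limit for lattice laws *)

Section lattice_set.
Context (R : realType).
Implicit Types x h : R.

Lemma measurable_lattice_set x0 h : measurable (lattice_set x0 h).
Proof.
have mi : measurable [set x : R | x \is a Num.int].
  have -> : [set x : R | x \is a Num.int] =
      \bigcup_(n : nat) ([set n%:R] `|` [set - n%:R]).
    apply/seteqP; split=> [x /= /intrP[m ->]|x [n _ []/= ->]].
    - exists `|m|%N => //=; case: (intP m) => [|k|k]; [by left|by left|right].
      by rewrite abszN /= mulrNz.
    - by rewrite rpred_nat.
    - by rewrite rpredN rpred_nat.
  apply: bigcupT_measurable => n; apply: measurableU; exact: measurable_set1.
have mf : measurable_fun setT (fun x : R => (x - x0) / h).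
  by apply: measurable_funM => //; exact: measurable_funB.
rewrite (_ : lattice_set x0 h = setT `&` (fun x => (x - x0) / h) @^-1` [set x : R | x \is a Num.int]).
  exact: mf.
by rewrite setTI.
Qed.

Lemma sin_int_pi (x : R) : x \is a Num.int -> sin (x * pi) = 0.
Proof.
have H (n : nat) : sin (n%:R * pi) = 0 :> R.
  elim: n => [|n IH]; first by rewrite mul0r sin0.
  by rewrite -natr1 mulrDl mul1r sinDpi IH oppr0.
move=> /intrP[m ->]; case: (intP m) => [|k|k]; first by rewrite mul0r sin0.
  exact: H.
by rewrite mulrNz mulNr sinN H oppr0.
Qed.

Lemma lattice_set0D h x y : lattice_set 0 h x -> lattice_set 0 h y ->
  lattice_set 0 h (x + y).
Proof. by rewrite /lattice_set/= !subr0 mulrDl; exact: rpredD. Qed.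

(** On the lattice, removing the atom at 0 leaves the same function shifted by one step and scaled
    by [e^(- th h)]; iterating produces the geometric series. *)
Lemma exp_tail_lattice th h x : 0 < h -> lattice_set 0 h x ->
  exp_tail th x = (x == 0)%:R + expR (- (th * h)) * exp_tail th (x - h).
Proof.
move=> h0; rewrite /lattice_set/= subr0 => /intrP[m xm].
have xE : x = m%:~R * h by rewrite -xm mulfVK// gt_eqF.
rewrite /exp_tail; have [x0|x0|->] := ltgtP x 0.
- have -> : 0 <= x - h = false by apply/negbTE; rewrite -ltNge; lra.
  by rewrite mulr0 addr0.
- have -> : 0 <= x - h.
    have : 0 < m%:~R :> R by rewrite -xm divr_gt0.
    rewrite ltr0z gtz0_ge1 => m1.
    rewrite xE subr_ge0 ler_peMl ?(ltW h0)//.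
    by rewrite -[1]/(1%:~R) ler_int.
  by rewrite add0r -expRD; congr expR; ring.
- have -> : 0 <= 0 - h = false by apply/negbTE; rewrite -ltNge; lra.
  by rewrite !mulr0 addr0 oppr0 expR0.
Qed.

End lattice_set.

Section full_measure.
Context (R : realType) (P : probability R R).
Variable A : set R.
Hypothesis mA : measurable A.
Hypothesis PA : P A = 1%E.

Lemma full_measureC : P (~` A) = 0%E.
Proof.
have := probability_setC P mA; rewrite PA => ->.
by rewrite subee.
Qed.

Lemma eq_integral_full (f g : R -> \bar R) : measurable_fun setT f -> measurable_fun setT g ->
  (forall x, A x -> f x = g x) -> (\int[P]_x f x = \int[P]_x g x)%E.
Proof.
move=> mf mg fg; apply: ae_eq_integral => //.
exists (~` A); split; first exact: measurableC.
  exact: full_measureC.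
by move=> x /= /not_implyP[_ fgx] Ax; apply: fgx; exact: fg.
Qed.

Lemma eq_Rintegral_full (f g : R -> R) : measurable_fun setT f -> measurable_fun setT g ->
  (forall x, A x -> f x = g x) -> \int[P]_x f x = \int[P]_x g x.
Proof.
move=> mf mg fg; rewrite /Rintegral; congr fine.
apply: eq_integral_full; [exact/measurable_EFinP|exact/measurable_EFinP|].
by move=> x Ax; rewrite fg.
Qed.

End full_measure.

Section window.
Context (R : realType).
Local Notation mu := (@lebesgue_measure R).
Variable T : R.
Hypothesis T_gt0 : 0 < T.

Definition window (t : R) : R := \1_(`[- T, T]%classic : set R) t.

Lemma windowE t : window t = (`|t| <= T)%R%:R.
Proof.
rewrite /window indicE; congr (nat_of_bool _)%:R.
by apply/idP/idP; rewrite inE/= in_itv/= ler_norml.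
Qed.

Lemma measurable_window : measurable_fun setT window.
Proof. exact: measurable_indic. Qed.

Lemma window01 t : 0 <= window t <= 1.
Proof. by rewrite windowE; case: (`|t| <= T); rewrite ?lexx ?ler01. Qed.

Lemma window1 t : `|1 - window t| <= `|t| / T.
Proof.
rewrite windowE; have [tT|tT] := leP `|t| T.
  by rewrite subrr normr0 divr_ge0// ltW.
by rewrite subr0 normr1 ler_pdivlMr// mul1r ltW.
Qed.

Lemma window_supp t : T < `|t| -> window t = 0.
Proof. by move=> tT; rewrite windowE leNgt tT. Qed.

Lemma kerft_window x : kerft window x = if x == 0 then 2 * T else 2 * sin (T * x) / x.
Proof.
have E : kerft window x = \int[mu]_(t in `[- T, T]) cos (t * x).
  rewrite /kerft [RHS]Rintegral_mkcond; apply: eq_Rintegral => t _.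
  rewrite patchE /window indicE.
  by case: ifPn => _; rewrite ?mul1r ?mul0r.
have TT : - T < T by rewrite gtrN.
rewrite E; case: ifPn => [/eqP ->|x0].
  under eq_Rintegral do rewrite mulr0 cos0.
  have d (t : R) : is_derive t 1 (fun t : R => t) (1 : R) by exact: is_derive_id.
  rewrite (Rintegral_is_derive TT _ d); first by ring.
  by move=> t; exact: cvg_cst.
have d (t : R) : is_derive t 1 (fun t : R => sin (t * x) / x) (cos (t * x)).
  by apply: is_derive_eq; rewrite /GRing.scale/=; field.
rewrite (Rintegral_is_derive TT _ d).
  by rewrite mulNr sinN; field.
by move=> t; apply: continuous_comp; [exact: mulrr_continuous|exact: continuous_cos].
Qed.

End window.

Section lattice_limit.
Context (R : realType) (Q : probability R R).
Local Notation mu := (@lebesgue_measure R).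
Hypothesis i1 : Q.-integrable setT (EFin \o (fun x : R => x)).
Hypothesis i2 : Q.-integrable setT (EFin \o (fun x : R => x ^+ 2)).
Hypothesis i3 : Q.-integrable setT (EFin \o (fun x : R => `|x| ^+ 3)).
Hypothesis Q_mean0 : \int[Q]_x x = 0.
Variables (s2 th h : R).
Hypothesis s2E : \int[Q]_x x ^+ 2 = s2.
Hypothesis s2_gt0 : 0 < s2.
Hypothesis th_gt0 : 0 < th.
Hypothesis h_gt0 : 0 < h.
Hypothesis Q_lattice : Q (lattice_set 0 h) = 1%E.

Lemma sum_law_lattice n L : is_sum_law Q n L -> L (lattice_set 0 h) = 1%E.
Proof.
move=> HL; pose A := lattice_set (0 : R) h; pose f (x : R) := (\1_A x : R)%:E.
have mA : measurable A by exact: measurable_lattice_set.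
have mf : measurable_fun setT f by apply/measurable_EFinP; exact: measurable_indic.
have f0 x : (0 <= f x)%E by rewrite lee_fin.
have H m s : A s -> iter_on setT Q m f s = 1%E.
  elim: m s => [|m IH] s As /=; first by rewrite /f indicE mem_set.
  rewrite (eq_integral_full mA Q_lattice (g := cst 1%E))//.
  - by rewrite integral_cst// mul1e; exact: probability_setT.
  - by apply: measurable_shift; exact: measurable_iter_on.
  - by move=> x Ax; rewrite IH//; exact: lattice_set0D.
have A0 : A 0 by rewrite /A /lattice_set/= subrr mul0r rpred0.
have := HL f 0 mf f0; rewrite H//.
under eq_integral do rewrite add0r.
by rewrite /f integral_indic// setIT => <-.
Qed.

(** The local limit at [k h] has an error growing with [k], so the limit is taken in finitely many
    terms only; what remains after [N] terms is controlled by [exp_tail_sup_bound]. *)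
Lemma lattice_limit (L : nat -> probability R R) :
  (forall t, 0 < t <= pi / h -> ecf2 Q t < 1) -> (forall n, is_sum_law Q n (L n)) ->
  th * Num.sqrt (2 * pi * n%:R * s2) * \int[L n]_s exp_tail th s @[n --> \oo]
    --> th * h / (1 - expR (- (th * h))).
Proof.
move=> Q_ecf HL.
have pi0 := pi_gt0 R; have th0 := th_gt0; have s20 := s2_gt0; have h0 := h_gt0.
have T0 : 0 < pi / h by rewrite divr_gt0.
have [D D0 HD] := kernel_local_limit i1 i2 i3 Q_mean0 s2E s2_gt0 T0
  (measurable_window _) (window01 _) (window1 T0) (@window_supp _ _) Q_ecf.
have [C0 C00 HC0] := exp_tail_sup_bound i1 i2 i3 Q_mean0 s2E s2_gt0 th_gt0.
pose a := th * Num.sqrt (2 * pi * s2).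
have a0 : 0 < a by rewrite mulr_gt0// sqrtr_gt0 !mulr_gt0.
have aE n : th * Num.sqrt (2 * pi * n%:R * s2) = a * Num.sqrt n%:R.
  rewrite /a -[RHS]mulrA -sqrtrM; last by rewrite !mulr_ge0 ?(ltW pi0)// ltW.
  by congr (_ * Num.sqrt _); ring.
pose q := expR (- (th * h)).
have q0 : 0 <= q by exact: expR_ge0.
have q1 : q < 1 by rewrite -[ltRHS]expR0 ltr_expR oppr_lt0 mulr_gt0.
pose w n k := \int[L n]_s ((s - h * k%:R == 0)%:R : R).
have mw (z : R) : measurable_fun setT (fun s : R => ((s - z == 0)%:R : R)).
  rewrite (_ : (fun _ => _) = (\1_[set z] : R -> R)); first exact: measurable_indic.
  apply/funext => s; rewrite indicE subr_eq0; congr (nat_of_bool _)%:R.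
  by apply/idP/idP; rewrite inE/= => /eqP.
have iw n z : (L n).-integrable setT (EFin \o (fun s : R => ((s - z == 0)%:R : R))).
  apply: (@bounded_integrable _ _ 1) => // s.
  by case: (_ == _); rewrite ?normr1 ?normr0.
have Lat n := sum_law_lattice (HL n).
have mA := measurable_lattice_set (0 : R) h.
have rec n N : \int[L n]_s exp_tail th s =
   \sum_(k < N) q ^+ k * w n k + q ^+ N * \int[L n]_s exp_tail th (s - h * N%:R).
  elim: N => [|N IH].
    rewrite big_ord0 add0r expr0 mul1r; apply: eq_Rintegral => s _.
    by rewrite mulr0 subr0.
  have E : \int[L n]_s exp_tail th (s - h * N%:R) =
      w n N + q * \int[L n]_s exp_tail th (s - h * N.+1%:R).
    have mt z : measurable_fun setT (fun s : R => exp_tail th (s - z)).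
      apply: measurableT_comp; first exact: measurable_exp_tail.
      exact: measurable_funB.
    have it z := integrable_exp_tail_law (L n) th_gt0 z.
    rewrite -RintegralZl// -RintegralD//; [|exact: iw|exact: integrable_scale].
    apply: (eq_Rintegral_full mA (Lat n)) => //.
      by apply: measurable_funD => //; exact: measurable_funM.
    move=> s As; rewrite (exp_tail_lattice _ h_gt0); last first.
      rewrite -mulrN /lattice_set/= subr0 mulrDl rpredD//.
        by move: As; rewrite /lattice_set/= subr0.
      by rewrite mulrAC divff ?gt_eqF// mul1r rpredN rpred_nat.
    congr (_ + _ * exp_tail th _); rewrite -natr1; ring.
  by rewrite IH big_ord_recr/= E mulrDr addrA mulrA -exprSr.
(* At lattice points the transform of the window equals [2 pi / h] when [s = h k], and is a multiple
   of the sine of an integer multiple of [pi] otherwise. *)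
have wE n k : w n k = h / (2 * pi) * \int[L n]_s kerft (window (pi / h)) (s - h * k%:R).
  have mk : measurable_fun setT (fun s : R => kerft (window (pi / h)) (s - h * k%:R)).
    apply: measurableT_comp; last exact: measurable_funB.
    apply: continuous_measurable_fun.
    exact: (continuous_kerft T0 (measurable_window _) (window01 _) (@window_supp _ _)).
  have ik : (L n).-integrable setT (EFin \o (fun s : R => kerft (window (pi / h)) (s - h * k%:R))).
    apply: (@bounded_integrable _ _ (\int[mu]_t window (pi / h) t)) => // s.
    apply: norm_Rintegral_le.
    - by have /measurable_EFinP := measurable_int _ (kerft_integrable T0 (measurable_window _) (window01 _) (@window_supp _ _) (s - h * k%:R)).
    - move=> t; have /andP[w0 _] := window01 (pi / h) t.
      by rewrite normrM ger0_norm// ler_piMr// cos_max.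
    - exact: (kernel_integrable T0 (measurable_window _) (window01 _) (@window_supp _ _)).
  rewrite -RintegralZl//; apply: (eq_Rintegral_full mA (Lat n)) => //.
    exact: measurable_funM.
  move=> s As; rewrite kerft_window//; have [_|x0] := eqVneq (s - h * k%:R) 0.
    by rewrite mulr1n; move: (@pi R) (lt0r_neq0 pi0) => p p0; field; rewrite p0 gt_eqF.
  have -> : pi / h * (s - h * k%:R) = (s - h * k%:R) / h * pi by ring.
  rewrite sin_int_pi ?mulr0 ?mul0r ?mulr0 ?mulr0n//.
  rewrite mulrBl; apply: rpredB; first by move: As; rewrite /lattice_set/= subr0.
  by rewrite mulrAC divff ?gt_eqF// mul1r rpred_nat.
have sqn (n : nat) : (0 < n)%N -> 0 < Num.sqrt n%:R :> R by rewrite sqrtr_gt0 ltr0n.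
have wb n k : (0 < n)%N -> `|a * Num.sqrt n%:R * w n k - th * h| <=
    h / (2 * pi) * a * D * (1 + h * k%:R) / Num.sqrt n%:R.
  move=> n0; have sn0 := sqn n n0; have nn0 : 0 < n%:R :> R by rewrite ltr0n.
  have snE : Num.sqrt n%:R ^+ 2 = n%:R :> R by rewrite sqr_sqrtr// ltW.
  have [hd _] := HD n (h * k%:R) (L n) n0 (HL n).
  rewrite wE; move: hd; set I := \int[L n]_s _; set c := Num.sqrt (2 * pi / _) => hd.
  have acE : a * Num.sqrt n%:R * c = 2 * pi * th.
    rewrite /a /c -[LHS]mulrA -sqrtrM ?(ltW nn0)// -[LHS]mulrA -sqrtrM; last first.
      by rewrite !mulr_ge0 ?(ltW pi0)// ltW.
    have -> : 2 * pi * s2 * (n%:R * (2 * pi / (n%:R * s2))) = (2 * pi) ^+ 2.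
      by field; rewrite !gt_eqF.
    by rewrite sqrtr_sqr ger0_norm ?mulr_ge0 ?(ltW pi0)// mulrC.
  have -> : a * Num.sqrt n%:R * (h / (2 * pi) * I) - th * h =
      h / (2 * pi) * a * Num.sqrt n%:R * (I - c).
    have -> : th * h = h / (2 * pi) * (a * Num.sqrt n%:R * c).
      by rewrite acE; move: (@pi R) (lt0r_neq0 pi0) => p p0; field.
    ring.
  have g0 : 0 <= h / (2 * pi) * a * Num.sqrt n%:R.
    by rewrite !mulr_ge0 ?invr_ge0 ?mulr_ge0 ?(ltW pi0)// ltW.
  rewrite normrM (ger0_norm g0); apply: (le_trans (ler_wpM2l g0 hd)).
  have -> : (n%:R : R)^-1 = (Num.sqrt n%:R ^+ 2)^-1 by rewrite snE.
  rewrite ger0_norm; last by rewrite mulr_ge0// ltW.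
  have sn' := lt0r_neq0 sn0.
  rewrite le_eqVlt; apply/orP; left; apply/eqP.
  move: (Num.sqrt n%:R) sn' => sn sn'.
  by move: (@pi R) (lt0r_neq0 pi0) => p p0; field; rewrite ?sn' ?p0.
have cvi (u : R) : u / Num.sqrt n%:R @[n --> \oo] --> (0 : R).
  rewrite -[X in _ --> X](mulr0 u); apply: cvgM; first exact: cvg_cst.
  apply/gtr0_cvgV0; first by near=> n; apply: sqn; near: n; exact: nbhs_infty_gt.
  apply/cvgryPge => A; near=> n.
  rewrite (le_trans (ler_norm A))// -sqrtr_sqr ler_wsqrtr//.
  near: n; exact: nbhs_infty_ger.
have wc k : a * Num.sqrt n%:R * w n k @[n --> \oo] --> th * h.
  apply/cvgrPdist_le => e e0.
  have /cvgrPdist_le/(_ e e0) ce := cvi (h / (2 * pi) * a * D * (1 + h * k%:R)).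
  near=> n; rewrite distrC; apply: le_trans (wb n k _) _; first by near: n; exact: nbhs_infty_gt.
  have : `|0 - h / (2 * pi) * a * D * (1 + h * k%:R) / Num.sqrt n%:R| <= e by near: n.
  by rewrite sub0r normrN; apply: le_trans; exact: ler_norm.
have q1' : 1 - q != 0 by rewrite subr_eq0 eq_sym lt_eqF.
apply/cvgrPdist_le => e e0.
(* The two errors of stopping at [N], divided by [q^N]: the tail of the geometric series and the
   normalized remainder of [rec]. *)
pose B := th * h / (1 - q) + a * C0.
have B0 : 0 <= B by rewrite addr_ge0 ?divr_ge0 ?mulr_ge0 ?subr_ge0// ltW.
have : B * q ^+ N @[N --> \oo] --> (0 : R).
  rewrite -[X in _ --> X](mulr0 B); apply: cvgM; first exact: cvg_cst.
  by apply: cvg_expr; rewrite ger0_norm.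
have e20 : 0 < e / 2 by rewrite divr_gt0.
move=> /cvgrPdist_le/(_ _ e20)[N _ /(_ N (leqnn N))].
rewrite /= sub0r normrN => /(le_trans (ler_norm _)) hN.
have Sc : \sum_(k < N) q ^+ k * (a * Num.sqrt n%:R * w n k) @[n --> \oo] -->
    \sum_(k < N) q ^+ k * (th * h).
  apply: cvg_big => [|k _]; first exact: add_continuous.
  by apply: cvgM; [exact: cvg_cst|exact: wc].
have SE : \sum_(k < N) q ^+ k * (th * h) = th * h / (1 - q) - th * h / (1 - q) * q ^+ N.
  rewrite -mulr_suml.
  have -> : \sum_(k < N) q ^+ k = (1 - q ^+ N) / (1 - q).
    apply: (mulIf q1'); rewrite mulfVK// mulrC -opprB mulNr -subrX1 opprB //.
  by field.
move/cvgrPdist_le : Sc => /(_ _ e20) Sc.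
near=> n.
have n0 : (0 < n)%N by near: n; exact: nbhs_infty_gt.
have sn0 := sqn n n0.
rewrite aE (rec n N) mulrDr mulr_sumr.
have -> : \sum_(i < N) a * Num.sqrt n%:R * (q ^+ i * w n i) =
    \sum_(k < N) q ^+ k * (a * Num.sqrt n%:R * w n k).
  by apply: eq_bigr => k _; ring.
have hS : `|\sum_(k < N) q ^+ k * (th * h) - \sum_(k < N) q ^+ k * (a * Num.sqrt n%:R * w n k)| <= e / 2 by near: n.
move: hS; set S := \sum_(k < N) q ^+ k * (a * _ * _); rewrite SE => hS.
have pN := HC0 n (L n) (h * N%:R) n0 (HL n).
have pN0 : 0 <= \int[L n]_s exp_tail th (s - h * N%:R).
  by apply: Rintegral_ge0 => s _; exact: exp_tail_ge0.
move: pN pN0; set p := \int[L n]_s _ => pN pN0.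
have qN0 : 0 <= q ^+ N by exact: exprn_ge0.
have t1 : 0 <= a * Num.sqrt n%:R * (q ^+ N * p) <= a * C0 * q ^+ N.
  have -> : a * Num.sqrt n%:R * (q ^+ N * p) = a * q ^+ N * (p * Num.sqrt n%:R) by ring.
  have aq0 : 0 <= a * q ^+ N by apply: mulr_ge0 => //; exact: ltW.
  apply/andP; split; first by apply: mulr_ge0 => //; apply: mulr_ge0 => //; exact: ltW.
  by rewrite [leRHS]mulrAC ler_wpM2l// -ler_pdivlMr.
have t2 : 0 <= th * h / (1 - q) * q ^+ N.
  by rewrite !mulr_ge0 ?invr_ge0 ?subr_ge0// ltW.
move: hN; rewrite /B mulrDl => hN.
move: hS; rewrite -/q !ler_norml => /andP[hS1 hS2].
move: t1 => /andP[t11 t12].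
apply/andP; split; lra.
Unshelve. all: by end_near. Qed.

End lattice_limit.

(** * Derivatives of the cumulant generating function *)

Section moments.
Context (R : realType) (F : probability R R).
Implicit Types (t r x : R).

(** The k-th derivative of the moment generating function on the interior of its domain; divided by
    [moment 0 t], the k-th moment of the tilted law. *)
Definition moment k t := \int[F]_x (x ^+ k * expR (t * x)).

Let mexp t : measurable_fun setT (fun x : R => expR (t * x)).
Proof. by apply: measurableT_comp => //; exact: measurable_funM. Qed.

(** From [e^y >= 1 + y] at [y = r x / (k + 1)], raised to the power [k]. *)
Lemma pow_le_expR (k : nat) r x : 0 < r -> 0 <= x ->
  x ^+ k <= (k.+1%:R / r) ^+ k * expR (r * x).
Proof.
move=> r0 x0.
have E : 1 <= expR (r * x) by rewrite -[leLHS]expR0 ler_expR mulr_ge0// ltW.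
case: k => [|k]; first by rewrite !expr0 mul1r.
have kr : 0 < k.+2%:R / r by rewrite divr_gt0.
have h : x <= k.+2%:R / r * expR (r / k.+2%:R * x).
  rewrite -ler_pdivrMl// invf_div.
  by apply: le_trans (expR_ge1Dx _); rewrite lerDr.
apply: (@le_trans _ _ ((k.+2%:R / r * expR (r / k.+2%:R * x)) ^+ k.+1)).
  by rewrite lerXn2r// nnegrE mulr_ge0 ?expR_ge0// ltW.
rewrite exprMn ler_wpM2l ?exprn_ge0 ?(ltW kr)// -expRM_natl ler_expR.
rewrite mulrA ler_wpM2r// mulrCA -[leRHS]mulr1 ler_wpM2l ?(ltW r0)//.
by rewrite ler_pdivrMr// mul1r ler_nat.
Qed.

Lemma integrable_dom t : dom_psi F t -> F.-integrable setT (EFin \o (fun x => expR (t * x))).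
Proof.
rewrite /dom_psi/= /mgf => h; apply/integrableP; split; first exact/measurable_EFinP.
by under eq_integral do rewrite /= ger0_norm ?expR_ge0//.
Qed.

(** The factor [e^(r |x|)] leaves room for all parameters within [r] of [t] at once, which is the
    domination needed to differentiate under the integral. *)
Lemma interior_dom_radius t : interior (dom_psi F) t -> exists2 r, 0 < r &
  forall k, F.-integrable setT (EFin \o (fun x => `|x| ^+ k * expR (t * x + r * `|x|))).
Proof.
move=> /nbhs_ballP[e /= e0 he]; have e4 : 0 < e / 4 by rewrite divr_gt0.
(* One [e / 4] pays for [|x|^k], another for [r |x|]; the sum [e / 2] keeps the parameters
   [t + e / 2] and [t - e / 2] inside the ball. *)
exists (e / 4) => // k.
have i1 : F.-integrable setT (EFin \o (fun x => expR ((t + e / 2) * x))).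
  by apply: integrable_dom; apply: he; rewrite /ball/= opprD addrA subrr sub0r normrN gtr0_norm; lra.
have i2 : F.-integrable setT (EFin \o (fun x => expR ((t - e / 2) * x))).
  by apply: integrable_dom; apply: he; rewrite /ball/= opprD addrA subrr sub0r opprK gtr0_norm; lra.
pose C := (k.+1%:R / (e / 4)) ^+ k.
apply: integrable_le (integrable_scale C (integrable_add i1 i2)).
  apply: measurable_funM.
    by apply: measurable_funX; exact: normr_measurable.
  apply: measurableT_comp => //; apply: measurable_funD; first exact: measurable_funM.
  by apply: measurable_funM => //; exact: normr_measurable.
move=> x; rewrite ger0_norm ?mulr_ge0 ?expR_ge0 ?exprn_ge0//.
have := pow_le_expR k e4 (normr_ge0 x); rewrite -/C => h.
apply: (@le_trans _ _ (C * expR (e / 4 * `|x|) * expR (t * x + e / 4 * `|x|))).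
  by rewrite ler_wpM2r ?expR_ge0.
have C0 : 0 <= C by rewrite exprn_ge0// divr_ge0// ltW.
rewrite -mulrA ler_wpM2l// -expRD.
have [x0|x0] := leP 0 x.
- rewrite (ger0_norm x0).
  have -> : e / 4 * x + (t * x + e / 4 * x) = (t + e / 2) * x by field.
  by rewrite lerDl expR_ge0.
- rewrite (ltr0_norm x0).
  have -> : e / 4 * - x + (t * x + e / 4 * - x) = (t - e / 2) * x by field.
  by rewrite lerDr expR_ge0.
Qed.

Lemma integrable_moment k t : interior (dom_psi F) t ->
  F.-integrable setT (EFin \o (fun x => `|x| ^+ k * expR (t * x))).
Proof.
move=> /interior_dom_radius[r r0 /(_ k)]; apply: integrable_le.
  by apply: measurable_funM => //; apply: measurable_funX; exact: normr_measurable.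
move=> x; rewrite ger0_norm ?mulr_ge0 ?expR_ge0 ?exprn_ge0//.
by rewrite ler_wpM2l ?exprn_ge0// ler_expR lerDl mulr_ge0// ltW.
Qed.

Lemma integrable_moment' k t : interior (dom_psi F) t ->
  F.-integrable setT (EFin \o (fun x => x ^+ k * expR (t * x))).
Proof.
move=> /(integrable_moment k); apply: integrable_le.
  by apply: measurable_funM => //; exact: measurable_funX.
by move=> x; rewrite normrM normrX [X in _ * X]ger0_norm// expR_ge0.
Qed.

Lemma is_derive_moment k t : interior (dom_psi F) t ->
  is_derive t 1 (moment k) (moment k.+1 t).
Proof.
move=> it; have [r r0 hr] := interior_dom_radius it.
have d1 (s y : R) : is_derive s 1 (fun s => y ^+ k * expR (s * y)) (y ^+ k.+1 * expR (s * y)).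
  by apply: is_derive_eq; rewrite /GRing.scale/= exprSr; ring.
have It : `]t - r, t + r[%classic t by rewrite /= in_itv/=; apply/andP; split; lra.
have bnd (s y : R) : `]t - r, t + r[%classic s -> expR (s * y) <= expR (t * y + r * `|y|).
  rewrite /= in_itv/= => /andP[s1 s2]; rewrite ler_expR -lerBlDl -mulrBl.
  apply: (le_trans (ler_norm _)); rewrite normrM ler_wpM2r// ler_norml.
  by apply/andP; split; lra.
have intf (s : R) : `]t - r, t + r[%classic s ->
    F.-integrable setT (EFin \o (fun y => y ^+ k * expR (s * y))).
  move=> hs; apply: integrable_le (hr k).
    by apply: measurable_funM => //; exact: measurable_funX.
  by move=> y; rewrite normrM normrX [X in _ * X]ger0_norm ?expR_ge0// ler_wpM2l// bnd.
have derf1 (s y : R) : `]t - r, t + r[%classic s -> setT y ->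
    derivable (fun s : R => y ^+ k * expR (s * y)) s 1.
  by move=> _ _; have [] := d1 s y.
pose G y := `|y| ^+ k.+1 * expR (t * y + r * `|y|).
have G0 y : 0 <= G y by rewrite mulr_ge0 ?expR_ge0 ?exprn_ge0.
have pE s y : partial1of2 (fun s y : R => y ^+ k * expR (s * y)) s y = y ^+ k.+1 * expR (s * y).
  by rewrite partial1of2E; have [_] := d1 s y.
have Gub (s y : R) : `]t - r, t + r[%classic s -> setT y ->
    `|partial1of2 (fun s y : R => y ^+ k * expR (s * y)) s y| <= G y.
  move=> hs _; rewrite pE normrM normrX [X in _ * X]ger0_norm ?expR_ge0//.
  by rewrite ler_wpM2l ?exprn_ge0// bnd.
apply: DeriveDef.
  exact: (derivable_under_integral measurableT It intf derf1 G0 (hr k.+1) Gub).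
rewrite -derive1E (differentiation_under_integral measurableT It intf derf1 G0 (hr k.+1) Gub).
by apply: eq_Rintegral => y _; rewrite pE.
Qed.

Lemma moment0E t : fine (mgf F t) = moment 0 t.
Proof.
rewrite /mgf /moment /Rintegral; congr fine; apply: eq_integral => x _.
by rewrite expr0 mul1r.
Qed.

Lemma psiE t : psi F t = ln (moment 0 t).
Proof. by rewrite /psi moment0E. Qed.

Lemma moment0_gt0 t : interior (dom_psi F) t -> 0 < moment 0 t.
Proof.
move=> it; rewrite lt_neqAle; apply/andP; split; last first.
  by apply: Rintegral_ge0 => x _; rewrite mulr_ge0 ?expR_ge0.
apply/eqP => m0.
have ii := integrable_moment' 0 it.
have : (\int[F]_x `|(x ^+ 0 * expR (t * x))%:E| = 0)%E.
  under eq_integral do rewrite /= ger0_norm ?mulr_ge0 ?expR_ge0//.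
  by rewrite EFin_Rintegral// -/(moment 0 t) -m0.
have mm : measurable_fun setT (fun x : R => (x ^+ 0 * expR (t * x))%:E).
  exact: (measurable_int _ ii).
move=> /(ae_eq_integral_abs _ measurableT mm)[N [mN N0 sN]].
have : (F setT <= F N)%E.
  apply: le_measure; rewrite ?inE// => x _; apply: sN => /=.
  move=> /(_ I)/eqP; rewrite expr0 mul1r eqe => /eqP h.
  by have := expR_gt0 (t * x); rewrite h ltxx.
by rewrite N0 probability_setT leNgt lte01.
Qed.

Lemma expR_psi t : interior (dom_psi F) t -> expR (psi F t) = moment 0 t.
Proof. by move=> it; rewrite psiE lnK// posrE moment0_gt0. Qed.

Lemma is_derive_psi t : interior (dom_psi F) t ->
  is_derive t 1 (psi F) (moment 1 t / moment 0 t).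
Proof.
move=> it; have -> : psi F = (@ln R) \o moment 0.
  by apply/funext => s; rewrite psiE.
rewrite mulrC; apply: is_derive1_comp; last exact: is_derive_moment.
by apply: is_derive1_ln; exact: moment0_gt0.
Qed.

Lemma derive1_psi t : interior (dom_psi F) t ->
  derive1 (psi F) t = moment 1 t / moment 0 t.
Proof. by move=> it; rewrite derive1E; have [_] := is_derive_psi it. Qed.

(** The quotient rule needs the formula for the first derivative on a neighbourhood of [t], which
    openness of the interior supplies. The value is the variance of the tilted law. *)
Lemma derive1_derive1_psi t : interior (dom_psi F) t ->
  derive1 (derive1 (psi F)) t = moment 2 t / moment 0 t - (moment 1 t / moment 0 t) ^+ 2.
Proof.
move=> it; have m0 := moment0_gt0 it.
have it' : interior (interior (dom_psi F)) t by exact: nbhs_interior.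
have ne : \forall s \near t, moment 1 s * (moment 0 s)^-1 = derive1 (psi F) s.
  by near=> s; rewrite derive1_psi//; near: s; exact: it'.
have d1 := is_derive_moment 1 it; have d0 := is_derive_moment 0 it.
have m0n : moment 0 t != 0 by rewrite gt_eqF.
have dV : is_derive t 1 (fun s => (moment 0 s)^-1) (- (moment 0 t) ^- 2 *: moment 1 t).
  exact: is_deriveV.
have dM : is_derive t 1 (fun s => moment 1 s * (moment 0 s)^-1)
   (moment 1 t *: (- (moment 0 t) ^- 2 *: moment 1 t) + (moment 0 t)^-1 *: moment 2 t).
  exact: is_deriveM.
have [_] := near_eq_is_derive ne dM; rewrite -derive1E => ->.
by rewrite /GRing.scale/=; field.
Unshelve. all: by end_near. Qed.

End moments.

(** * Exponential tilting *)

Section cos_eq1.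
Context {R : realType}.

(** The half-angle formula gives [sin (y / 2) = 0]. Subtracting the integer part of [y / (2 pi)]
    brings the half-angle into [[0, pi[], where sine vanishes only at 0. *)
Lemma cos_eq1_int (y : R) : cos y = 1 -> y / (2 * pi) \is a Num.int.
Proof.
move=> cy; have p0 := @pi_gt0 R.
have p0' : (pi : R) != 0 by rewrite gt_eqF.
have s0 : sin (y / 2) = 0.
  have := cosD (y / 2) (y / 2); rewrite -splitr cy -!expr2.
  have := cos2Dsin2 (y / 2) => h1 h2; apply/eqP; rewrite -sqrf_eq0; apply/eqP; lra.
pose n : R := (Num.floor (y / (2 * pi)))%:~R.
have ni : n \is a Num.int by exact: intr_int.
have sn : sin (y / 2 - n * pi) = 0 by rewrite sinB s0 (sin_int_pi ni) mul0r mulr0 subrr.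
have h1 : n <= y / (2 * pi) by exact: floor_le.
have h2 : y / (2 * pi) < n + 1 by rewrite -intrD1; exact: floorD1_gt.
have yE : y / 2 = y / (2 * pi) * pi.
  by move: (@pi R) p0' => p pn; field.
have [->//|ne] := eqVneq (y / (2 * pi)) n.
have h3 : n < y / (2 * pi) by rewrite lt_neqAle eq_sym ne.
suff : 0 < sin (y / 2 - n * pi) by rewrite sn ltxx.
apply: sin_gt0_pi; rewrite yE -mulrBl ?mulr_gt0 ?subr_gt0//=.
by rewrite gtr_pMl//; lra.
Qed.

End cos_eq1.

Section null_integral.
Context (R : realType) (P : probability R R).

Lemma probability_eq1_of_Rintegral_eq0 (g : R -> R) :
  P.-integrable setT (EFin \o g) -> (forall x, 0 <= g x) -> \int[P]_x g x = 0 ->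
  P [set x | g x = 0] = 1%E.
Proof.
move=> ig g0 Ig.
have mg : measurable_fun setT g by apply/measurable_EFinP; exact: measurable_int ig.
set A := [set x | g x = 0]; have mA : measurable A.
  by have := mg measurableT [set 0] (measurable_set1 0); rewrite setTI.
have : (\int[P]_x `|(EFin \o g) x| = 0)%E.
  under eq_integral do rewrite /= ger0_norm//.
  by rewrite EFin_Rintegral// Ig.
move=> /(ae_eq_integral_abs _ measurableT (measurable_int _ ig))[N [mN N0 sN]].
have : (P (~` A) <= P N)%E.
  apply: le_measure; rewrite ?inE//; first exact: measurableC.
  by move=> x gx; apply: sN => /= /(_ I)[].
rewrite N0 measure_le0 => /eqP PA; have := probability_setC P mA; rewrite PA.
have -> : P A = (fine (P A))%:E by rewrite fineK// fin_num_measure.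
by rewrite -EFinB => -[h]; congr EFin; rewrite -[RHS]addr0 h; lra.
Qed.

Lemma probability_eq1_nonempty (A : set R) : P A = 1%E -> A !=set0.
Proof.
move=> PA; apply/set0P/negP => /eqP A0; move: PA; rewrite A0 measure0 => /eqP.
by rewrite eqe eq_sym oner_eq0.
Qed.

Lemma probability_eq1_sub (A B : set R) : measurable A -> measurable B -> A `<=` B ->
  P A = 1%E -> P B = 1%E.
Proof.
move=> mA mB AB PA; apply/eqP; rewrite eq_le probability_le1//= -PA.
by apply: le_measure; rewrite ?inE.
Qed.

End null_integral.

Section tilt.
Context (R : realType) (F : probability R R) (b th : R).
Hypothesis ith : interior (dom_psi F) th.

Definition tilt_density (x : R) := expR (th * x - psi F th).

Local Notation w := tilt_density.

Lemma tilt_density_gt0 x : 0 < w x. Proof. exact: expR_gt0. Qed.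

Lemma tilt_density_ge0 x : 0 <= w x. Proof. exact: expR_ge0. Qed.

Lemma tilt_densityE x : w x = (moment F 0 th)^-1 * expR (th * x).
Proof. by rewrite /w expRB mulrC expR_psi. Qed.

Lemma measurable_tilt_density : measurable_fun setT w.
Proof.
apply: measurableT_comp => //; apply: measurable_funB => //; exact: measurable_funM.
Qed.

Lemma integrable_tilt_moment k :
  F.-integrable setT (EFin \o (fun x => `|x - b| ^+ k * w x)).
Proof.
have i1 := integrable_moment k ith; have i0 := integrable_moment 0 ith.
have m0 := moment0_gt0 ith.
apply: integrable_le (integrable_scale (2 ^+ k * (moment F 0 th)^-1)
    (integrable_add i1 (integrable_scale (`|b| ^+ k) i0))).
  apply: measurable_funM; last exact: measurable_tilt_density.
  apply: measurable_funX; apply: measurableT_comp; first exact: normr_measurable.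
  exact: measurable_funB.
move=> x; rewrite ger0_norm ?mulr_ge0 ?exprn_ge0 ?tilt_density_ge0//.
rewrite tilt_densityE expr0 mul1r -mulrDl mulrACA.
set e := _^-1 * expR _.
have e0 : 0 <= e by rewrite mulr_ge0 ?expR_ge0// invr_ge0 ltW.
rewrite ler_wpM2r//.
apply: (@le_trans _ _ ((2 * Num.max `|x| `|b|) ^+ k)).
  rewrite lerXn2r// ?nnegrE ?mulr_ge0 ?le_max ?normr_ge0//.
  apply: (le_trans (ler_normB _ _)).
  by have [] := leP `|x| `|b|; lra.
rewrite exprMn ler_wpM2l ?exprn_ge0//.
by have [_|_] := leP `|x| `|b|; rewrite ?lerDl ?lerDr exprn_ge0.
Qed.

Lemma Rintegral_tilt_density : \int[F]_x w x = 1.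
Proof.
have m0 := moment0_gt0 ith.
under eq_Rintegral do rewrite tilt_densityE.
have i0 := integrable_moment' 0 ith.
have -> : \int[F]_x ((moment F 0 th)^-1 * expR (th * x)) =
   \int[F]_x ((moment F 0 th)^-1 * (x ^+ 0 * expR (th * x))).
  by apply: eq_Rintegral => x _; rewrite expr0 mul1r.
by rewrite RintegralZl// -/(moment F 0 th) mulVf// gt_eqF.
Qed.

Lemma integral_tilt_density : (\int[F]_x (w x)%:E = 1)%E.
Proof.
rewrite EFin_Rintegral ?Rintegral_tilt_density//.
have := integrable_tilt_moment 0.
by congr integrable; apply/funext => x /=; rewrite expr0 mul1r.
Qed.

Lemma exists_tilt : exists Q : probability R R, forall f : R -> \bar R,
  measurable_fun setT f -> (forall x, 0 <= f x)%E ->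
  (\int[Q]_x f x = \int[F]_x (f (x - b)%R * (w x)%:E))%E.
Proof.
apply: density_probability.
- exact: measurable_tilt_density.
- exact: tilt_density_ge0.
- exact: measurable_funB.
- exact: integral_tilt_density.
Qed.

Lemma moment1_of_derive1_psi : derive1 (psi F) th = b -> moment F 1 th = b * moment F 0 th.
Proof.
by move=> <-; rewrite derive1_psi// divfK// gt_eqF// moment0_gt0.
Qed.

Variable Q : probability R R.
Hypothesis QE : forall f : R -> \bar R, measurable_fun setT f -> (forall x, 0 <= f x)%E ->
  (\int[Q]_x f x = \int[F]_x (f (x - b)%R * (w x)%:E))%E.

Let measurable_subb (f : R -> R) : measurable_fun setT f ->
  measurable_fun setT (fun x : R => f (x - b)).
Proof. by move=> mf; apply: measurableT_comp => //; exact: measurable_funB. Qed.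

Lemma integrable_tilt (f : R -> R) : measurable_fun setT f ->
  F.-integrable setT (EFin \o (fun x => f (x - b) * w x)) -> Q.-integrable setT (EFin \o f).
Proof.
move=> mf /integrableP[_ fi]; apply/integrableP; split; first exact/measurable_EFinP.
rewrite QE//; last by apply: measurableT_comp => //; exact/measurable_EFinP.
apply: le_lt_trans fi; apply: ge0_le_integral => //.
- by move=> x _; rewrite mule_ge0// lee_fin tilt_density_ge0.
- apply/measurable_EFinP; apply: measurable_funM; last exact: measurable_tilt_density.
  by apply: measurableT_comp; [exact: normr_measurable|exact: measurable_subb].
- apply/measurable_EFinP; apply: measurableT_comp; first exact: normr_measurable.
  by apply: measurable_funM; [exact: measurable_subb|exact: measurable_tilt_density].
- move=> x _; rewrite /= -EFinM lee_fin normrM.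
  by rewrite (ger0_norm (tilt_density_ge0 _)).
Qed.

Lemma Rintegral_tilt_ge0 (f : R -> R) : measurable_fun setT f -> (forall x, 0 <= f x) ->
  \int[Q]_x f x = \int[F]_x (f (x - b) * w x).
Proof.
by move=> mf f0; rewrite /Rintegral QE//; exact/measurable_EFinP.
Qed.

(** [QE] covers nonnegative functions only: it is applied to [f + |f|] and to [|f|], and the results
    are subtracted. *)
Lemma Rintegral_tilt (f : R -> R) : measurable_fun setT f ->
  F.-integrable setT (EFin \o (fun x => f (x - b) * w x)) ->
  \int[Q]_x f x = \int[F]_x (f (x - b) * w x).
Proof.
move=> mf fi; have Qf := integrable_tilt mf fi.
have mn : measurable_fun setT (fun x => `|f x|).
  by apply: measurableT_comp => //; exact: normr_measurable.
have ni : F.-integrable setT (EFin \o (fun x => `|f (x - b)| * w x)).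
  have := integrable_norm fi; congr integrable; apply/funext => x /=.
  by rewrite normrM (ger0_norm (tilt_density_ge0 _)).
have Qn := integrable_tilt mn ni.
have : \int[Q]_x (f x + `|f x|) = \int[F]_x ((f (x - b) + `|f (x - b)|) * w x).
  apply: (@Rintegral_tilt_ge0 (fun x => f x + `|f x|)); first exact: measurable_funD.
  by move=> x; rewrite -lerBlDl sub0r -normrN ler_norm.
under [RHS]eq_Rintegral do rewrite mulrDl.
rewrite !RintegralD// (Rintegral_tilt_ge0 mn)// => /addIr ->//.
Qed.

Let sqE x : (x - b) ^+ 2 * w x = (moment F 0 th)^-1 *
  (x ^+ 2 * expR (th * x) - 2 * b * (x ^+ 1 * expR (th * x)) + b ^+ 2 * (x ^+ 0 * expR (th * x))).
Proof. by rewrite tilt_densityE; ring. Qed.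

Lemma integrable_sub_pow_tilt_density k :
  F.-integrable setT (EFin \o (fun x => (x - b) ^+ k * w x)).
Proof.
have := integrable_tilt_moment k; apply: integrable_le.
  apply: measurable_funM; last exact: measurable_tilt_density.
  by apply: measurable_funX; exact: measurable_funB.
by move=> x; rewrite normrM normrX (ger0_norm (tilt_density_ge0 _)).
Qed.

Lemma integrable_tilt_pow k : Q.-integrable setT (EFin \o (fun x => x ^+ k)).
Proof.
apply: integrable_tilt; first exact: measurable_funX.
exact: integrable_sub_pow_tilt_density.
Qed.

Lemma integrable_tilt_norm_pow k : Q.-integrable setT (EFin \o (fun x => `|x| ^+ k)).
Proof.
have := integrable_norm (integrable_tilt_pow k).
by congr integrable; apply/funext => x /=; rewrite normrX.
Qed.

Lemma Rintegral_tilt_pow k : \int[Q]_x x ^+ k = \int[F]_x ((x - b) ^+ k * w x).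
Proof.
apply: (@Rintegral_tilt (fun x => x ^+ k)); first exact: measurable_funX.
exact: integrable_sub_pow_tilt_density.
Qed.

Hypothesis psi1 : derive1 (psi F) th = b.

Lemma tilt_mean0 : \int[Q]_x x = 0.
Proof.
have i0 := integrable_moment' 0 ith; have i1 := integrable_moment' 1 ith.
have -> : \int[Q]_x x = \int[Q]_x (x ^+ 1) by [].
rewrite Rintegral_tilt_pow.
under eq_Rintegral => x _.
  rewrite (_ : _ * _ = (moment F 0 th)^-1 * (x ^+ 1 * expR (th * x) - b * (x ^+ 0 * expR (th * x)))); last first.
    by rewrite tilt_densityE; ring.
  over.
rewrite RintegralZl//; last by apply: integrable_sub => //; exact: integrable_scale.
rewrite RintegralB//; last exact: integrable_scale.
by rewrite RintegralZl// -/(moment F 1 th) -/(moment F 0 th) moment1_of_derive1_psi// subrr mulr0.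
Qed.

Lemma tilt_variance : \int[Q]_x x ^+ 2 = derive1 (derive1 (psi F)) th.
Proof.
have i0 := integrable_moment' 0 ith; have i1 := integrable_moment' 1 ith.
have i2 := integrable_moment' 2 ith.
have m0 : moment F 0 th != 0 by rewrite gt_eqF// moment0_gt0.
rewrite Rintegral_tilt_pow; under eq_Rintegral do rewrite sqE.
have j1 := integrable_scale (2 * b) i1; have j0 := integrable_scale (b ^+ 2) i0.
rewrite RintegralZl//; last exact: integrable_add (integrable_sub i2 j1) j0.
rewrite RintegralD//; last exact: integrable_sub.
rewrite RintegralB// (RintegralZl _ measurableT i1) (RintegralZl _ measurableT i0).
rewrite -/(moment F 2 th) -/(moment F 1 th) -/(moment F 0 th) derive1_derive1_psi//.
by rewrite moment1_of_derive1_psi//; field.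
Qed.

(** The tilting density is positive everywhere, so what is almost sure under the tilted law is
    almost sure under [F]. This carries degeneracy of [Q] back to the hypotheses on [F]. *)
Lemma tilt_full (f : R -> R) : measurable_fun setT f -> (forall x, 0 <= f x) ->
  F.-integrable setT (EFin \o (fun x => f (x - b) * w x)) ->
  \int[Q]_x f x <= 0 -> F [set x | f (x - b) = 0] = 1%E.
Proof.
move=> mf f0 fi Qf.
have wf x : 0 <= f (x - b) * w x by rewrite mulr_ge0 ?tilt_density_ge0.
have e : \int[F]_x (f (x - b) * w x) = 0.
  apply/eqP; rewrite eq_le; apply/andP; split; last exact: Rintegral_ge0.
  by rewrite -Rintegral_tilt_ge0.
rewrite -(probability_eq1_of_Rintegral_eq0 fi wf e); congr (F _).
apply/seteqP; split => x /=; first by move->; rewrite mul0r.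
by move/eqP; rewrite mulf_eq0 [X in _ || X]gt_eqF ?tilt_density_gt0// orbF => /eqP.
Qed.

Lemma tilt_variance_gt0 : F [set b] <> 1%E -> 0 < derive1 (derive1 (psi F)) th.
Proof.
move=> Fb; rewrite -tilt_variance ltNge; apply/negP => h; apply: Fb.
have := @tilt_full (fun x => x ^+ 2) (measurable_funX 2 (@measurable_id _ _ setT))
  (fun x => sqr_ge0 x) (integrable_sub_pow_tilt_density 2) h.
move=> <-; congr (F _); apply/seteqP; split => x /=; first by move->; rewrite subrr expr0n.
by move/eqP; rewrite sqrf_eq0 subr_eq0 => /eqP.
Qed.

(** Modulus 1 would make [(cos (t X), sin (t X))] almost surely constant; two points with the same
    cosine and sine differ by a multiple of [2 pi / t], so [F] would live on a translate of that
    lattice. *)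
Lemma tilt_ecf2_lt1 t : t != 0 -> (forall x0, F (lattice_set x0 (2 * pi / t)) <> 1%E) ->
  ecf2 Q t < 1.
Proof.
move=> t0 Fl; rewrite ltNge; apply/negP => h1.
set c := ecos Q t; set s := esin Q t.
(* [(cos tX, sin tX)] has total variance [1 - (c^2 + s^2)]. *)
pose g x := (cos (t * x) - c) ^+ 2 + (sin (t * x) - s) ^+ 2.
have mc : measurable_fun setT (fun x : R => cos (t * x)).
  by have := measurable_cos_affine t 0; congr measurable_fun; apply/funext => x; rewrite addr0.
have ms : measurable_fun setT (fun x : R => sin (t * x)).
  by have := measurable_sin_affine t 0; congr measurable_fun; apply/funext => x; rewrite addr0.
have ic : Q.-integrable setT (EFin \o (fun x => cos (t * x))).
  by apply: (@bounded_integrable _ _ 1) => // x; exact: cos_max.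
have is' : Q.-integrable setT (EFin \o (fun x => sin (t * x))).
  by apply: (@bounded_integrable _ _ 1) => // x; exact: sin_max.
have mg : measurable_fun setT g.
  by apply: measurable_funD; apply: measurable_funX; exact: measurable_funB.
have g0 x : 0 <= g x by rewrite addr_ge0 ?sqr_ge0.
have gE x : g x = (1 + (c ^+ 2 + s ^+ 2)) - (2 * c * cos (t * x) + 2 * s * sin (t * x)).
  by have := cos2Dsin2 (t * x); rewrite /g; nra.
have jc := integrable_scale (2 * c) ic; have js := integrable_scale (2 * s) is'.
have Qg : \int[Q]_x g x <= 0.
  under eq_Rintegral do rewrite gE.
  rewrite RintegralB//; [|exact: integrable_const|exact: integrable_add].
  rewrite Rintegral_prob_cst RintegralD// (RintegralZl _ measurableT ic) (RintegralZl _ measurableT is').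
  rewrite -/(ecos Q t) -/(esin Q t) -/c -/s.
  by move: h1; rewrite /ecf2 -/c -/s; nra.
have gw : F.-integrable setT (EFin \o (fun x => g (x - b) * w x)).
  have := integrable_scale (1 + (c ^+ 2 + s ^+ 2) + 2 * `|c| + 2 * `|s|) (integrable_tilt_moment 0).
  apply: integrable_le.
    apply: measurable_funM; last exact: measurable_tilt_density.
    exact: measurable_subb.
  move=> x; rewrite [leLHS]ger0_norm ?mulr_ge0 ?tilt_density_ge0//.
  rewrite expr0 mul1r ler_wpM2r ?tilt_density_ge0// gE.
  have n1 : `|c * cos (t * (x - b))| <= `|c|.
    by rewrite normrM ler_piMr// cos_max.
  have n2 : `|s * sin (t * (x - b))| <= `|s|.
    by rewrite normrM ler_piMr// sin_max.
  move: n1 n2; rewrite !ler_norml => /andP[n1 _] /andP[n2 _].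
  by rewrite -!mulrA; lra.
have FA := tilt_full mg g0 gw Qg.
have [x1 /= gx1] := probability_eq1_nonempty FA.
have H x : g x = 0 -> cos (t * x) = c /\ sin (t * x) = s.
  move=> /eqP; rewrite paddr_eq0 ?sqr_ge0// !sqrf_eq0 !subr_eq0.
  by move=> /andP[/eqP -> /eqP ->].
apply: (Fl x1); apply: probability_eq1_sub FA.
- have := measurable_subb mg measurableT (measurable_set1 0); rewrite setTI; exact.
- exact: measurable_lattice_set.
move=> x /= gx; have [c1 s1] := H _ gx1; have [c2 s2] := H _ gx.
have E : cos (t * (x - b) - t * (x1 - b)) = 1.
  by rewrite cosB c1 c2 s1 s2 -!expr2 -c1 -s1 cos2Dsin2.
have := cos_eq1_int E; rewrite /lattice_set/=; congr (_ \is a Num.int).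
have p0 : (pi : R) != 0 by rewrite gt_eqF// pi_gt0.
by move: (@pi R) p0 => p p0; field; apply/andP.
Qed.

(** An atom at [b] forces [b] onto the lattice, so [X - b] takes its values in the multiples of [h]
    with no offset, and so do all the sums. *)
Lemma tilt_lattice x0 h : 0 < h -> F (lattice_set x0 h) = 1%E -> (0 < F [set b])%E ->
  Q (lattice_set 0 h) = 1%E.
Proof.
move=> h0 Fl Fb; have mA := measurable_lattice_set x0 h.
have bl : lattice_set x0 h b.
  apply: contrapT => nb; move: Fb; rewrite ltNge => /negP; apply.
  rewrite -(full_measureC mA Fl); apply: le_measure; rewrite ?inE//; first exact: measurableC.
  by move=> x ->.
have mB := measurable_lattice_set 0 h.
rewrite -[LHS]mul1e -integral_cst// integral_mkcond QE; last 2 first.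
- apply/measurable_restrict => //; exact: measurable_cst.
- by move=> x; rewrite patchE; case: ifP.
rewrite -[RHS]integral_tilt_density; apply: (eq_integral_full mA Fl).
- apply: emeasurable_funM; last by apply/measurable_EFinP; exact: measurable_tilt_density.
  apply: (@measurableT_comp _ _ _ _ _ _ (patch _ _ _) _ (fun x : R => x - b)).
    by apply/measurable_restrict => //; exact: measurable_cst.
  exact: measurable_funB.
- by apply/measurable_EFinP; exact: measurable_tilt_density.
move=> x xl; rewrite patchE ifT ?mul1e// inE /lattice_set/= subr0.
have -> : (x - b) / h = (x - x0) / h - (b - x0) / h by field; rewrite gt_eqF.
exact: rpredB.
Qed.

End tilt.

Lemma tilt_parameter_gt0 (R : realType) (F : probability R R) (b th : R) :
  interior (dom_psi F) 0 -> interior (dom_psi F) th -> mean F < b ->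
  derive1 (psi F) th = b -> 0 < th.
Proof.
(* If [th <= 0] then [(x - b) (e^(th x) - e^(th b)) <= 0] for all [x]. *)
move=> i0 ith mb psib; rewrite ltNge; apply/negP => th0.
have i1 : F.-integrable setT (EFin \o (fun x : R => x)).
  have := integrable_moment' 1 i0; congr integrable; apply/funext => x /=.
  by rewrite expr1 mul0r expR0 mulr1.
have e0 := integrable_moment' 0 ith; have e1 := integrable_moment' 1 ith.
have m1 := moment1_of_derive1_psi ith psib.
have E1 : \int[F]_x (x ^+ 1 * expR (th * x) - b * (x ^+ 0 * expR (th * x))) = 0.
  rewrite RintegralB//; last exact: integrable_scale.
  by rewrite RintegralZl// -/(moment F 1 th) -/(moment F 0 th) m1 subrr.
have E2 : \int[F]_x (expR (th * b) * (x - b)) = expR (th * b) * (mean F - b).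
  rewrite RintegralZl//; last by apply: integrable_sub => //; exact: integrable_const.
  by rewrite RintegralB//; [rewrite Rintegral_prob_cst|exact: integrable_const].
have : \int[F]_x (x ^+ 1 * expR (th * x) - b * (x ^+ 0 * expR (th * x))) <=
    \int[F]_x (expR (th * b) * (x - b)).
  apply: le_Rintegral => //.
  - by apply: integrable_sub => //; exact: integrable_scale.
  - by apply: integrable_scale; apply: integrable_sub => //; exact: integrable_const.
  move=> x _; rewrite expr1 expr0 mul1r -mulrBl [leRHS]mulrC.
  have [xb|xb] := leP b x.
  - by rewrite ler_wpM2l ?subr_ge0// ler_expR ler_wnM2l.
  - by rewrite ler_wnM2l ?subr_le0 ?(ltW xb)// ler_expR ler_wnM2l// ltW.
rewrite E1 E2 => h; have : 0 <= mean F - b by rewrite -(pmulr_rge0 _ (expR_gt0 (th * b))).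
by lra.
Qed.

(** * Truncation *)

Lemma bernoulli_ineq (R : realDomainType) (x : R) n : 0 <= x <= 1 -> 1 - n%:R * x <= (1 - x) ^+ n.
Proof.
move=> /andP[x0 x1]; elim: n => [|n IH]; first by rewrite mul0r subr0 expr0.
rewrite exprS; apply: (@le_trans _ _ ((1 - x) * (1 - n%:R * x))); last first.
  by rewrite ler_wpM2l// subr_ge0.
have : 0 <= n%:R * (x * x) by rewrite !mulr_ge0.
rewrite -natr1; have -> : (1 - x) * (1 - n%:R * x) = 1 - (n%:R + 1) * x + n%:R * (x * x) by ring.
by move: (n%:R * (x * x)) => y y0; rewrite lerDl.
Qed.

Section iterated_trunc.
Context (R : realType) (F : probability R R).

(** Each step releases one factor [1 / F(u)]; what is left is an iteration of [F] itself confined to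
    []-oo, u]]. *)
Lemma iter_int_trunc (u : R) n (g : R -> \bar R) s :
  measurable_fun setT g -> (forall x, 0 <= g x)%E ->
  iter_int (trunc F u) n g s =
  (((fine (F `]-oo, u]%classic))^-1 ^+ n)%:E * iter_on `]-oo, u] F n g s)%E.
Proof.
move=> mg g0; elim: n s => [|n IH] s; first by rewrite /= expr0 mul1e.
set c := (fine _)^-1.
have mD : measurable (`]-oo, u] : set R) by exact: measurable_itv.
have mi : measurable_fun setT (fun x => iter_on `]-oo, u] F n g (s + x)).
  by apply: measurable_shift; exact: measurable_iter_on.
have i0 x : (0 <= iter_on `]-oo, u] F n g (s + x)%R)%E by exact: iter_on_ge0.
have c0 : 0 <= c by rewrite invr_ge0 fine_ge0// measure_ge0.
rewrite /= /trunc; under eq_integral do rewrite IH.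
rewrite ge0_integral_mscale//; last 2 first.
- by apply: emeasurable_funM => //; exact: measurable_cst.
- by move=> x _; rewrite mule_ge0// lee_fin exprn_ge0.
rewrite ge0_integral_mrestr//; last 2 first.
- by apply: emeasurable_funM => //; exact: measurable_cst.
- by move=> x; rewrite mule_ge0// lee_fin exprn_ge0.
rewrite ge0_integralZl//; last 2 first.
- exact: (measurable_funS measurableT).
- by rewrite lee_fin exprn_ge0.
by rewrite muleA -EFinM -exprS.
Qed.

End iterated_trunc.

Lemma measurable_preimage_addr (R : realType) (b : R) (D : set R) :
  measurable D -> measurable [set y | D (y + b)].
Proof.
move=> mD; have H : measurable_fun setT (fun y : R => y + b) by exact: measurable_funD.
by have := H measurableT D mD; rewrite setTI.
Qed.

Section iterated_tilt.
Context (R : realType) (F Q : probability R R) (b th : R).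
Hypothesis QE : forall f : R -> \bar R, measurable_fun setT f -> (forall x, 0 <= f x)%E ->
  (\int[Q]_x f x = \int[F]_x (f (x - b)%R * (tilt_density F th x)%:E))%E.

Lemma integral_tilt_on (D : set R) (f : R -> \bar R) : measurable D ->
  measurable_fun setT f -> (forall x, 0 <= f x)%E ->
  (\int[Q]_(x in [set y | D (y + b)%R]) f x =
   \int[F]_(x in D) (f (x - b)%R * (tilt_density F th x)%:E))%E.
Proof.
move=> mD mf f0; rewrite integral_mkcond QE; last 2 first.
- by apply: (measurable_restrictT f (measurable_preimage_addr b mD)).1; exact: (measurable_funS measurableT).
- by move=> x; rewrite patchE; case: ifP.
rewrite [RHS]integral_mkcond; apply: eq_integral => x _; rewrite !patchE.
have [xD|xD] := pselect (D x).
- by rewrite !mem_set//= subrK.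
- by rewrite !memNset ?mul0e//= subrK.
Qed.

(** The densities multiply, so their exponents add up along the path and combine with the end point.
    [s] and [c] are free for the induction; at [s = 0], [c = b n] the centred sum starts from 0. *)
Lemma iter_on_tilt (D : set R) n (g : R -> R) (c s : R) : measurable D ->
  measurable_fun setT g -> (forall x, 0 <= g x) ->
  (iter_on D F n (fun x => (g (x - c))%:E) s =
   (expR (n%:R * psi F th + th * (s - c)))%:E *
   iter_on [set y | D (y + b)%R] Q n (fun v => (expR (- (th * v)) * g v)%:E) (s - c + n%:R * b)%R)%E.
Proof.
move=> mD mg g0; set f := (fun v => (expR _ * _)%:E); set D' := [set y | _].
have mD' : measurable D' by exact: measurable_preimage_addr.
have mf : measurable_fun setT f.
  apply/measurable_EFinP; apply: measurable_funM => //; apply: measurableT_comp => //.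
  by apply: measurableT_comp => //; exact: measurable_funM.
have f0 x : (0 <= f x)%E by rewrite lee_fin mulr_ge0 ?expR_ge0.
elim: n s => [|n IH] s.
  by rewrite /= /f !mul0r add0r addr0 -EFinM mulrA -expRD subrr expR0 mul1r.
rewrite /=; under eq_integral do rewrite IH.
set v := s - c + n.+1%:R * b.
have mi : measurable_fun setT (fun x => iter_on D' Q n f (v + x)).
  by apply: measurable_shift; exact: measurable_iter_on.
have i0 x : (0 <= iter_on D' Q n f (v + x)%R)%E by exact: iter_on_ge0.
rewrite integral_tilt_on// -ge0_integralZl//; last 2 first.
- apply: (measurable_funS measurableT) => //; apply: emeasurable_funM.
    by apply: (measurableT_comp mi); exact: measurable_funB.
  by apply/measurable_EFinP; exact: measurable_tilt_density.
- by move=> x _; rewrite mule_ge0// lee_fin tilt_density_ge0.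
apply: eq_integral => x _; rewrite muleCA [RHS]muleC; congr (_ * _)%E.
  rewrite -EFinM /tilt_density -expRD; congr (expR _)%:E.
  by rewrite -natr1; ring.
by congr iter_on; rewrite /v -natr1; ring.
Qed.

End iterated_tilt.

(** * From the tilted law to the tail probabilities *)

Section main.
Context (R : realType) (F Q : probability R R) (b th : R).
Hypothesis QE : forall f : R -> \bar R, measurable_fun setT f -> (forall x, 0 <= f x)%E ->
  (\int[Q]_x f x = \int[F]_x (f (x - b)%R * (tilt_density F th x)%:E))%E.
Hypothesis ith : interior (dom_psi F) th.
Hypothesis psi1 : derive1 (psi F) th = b.
Hypothesis th_gt0 : 0 < th.
Let s2 := derive1 (derive1 (psi F)) th.
Hypothesis s2_gt0 : 0 < s2.
Variable L : nat -> probability R R.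
Hypothesis HL : forall n, is_sum_law Q n (L n).

Let a n := th * Num.sqrt (2 * pi * n%:R * s2).
Let p n := \int[L n]_s exp_tail th s.
Let E n := expR (th * n%:R * b - n%:R * psi F th).
(** The truncation in the centred variable, that is []-oo, u - b]]. *)
Let A (u : R) : set R := [set y | `]-oo, u]%classic (y + b)].
Let r (u : R) n :=
  fine (iter_on (A u) Q n (fun x => (exp_tail th x)%:E) 0).

Let ind (y : R) : R := if 0 <= y then 1 else 0.

Let measurable_ind : measurable_fun setT ind.
Proof.
have -> : ind = \1_(`[0, +oo[%classic).
  apply/funext => x; rewrite /ind indicE.
  have [x0|x0] := leP 0 x; first by rewrite mem_set//= in_itv/= x0.
  by rewrite memNset//= in_itv/= andbT leNgt x0.
exact: measurable_indic.
Qed.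

Let ind_ge0 x : 0 <= ind x. Proof. by rewrite /ind; case: ifP. Qed.

Let exp_tailE v : expR (- (th * v)) * ind v = exp_tail th v.
Proof. by rewrite /ind /exp_tail; case: ifP; rewrite ?mulr1 ?mulr0. Qed.

Let indE n : (fun s : R => (if b * n%:R <= s then 1 else 0)%:E : \bar R) =
  (fun s => (ind (s - b * n%:R))%:E).
Proof. by apply/funext => s; rewrite /ind subr_ge0. Qed.

Let iterE D n : measurable D -> iter_on D F n (fun s => (ind (s - b * n%:R))%:E) 0 =
  ((E n)^-1%:E * iter_on [set y | D (y + b)%R] Q n (fun x => (exp_tail th x)%:E) 0)%E.
Proof.
move=> mD; rewrite (iter_on_tilt QE)//; congr ((_)%:E * _)%E.
  by rewrite /E -expRN; congr expR; ring.
have -> : 0 - b * n%:R + n%:R * b = 0 by ring.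
by congr iter_on; apply/funext => v; rewrite exp_tailE.
Qed.

Let iter_setT n s : iter_on setT Q n (fun x => (exp_tail th x)%:E) s =
  (\int[L n]_y exp_tail th (y + s))%:E.
Proof.
rewrite HL//; last 2 first.
- by apply/measurable_EFinP; exact: measurable_exp_tail.
- by move=> x; rewrite lee_fin exp_tail_ge0.
rewrite -EFin_Rintegral; first by apply: eq_integral => x _; rewrite addrC.
by have := integrable_exp_tail_law (L n) th_gt0 (- s); under eq_fun do rewrite opprK.
Qed.

Let ptildeE n : E n * ptilde F n (b * n%:R) = p n.
Proof.
rewrite /ptilde indE iter_int_iter_on iterE// (_ : [set y | setT (y + b)] = setT)//.
rewrite iter_setT -EFinM/= mulrA mulfV ?gt_eqF ?expR_gt0// mul1r.
by apply: eq_Rintegral => x _; rewrite addr0.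
Qed.

Let mD u : measurable (A u).
Proof. by apply: measurable_preimage_addr; exact: measurable_itv. Qed.

Let iter_on_setT (D : set R) n s : measurable D ->
  (iter_on D Q n (fun x => (exp_tail th x)%:E) s <=
   iter_on setT Q n (fun x => (exp_tail th x)%:E) s)%E.
Proof.
have me : measurable_fun setT (fun x => (exp_tail th x)%:E).
  by apply/measurable_EFinP; exact: measurable_exp_tail.
have e0 x : (0 <= (exp_tail th x)%:E)%E by rewrite lee_fin exp_tail_ge0.
move=> mD'; elim: n s => //= n IH s.
apply: (@le_trans _ _ (\int[Q]_(x in D) iter_on setT Q n (fun x => (exp_tail th x)%:E) (s + x)%R)%E).
  apply: ge0_le_integral => //.
  - by move=> x _; exact: iter_on_ge0.
  - apply: (measurable_funS measurableT) => //.
    by apply: measurable_shift; exact: measurable_iter_on.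
  - apply: (measurable_funS measurableT) => //.
    by apply: measurable_shift; exact: measurable_iter_on.
apply: ge0_subset_integral => //.
- by apply: measurable_shift; exact: measurable_iter_on.
- by move=> x _; exact: iter_on_ge0.
Qed.

Let rE u n : iter_on (A u) Q n (fun x => (exp_tail th x)%:E) 0
  = (r u n)%:E.
Proof.
rewrite /r fineK// ge0_fin_numE; last by apply: iter_on_ge0 => x; rewrite lee_fin exp_tail_ge0.
by apply: le_lt_trans (iter_on_setT _ _ (mD u)) _; rewrite iter_setT ltry.
Qed.

Let ptilde_truncE u n : E n * ptilde (trunc F u) n (b * n%:R) =
  (fine (F `]-oo, u]%classic) ^+ n)^-1 * r u n.
Proof.
rewrite /ptilde indE iter_int_trunc; last 2 first.
- apply/measurable_EFinP; apply: measurableT_comp => //; exact: measurable_funB.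
- by move=> x; rewrite lee_fin.
rewrite iterE; last exact: measurable_itv.
by rewrite rE -!EFinM/= mulrCA mulVKf ?gt_eqF ?expR_gt0// exprVn.
Qed.

Let pE n : (p n)%:E = iter_on setT Q n (fun x => (exp_tail th x)%:E) 0.
Proof.
by rewrite iter_setT; congr EFin; apply: eq_Rintegral => x _; rewrite addr0.
Qed.

Let r_le_p u n : r u n <= p n.
Proof. by rewrite -lee_fin -rE pE iter_on_setT. Qed.

(** Tilting has already spent [th], so the exponential moment of order [t] under the tilted law is
    that of order [th + t] under [F]: hence the condition on [th + t]. *)
Let markov_Q u t : 0 < t -> interior (dom_psi F) (th + t) ->
  (Q (~` (A u)) <=
   (expR (- (t * u)) * (moment F 0 (th + t) / moment F 0 th))%:E)%E.
Proof.
move=> t0 it; have m0 := moment0_gt0 ith.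
set D := A u; have mDC : measurable (~` D) by apply: measurableC; exact: mD.
rewrite -[leLHS]mul1e -integral_cst// integral_mkcond QE; last 2 first.
- apply: (measurable_restrictT _ _).1 => //.
- by move=> x; rewrite patchE; case: ifP.
have i0 := integrable_moment' 0 it.
have i0' := integrable_scale (expR (- (t * u)) / moment F 0 th) i0.
have -> : expR (- (t * u)) * (moment F 0 (th + t) / moment F 0 th) =
    \int[F]_x (expR (- (t * u)) / moment F 0 th * (x ^+ 0 * expR ((th + t) * x))).
  by rewrite (RintegralZl _ measurableT i0) mulrCA mulrC.
rewrite -EFin_Rintegral//; apply: ge0_le_integral => //.
- by move=> x _; rewrite mule_ge0 ?lee_fin ?tilt_density_ge0// patchE; case: ifP.
- apply: emeasurable_funM; last by apply/measurable_EFinP; exact: measurable_tilt_density.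
  apply: (@measurableT_comp _ _ _ _ _ _ (patch _ _ _) _ (fun x : R => x - b)).
    by apply: (measurable_restrictT _ _).1.
  exact: measurable_funB.
- exact: (measurable_int _ i0').
move=> x _; rewrite patchE; case: ifP => [xD|_]; last first.
  by rewrite mul0e lee_fin !mulr_ge0 ?expR_ge0// invr_ge0 ltW.
rewrite mul1e lee_fin (tilt_densityE ith) expr0 mul1r.
rewrite [leRHS]mulrAC [leLHS]mulrC ler_wpM2r ?invr_ge0 ?(ltW m0)//.
rewrite -expRD ler_expR mulrDl addrCA lerDl addrC -mulrBr mulr_ge0 ?(ltW t0)//.
move: xD; rewrite inE /D /A/= subrK in_itv/= => /negP; rewrite -ltNge => /ltW.
by rewrite subr_ge0.
Qed.

Let markov_F u t : 0 < t -> interior (dom_psi F) t ->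
  1 - fine (F `]-oo, u]%classic) <= expR (- (t * u)) * moment F 0 t.
Proof.
move=> t0 it; set B : set R := `]-oo, u]%classic.
have mB : measurable B by exact: measurable_itv.
have := probability_setC F mB.
have -> : F B = (fine (F B))%:E by rewrite fineK// fin_num_measure.
rewrite -EFinB => FA; rewrite -lee_fin -FA.
have mDC : measurable (~` B) by exact: measurableC.
rewrite -[leLHS]mul1e -integral_cst// integral_mkcond.
have i0 := integrable_moment' 0 it.
have i0' := integrable_scale (expR (- (t * u))) i0.
rewrite -(RintegralZl _ measurableT i0) -EFin_Rintegral//; apply: ge0_le_integral => //.
- by move=> x _; rewrite patchE; case: ifP.
- by apply: (measurable_restrictT _ _).1.
- exact: (measurable_int _ i0').
move=> x _; rewrite patchE; case: ifP => [xD|_]; last first.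
  by rewrite lee_fin !mulr_ge0 ?expR_ge0.
rewrite lee_fin expr0 mul1r -expRD -[leLHS]expR0 ler_expR addrC -mulrBr mulr_ge0 ?(ltW t0)//.
move: xD; rewrite inE /B/= in_itv/= => /negP; rewrite -ltNge => /ltW.
by rewrite subr_ge0.
Qed.

(** [n > 1] because the uniform bound is applied to the [n - 1] free steps. The 2 in the constant is
    from [sqrt (n + 1) <= 2 sqrt n], which matches the normalization of [n + 1] steps with the bound
    for [n]. *)
Let sub_le : exists2 C, 0 <= C & forall u n, (1 < n)%N ->
  a n * (p n - r u n) <= C * (n%:R * fine (Q (~` (A u)))).
Proof.
have [C C0 HC] := exp_tail_sup_bound (integrable_tilt_pow ith QE 1) (integrable_tilt_pow ith QE 2)
  (integrable_tilt_norm_pow ith QE 3) (tilt_mean0 ith QE psi1) (tilt_variance ith QE psi1) s2_gt0 th_gt0.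
exists (th * Num.sqrt (2 * pi * s2) * 2 * C).
  by rewrite !mulr_ge0// ltW.
move=> u [//|n] n1; set D := A u; have mD' : measurable D by exact: mD.
have me : measurable_fun setT (fun x => (exp_tail th x)%:E).
  by apply/measurable_EFinP; exact: measurable_exp_tail.
have e0 x : (0 <= (exp_tail th x)%:E)%E by rewrite lee_fin exp_tail_ge0.
have mDC : measurable (~` D) by exact: measurableC.
have n0 : (0 < n)%N by [].
have sn : 0 < Num.sqrt n%:R :> R by rewrite sqrtr_gt0 ltr0n.
set q := fine (Q (~` D)); have qE : Q (~` D) = q%:E by rewrite fineK// fin_num_measure.
have q0 : 0 <= q by rewrite fine_ge0.
have h : p n.+1 <= r u n.+1 + n.+1%:R * (C / Num.sqrt n%:R * q).
  rewrite -lee_fin EFinD -rE pE; apply: le_trans (iter_on_trunc_le Q n 0 mD' me e0) _.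
  rewrite leeD2l// EFinM lee_pmul2l// EFinM -qE -integral_cst//.
  apply: ge0_le_integral => //.
  - by move=> x _; exact: iter_on_ge0.
  - apply: (measurable_funS measurableT) => //.
    by apply: measurable_shift; exact: measurable_iter_on.
  - by move=> x _; rewrite iter_setT lee_fin add0r -[x]opprK; exact: HC.
have -> : a n.+1 = th * Num.sqrt (2 * pi * s2) * Num.sqrt n.+1%:R.
  rewrite /a -[RHS]mulrA -sqrtrM; last by rewrite !mulr_ge0 ?pi_ge0// ltW.
  by congr (_ * Num.sqrt _); ring.
rewrite -!mulrA; do 2 rewrite ler_wpM2l ?sqrtr_ge0 ?(ltW th_gt0)//.
have sn2 : Num.sqrt n.+1%:R <= 2 * Num.sqrt n%:R :> R.
  have -> : 2 = Num.sqrt (2 ^+ 2) :> R by rewrite sqrtr_sqr ger0_norm.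
  rewrite -sqrtrM ?sqr_ge0// ler_wsqrtr// -natr1.
  by have : 1 <= n%:R :> R by [rewrite ler1n]; lra.
apply: (@le_trans _ _ (2 * Num.sqrt n%:R * (n.+1%:R * (C / Num.sqrt n%:R * q)))).
  apply: ler_pM => //; first by rewrite subr_ge0 r_le_p.
  by rewrite lerBlDl.
rewrite le_eqVlt; apply/orP; left; apply/eqP.
by field; rewrite gt_eqF.
Qed.

(** The limit [c] is a parameter, so that the lattice and non-lattice cases share the passage to
    [ptilde] and the truncation. *)
Lemma bahadur_rao_trunc (u : nat -> R) (t c : R) : 0 < t -> interior (dom_psi F) (th + t) ->
  n%:R * expR (- (t * u n)) @[n --> \oo] --> (0 : R) -> 0 < c -> a n * p n @[n --> \oo] --> c ->
  [/\ (a n * E n * ptilde F n (b * n%:R)) @[n --> \oo] --> c,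
      (a n * E n * ptilde (trunc F (u n)) n (b * n%:R)) @[n --> \oo] --> c &
      (fun n => ptilde (trunc F (u n)) n (b * n%:R) - ptilde F n (b * n%:R)) =o_\oo
      (fun n => ptilde F n (b * n%:R))].
Proof.
move=> t0 it nu c0 ap.
have th0 := th_gt0; have m0 := moment0_gt0 ith.
pose q n := fine (F `]-oo, (u n)]%classic).
(* [n e^(- t u) < 1] with [n >= 1] forces [u > 0]; this is what gives
   [e^(- (th + t) u) <= e^(- t u)] in the bound on [1 - F(u)]. *)
have u_gt0 : \forall n \near \oo, 0 < u n.
  have /cvgrPdist_lt/(_ _ ltr01) H := nu; near=> n.
  have n1 : (0 < n)%N by near: n; exact: nbhs_infty_gt.
  have : `|0 - n%:R * expR (- (t * u n))| < 1 by near: n.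
  rewrite sub0r normrN ger0_norm ?mulr_ge0 ?expR_ge0// => h.
  have : expR (- (t * u n)) < 1.
    by apply: le_lt_trans h; rewrite ler_peMl ?expR_ge0// ler1n.
  by rewrite -[ltRHS]expR0 ltr_expR oppr_lt0 pmulr_rgt0.
have q1 : q n ^+ n @[n --> \oo] --> (1 : R).
  apply: (@squeeze_cvgr _ _ _ _ (fun n => 1 - n%:R * expR (- (t * u n)) * moment F 0 (th + t)) (cst 1)).
  - near=> n; have u0 : 0 < u n by near: n.
    have q01 : 0 <= q n <= 1.
      rewrite fine_ge0//= -lee_fin fineK ?fin_num_measure//.
      by apply: probability_le1; exact: measurable_itv.
    apply/andP; split; last by rewrite exprn_ile1//; case/andP: q01.
    have -> : q n = 1 - (1 - q n) by ring.
    apply: le_trans (bernoulli_ineq _ _); last by apply/andP; split; lra.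
    rewrite lerD2l lerN2 -mulrA ler_wpM2l//.
    apply: le_trans (markov_F _ _ it) _; first by rewrite addr_gt0.
    rewrite ler_wpM2r ?(ltW (moment0_gt0 it))// ler_expR lerN2 mulrDl lerDr mulr_ge0// ltW//.
  - rewrite -[X in _ --> X]subr0; apply: cvgB; first exact: cvg_cst.
    by rewrite -(mul0r (moment F 0 (th + t))); apply: cvgMl.
  - exact: cvg_cst.
have [C C0 HC] := sub_le.
have apr : a n * (p n - r (u n) n) @[n --> \oo] --> (0 : R).
  apply: (@squeeze_cvgr _ _ _ _ (cst 0)
     (fun n => C * (n%:R * expR (- (t * u n)) * (moment F 0 (th + t) / moment F 0 th)))).
  - near=> n; have n1 : (1 < n)%N by near: n; exact: nbhs_infty_gt.
    apply/andP; split.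
      by rewrite mulr_ge0 ?subr_ge0 ?r_le_p// mulr_ge0 ?sqrtr_ge0// ltW.
    apply: (le_trans (HC (u n) n n1)); rewrite ler_wpM2l// -mulrA ler_wpM2l//.
    rewrite -lee_fin fineK ?markov_Q// fin_num_measure//.
    by apply: measurableC; exact: mD.
  - exact: cvg_cst.
  - rewrite -(mulr0 C) -[X in C * X](mul0r (moment F 0 (th + t) / moment F 0 th)).
    by apply: cvgMr; apply: cvgMl.
have l1 : (a n * E n * ptilde F n (b * n%:R)) @[n --> \oo] --> c.
  by under eq_fun do rewrite -mulrA ptildeE.
have l2 : (a n * E n * ptilde (trunc F (u n)) n (b * n%:R)) @[n --> \oo] --> c.
  under eq_fun do rewrite -mulrA ptilde_truncE.
  have -> : c = 1^-1 * (c - 0) by rewrite invr1 mul1r subr0.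
  rewrite (_ : (fun n => _) =
     (fun n => (q n ^+ n)^-1 * (a n * p n - a n * (p n - r (u n) n)))); last first.
    by apply/funext => n; rewrite /q; ring.
  by apply: cvgM; [apply: cvgV => //; exact: oner_neq0|exact: cvgB].
(* No division by [ptilde]: after the common normalization the difference tends to 0 while
   [ptilde F] eventually stays above [c / 2 > 0]. *)
split=> //; apply/eqoP => e e0.
have l0 : (a n * E n * (ptilde (trunc F (u n)) n (b * n%:R) - ptilde F n (b * n%:R)))
    @[n --> \oo] --> (0 : R).
  under eq_fun do rewrite mulrBr.
  by rewrite -(subrr c); apply: cvgB.
have c2 : 0 < c / 2 by rewrite divr_gt0.
have ec : 0 < e * (c / 2) by rewrite mulr_gt0.
move/cvgrPdist_le : l0 => /(_ _ ec) l0.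
move/cvgrPdist_le : l1 => /(_ _ c2) l1.
near=> n.
have n1 : (0 < n)%N by near: n; exact: nbhs_infty_gt.
have aE0 : 0 < a n * E n.
  by rewrite mulr_gt0 ?expR_gt0// mulr_gt0// sqrtr_gt0 !mulr_gt0 ?pi_gt0// ltr0n.
have h1 : `|c - a n * E n * ptilde F n (b * n%:R)| <= c / 2 by near: n.
have h0 : `|0 - a n * E n * (ptilde (trunc F (u n)) n (b * n%:R) - ptilde F n (b * n%:R))|
   <= e * (c / 2) by near: n.
rewrite -(ler_pM2l aE0); move: h0; rewrite sub0r normrN normrM (gtr0_norm aE0).
move=> /le_trans; apply; rewrite [leRHS]mulrCA ler_pM2l//.
rewrite -[X in X * `|_|](gtr0_norm aE0) -normrM.
apply: le_trans (ler_norm _).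
by move: h1; rewrite ler_norml => /andP[_]; lra.
Unshelve. all: by end_near. Qed.

End main.

Theorem theorem6 (R : realType) (F : probability R R) (b thetas : R)
    (u : nat -> R) :
  mean F < b ->
  interior (dom_psi F) 0 ->
  interior (dom_psi F) thetas ->
  derive1 (psi F) thetas = b ->
  (forall theta, interior (dom_psi F) theta -> derive1 (psi F) theta = b ->
     theta = thetas) ->
  (exists theta' : R, 0 < theta' /\ interior (dom_psi F) (thetas + theta') /\
     (fun n : nat => n%:R * expR (- (theta' * u n))) @ \oo --> (0 : R)) ->
  let a := fun n : nat => thetas * Num.sqrt (2 * pi * n%:R * derive1 (derive1 (psi F)) thetas)
                          * expR (thetas * n%:R * b - n%:R * psi F thetas) in
  let pF := fun n : nat => ptilde F n (b * n%:R) in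
  let pFu := fun n : nat => ptilde (trunc F (u n)) n (b * n%:R) in
  (~ is_lattice F ->
     (fun n => a n * pF n) @ \oo --> (1 : R) /\
     (fun n => a n * pFu n) @ \oo --> (1 : R) /\
     (fun n => pFu n - pF n) =o_\oo pF) /\
  (forall h : R, is_span F h ->
     (0 < F [set b])%E -> (F [set b] < 1)%E ->
     (fun n => a n * pF n) @ \oo --> thetas * h / (1 - expR (- (thetas * h))) /\
     (fun n => a n * pFu n) @ \oo --> thetas * h / (1 - expR (- (thetas * h))) /\
     (fun n => pFu n - pF n) =o_\oo pF).
Proof.
move=> Fb i0 ith psi1 _ [t [t0 [it nu]]] a pF pFu.
have th0 : 0 < thetas by exact: tilt_parameter_gt0 i0 ith Fb psi1.
have [Q QE] := exists_tilt b ith.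
have [L HL] : {L : nat -> probability R R & forall n, is_sum_law Q n (L n)}.
  by apply: choice => n; exact: iter_on_law.
have i1 := integrable_tilt_pow ith QE 1.
have i2 := integrable_tilt_pow ith QE 2.
have i3 := integrable_tilt_norm_pow ith QE 3.
have Qm := tilt_mean0 ith QE psi1; have Qv := tilt_variance ith QE psi1.
split.
- move=> nl.
  (* A point mass at [b] would be lattice, for instance with step 1. *)
  have s20 : 0 < derive1 (derive1 (psi F)) thetas.
    apply: (tilt_variance_gt0 ith QE psi1) => F1; apply: nl; exists b, 1; split => //.
    apply: probability_eq1_sub F1; [exact: measurable_set1|exact: measurable_lattice_set|].
    by move=> x ->; rewrite /lattice_set/= subrr mul0r.
  have lim := nonlattice_limit i1 i2 i3 Qm Qv s20 th0 _ HL.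
  have [|l1 l2 l3] := bahadur_rao_trunc QE ith psi1 th0 s20 HL t0 it nu ltr01; last by [].
  apply: lim => s s0; apply: (tilt_ecf2_lt1 ith QE); first by rewrite gt_eqF.
  by move=> x0 Fx0; apply: nl; exists x0, (2 * pi / s); split; rewrite // divr_gt0 ?mulr_gt0 ?pi_gt0.
- move=> h [h0 [x0 Fx0] hmax] Fb0 Fb1.
  have s20 : 0 < derive1 (derive1 (psi F)) thetas.
    by apply: (tilt_variance_gt0 ith QE psi1) => F1; move: Fb1; rewrite F1 ltxx.
  have Ql := tilt_lattice ith QE h0 Fx0 Fb0.
  have lim := lattice_limit i1 i2 i3 Qm Qv s20 th0 h0 Ql _ HL.
  have c0 : 0 < thetas * h / (1 - expR (- (thetas * h))).
    by rewrite divr_gt0 ?mulr_gt0// subr_gt0 -[ltRHS]expR0 ltr_expR oppr_lt0 mulr_gt0.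
  have [|l1 l2 l3] := bahadur_rao_trunc QE ith psi1 th0 s20 HL t0 it nu c0; last by [].
  (* For [0 < s <= pi / h] the period [2 pi / s] is at least [2 h], beyond the span, so no translate
     of that lattice can carry [F]. *)
  apply: lim => s /andP[s0 sh]; apply: (tilt_ecf2_lt1 ith QE); first by rewrite gt_eqF.
  move=> x1 /hmax; rewrite divr_gt0 ?mulr_gt0 ?pi_gt0// => /(_ isT).
  rewrite ler_pdivrMr// => sh1; move: sh; rewrite ler_pdivlMr// mulrC => sh2.
  by have := @pi_gt0 R; lra.
Qed.
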